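(* For every integer $k \ge 2$, every $n$, every width $w \ge 2$ and every $\varepsilon>0$, and every sequence $S$ over the variables $X=\{x_1,\dots,x_n\}$ in which every variable appears at most $k$ times, there exists a function $G:\{0,1\}^s \to \{0,1\}^n$, computable efficiently (in time polynomial in $n,k,\log w,\log(1/\varepsilon)$) given $S$, where \[ s = O\left( \exp(k^2) \cdot n^{1-1/2^{k-1}} \cdot \log(n) \cdot (\log(n/\varepsilon) + k \log w) \right), \] such that for every function $f:\{0,1\}^n\to\{0,1\}$ computed by a width-$w$ oblivious read-$k$ branching program whose layers read the variables in the order given by $S$, \[ \left| \Pr_{y \sim U_s}[f(G(y))=1] - \Pr_{x\sim U_n}[f(x)=1] \right| \le \varepsilon . \]
   Context: $U_m$ denotes the uniform distribution on $\{0,1\}^m$. A (layered) branching program on variables $X=\{x_1,\dots,x_n\}$ is a directed acyclic graph whose vertices are partitioned into layers, with edges only from one layer to the next, a unique source, two sinks labeled accept and reject, and where every non-sink vertex is labeled by a variable and has two outgoing edges labeled $0$ and $1$; it computes $f(x)=1$ iff the path from the source followed according to $x$ reaches accept. Its width is the maximum number of vertices in a layer. It is oblivious if all vertices in a given layer are labeled by the same variable; the sequence of these labels (layer by layer) is its reading order. An oblivious branching program is read-$k$ if every variable labels at most $k$ layers.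
   Formalization: In the bounds every logarithm is read as max(1, log2), since at n = 1 the literal bound forces s = 0 (false for f(x) = x_1, ε = 1/4) and for very large ε it is negative; for n ≥ 2 and ε ≤ 1 nothing changes. *)

(* Defs.v *)
From mathcomp Require Import all_boot all_order all_algebra.
From mathcomp Require Import all_classical all_reals all_analysis.

Set Implicit Arguments.
Unset Strict Implicit.
Unset Printing Implicit Defensive.

Import Order.TTheory GRing.Theory Num.Theory.

Local Open Scope nat_scope.

(* Layered branching programs over x_0, ..., x_(n-1).  Vertices carry their   *)
(* layer; the sinks are exactly the unlabelled vertices, and the value of     *)
(* [succ] on a sink is never used.  The source is the only vertex of the      *)
(* first layer.  The sinks may lie in any layers, and acyclicity follows from *)
(* [succ_layer].                                                              *)
Record branching_program (n : nat) := BranchingProgram {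
  vertex : finType;
  layer : vertex -> nat;
  source : vertex;
  accept : vertex;
  reject : vertex;
  label : vertex -> option 'I_n;
  succ : vertex -> bool -> vertex;
  source_unique : forall v, (layer v == 0) = (v == source);
  accept_neq_reject : accept != reject;
  sinkE : forall v, (label v == None) = (v \in [:: accept; reject]);
  succ_layer : forall v b, label v != None -> layer (succ v b) = (layer v).+1
}.

Section BranchingProgram.
Variables (n : nat) (B : branching_program n).

Definition bp_step (x : n.-tuple bool) (v : vertex B) : vertex B :=
  if label v is Some i then succ v (tnth x i) else v.

Definition bp_computes (f : n.-tuple bool -> bool) : Prop :=
  forall x, f x = fconnect (bp_step x) (source B) (accept B).

Definition bp_width : nat :=
  \max_(v : vertex B) #|[set u : vertex B | layer u == layer v]|.

Definition oblivious : Prop :=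
  forall u v : vertex B, layer u = layer v ->
    label u != None -> label v != None -> label u = label v.

Definition layers_reading (i : 'I_n) : seq nat :=
  undup [seq layer v | v <- enum [set v : vertex B | label v == Some i]].

Definition read_at_most (k : nat) : Prop :=
  forall i, size (layers_reading i) <= k.

Definition reading_order (S : seq 'I_n) : Prop :=
  forall (l : nat) (i : 'I_n), (l \in layers_reading i) = (onth S l == Some i).

End BranchingProgram.

(* Time is measured in N. Jones's WHILE language (Computability and           *)
(* Complexity from a Programming Perspective, 1997): imperative programs over *)
(* binary trees, unit cost per elementary operation.  Its polynomial time is  *)
(* that of Turing machines: trees are never compared or copied in one step,   *)
(* only shared, so each operation takes constant time on pointers.            *)
Inductive tree := Nil | Cons of tree & tree.

Definition hd (t : tree) := if t is Cons a _ then a else Nil.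
Definition tl (t : tree) := if t is Cons _ b then b else Nil.

Inductive expr :=
  | EVar of nat
  | ENil
  | ECons of expr & expr
  | EHd of expr
  | ETl of expr.

Inductive cmd :=
  | Assign of nat & expr
  | Seq of cmd & cmd
  | If of expr & cmd & cmd
  | While of expr & cmd.

Definition store := nat -> tree.

Definition upd (st : store) (i : nat) (t : tree) : store :=
  fun j => if j == i then t else st j.

Fixpoint eval (st : store) (e : expr) : tree :=
  match e with
  | EVar i => st i
  | ENil => Nil
  | ECons e1 e2 => Cons (eval st e1) (eval st e2)
  | EHd e1 => hd (eval st e1)
  | ETl e1 => tl (eval st e1)
  end.

Fixpoint cost (e : expr) : nat :=
  match e with
  | EVar _ | ENil => 1
  | ECons e1 e2 => (cost e1 + cost e2).+1
  | EHd e1 | ETl e1 => (cost e1).+1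
  end.

(* [exec c st t st']: from store [st], [c] halts in store [st'] after exactly *)
(* [t] time units.  [Nil] is false, every other tree is true.                 *)
Inductive exec : cmd -> store -> nat -> store -> Prop :=
  | ExecAssign st i e :
      exec (Assign i e) st (cost e).+1 (upd st i (eval st e))
  | ExecSeq c1 c2 st1 st2 st3 t1 t2 :
      exec c1 st1 t1 st2 -> exec c2 st2 t2 st3 ->
      exec (Seq c1 c2) st1 (t1 + t2) st3
  | ExecIfTrue e c1 c2 st st' t :
      eval st e <> Nil -> exec c1 st t st' ->
      exec (If e c1 c2) st (cost e + t).+1 st'
  | ExecIfFalse e c1 c2 st st' t :
      eval st e = Nil -> exec c2 st t st' ->
      exec (If e c1 c2) st (cost e + t).+1 st'
  | ExecWhileTrue e c st1 st2 st3 t1 t2 :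
      eval st1 e <> Nil -> exec c st1 t1 st2 -> exec (While e c) st2 t2 st3 ->
      exec (While e c) st1 (cost e + t1 + t2).+1 st3
  | ExecWhileFalse e c st :
      eval st e = Nil -> exec (While e c) st (cost e).+1 st.

(* Variable 0 holds the input initially and the output finally; all other     *)
(* variables start at [Nil].                                                  *)
Definition outputs_in_time (c : cmd) (input : tree) (t : nat) (output : tree) :=
  exists st, exec c (upd (fun=> Nil) 0 input) t st /\ st 0 = output.

Definition enc_seq (T : Type) (enc : T -> tree) (s : seq T) : tree :=
  foldr (fun x => Cons (enc x)) Nil s.

Definition enc_bool (b : bool) : tree := if b then Cons Nil Nil else Nil.

Definition enc_bits (s : seq bool) : tree := enc_seq enc_bool s.

Definition enc_unary (m : nat) : tree := enc_bits (nseq m true).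

(* Least significant bit first, no leading zero; [up_log 2 m.+1] is the bit   *)
(* length of [m].                                                             *)
Definition enc_binary (m : nat) : tree :=
  enc_bits [seq odd (m %/ 2 ^ i) | i <- iota 0 (up_log 2 m.+1)].

Local Open Scope ring_scope.

(* The real accuracy [eps] is handed to the algorithm as the integer          *)
(* ceil(1/eps).  Quantities in which the running time may be polynomial are   *)
(* in unary, those in whose logarithm it is measured are in binary.           *)
Definition generator_input (R : realType) (n k w : nat) (eps : R)
    (S : seq 'I_n) (y : seq bool) : tree :=
  enc_seq id
    [:: enc_unary n; enc_unary k; enc_binary w;
        enc_binary `|Num.ceil eps^-1|%N;
        enc_seq (fun i : 'I_n => enc_unary i) S;
        enc_bits y].

(* Logarithm inside asymptotic bounds, truncated below at 1 so that the       *)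
(* bounds make sense at n <= 1 and eps > 1.  For n >= 2, w >= 2 and eps <= 1, *)
(* [lg n], [lg w] and [lg (n / eps)] are the plain binary logarithms.         *)
Definition lg (R : realType) (x : R) : R := Num.max 1 (ln x / ln 2).

Definition seed_bound (R : realType) (n k w : nat) (eps : R) : R :=
  expR (k%:R ^+ 2) * n%:R `^ (1 - 2 ^- k.-1) * lg n%:R *
  (lg (n%:R / eps) + k%:R * lg w%:R).

Definition time_parameter (R : realType) (n k w : nat) (eps : R) : R :=
  n%:R + k%:R + lg w%:R + lg eps^-1.

Definition prob_unif (R : realType) (m : nat) (E : pred (m.-tuple bool)) : R :=
  #|E|%:R / 2 ^+ m.

(* Main.v *)
(** A variable is named by its first position in S padded to at least k
    occurrences; [key j x] is then the position of the (j+1)-st occurrence of x,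
    and [key 0] is the identity.  By Erdős and Szekeres, n variables split into
    O(sqrt n) parts on each of which a given key is monotone; iterating over
    [key 1], ..., [key k.-1] leaves O(n^(1 - 1/2^(k-1))) parts on which all keys
    are monotone.  For each pair j < j' with keys running in the same direction,
    the intervals from [key j x] to [key j' x] move along the part, and cutting
    it into alternating blocks makes the relation "the intervals of x and y
    overlap" transitive, at the price of a factor 2.

    On such a part, for every initial segment A there are at most 3 thresholds
    per pair (j, j') such that the block of thresholds containing a reading time
    already tells whether the variable read belongs to A.  Hence, the
    other parts being fixed and the program's states at O(k^2) times being
    guessed, A alone and its complement alone verify the guess on the stretches
    where they are read; as just one guess is right, acceptance is a disjoint
    union of w^O(k^2) rectangles.  Nisan's generator, with Toeplitz hashing, needs
    only this property at the cuts of its binary recursion, so it fools the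
    program on one part, and a hybrid argument over the parts, with independent
    seeds, concludes.

    The running time is obtained from a calculus [ptime] of functions between
    encodable types that WHILE programs compute in polynomial time. *)
Require Import Defs.
From mathcomp Require Import all_boot all_order all_algebra.
From mathcomp Require Import all_classical all_reals all_analysis.
From mathcomp Require Import ring lra zify.

Set Implicit Arguments.
Unset Strict Implicit.
Unset Printing Implicit Defensive.

Import Order.TTheory GRing.Theory Num.Theory.
Local Open Scope ring_scope.

(** * Averages over bit strings *)

(** Monotone keys alone are not enough. If two keys increase along a part and A is an initial
    segment, the second reads of A may alternate arbitrarily often with the first reads of its
    complement. Once overlap is transitive, the intervals fall into cliques, and within a clique all
    first reads precede all second reads. Only the clique cut by A mixes both kinds, so the pattern
    is A, not A, A, not A: three changes. For keys running in opposite directions the pattern A, not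
    A, A needs no preparation.

    Errors add up over rectangles and hash discrepancies are exponentially small, so [w ^ O(k^2)]
    rectangles cost only [O(k^2 log w)] further hash bits. The seed bound allows [k log w] there;
    the surplus factor [k] is paid by [exp(k^2)]. Bounding the number of pairs of keys by [k(k-1)],
    block cutting multiplies the number of parts by at most [2 ^ (k(k-1))], and
    [k * 2 ^ (k(k-1)) <= 2 ^ (k^2)]. *)

Section Average.
Variable R : realFieldType.
Implicit Types F G : seq bool -> R.

(** Seeds are plain lists, so that cutting one into consecutive fields ([avg_cat]) involves no
    dependent lengths. [avg_tuple] returns to counting over tuples. *)
Fixpoint avg (m : nat) F : R :=
  if m is m'.+1 then (avg m' (F \o cons true) + avg m' (F \o cons false)) / 2
  else F [::].

Lemma eq_avg m F G :
  (forall s, size s = m -> F s = G s) -> avg m F = avg m G.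
Proof.
elim: m F G => [|m IHm] F G FG /=; first exact: FG.
by congr ((_ + _) / 2); apply: IHm => s sm; apply: FG; rewrite /= sm.
Qed.

Lemma le_avg m F G :
  (forall s, size s = m -> F s <= G s) -> avg m F <= avg m G.
Proof.
elim: m F G => [|m IHm] F G FG /=; first exact: FG.
rewrite ler_pM2r ?invr_gt0 ?ltr0n //; apply: lerD; apply: IHm => s sm;
  by apply: FG; rewrite /= sm.
Qed.

Lemma avg_cst m (c : R) : avg m (fun=> c) = c.
Proof. by elim: m => //= m IHm; rewrite IHm; field. Qed.

Lemma avgD m F G : avg m (fun s => F s + G s) = avg m F + avg m G.
Proof. by elim: m F G => //= m IHm F G; rewrite !IHm; field. Qed.

Lemma avgZ m c F : avg m (fun s => c * F s) = c * avg m F.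
Proof. by elim: m F => //= m IHm F; rewrite !IHm; field. Qed.

Lemma avgZr m c F : avg m (fun s => F s * c) = avg m F * c.
Proof. by rewrite mulrC -avgZ; apply: eq_avg => s _; rewrite mulrC. Qed.

Lemma avgB m F G : avg m (fun s => F s - G s) = avg m F - avg m G.
Proof.
rewrite -mulN1r -avgZ -avgD; apply: eq_avg => s _; by rewrite mulN1r.
Qed.

Lemma avg_sum m (I : finType) (P : pred I) (F : I -> seq bool -> R) :
  avg m (fun s => \sum_(i | P i) F i s) = \sum_(i | P i) avg m (F i).
Proof.
elim: (index_enum I) => [|i r IHr].
  by rewrite big_nil -[RHS](avg_cst m); apply: eq_avg => s _; rewrite big_nil.
rewrite big_cons -IHr; case: ifP => Pi; rewrite -?avgD;
  by apply: eq_avg => s _; rewrite big_cons Pi.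
Qed.

Lemma avg_norm m F : `|avg m F| <= avg m (fun s => `|F s|).
Proof.
elim: m F => //= m IHm F.
rewrite normrM [X in _ * X]ger0_norm ?invr_ge0 ?ler0n //.
rewrite ler_pM2r ?invr_gt0 ?ltr0n //.
exact: le_trans (ler_normD _ _) (lerD (IHm _) (IHm _)).
Qed.

Lemma avg_swap m m' (F : seq bool -> seq bool -> R) :
  avg m (fun s => avg m' (F s)) = avg m' (fun s' => avg m (F^~ s')).
Proof.
elim: m F => //= m IHm F.
rewrite [avg m _]IHm [in X in _ + X]IHm.
by rewrite -avgD -avgZr.
Qed.

Lemma avg_cat m m' F :
  avg (m + m') F = avg m (fun s => avg m' (fun s' => F (s ++ s'))).
Proof. by elim: m F => //= m IHm F; rewrite !IHm. Qed.

Lemma avg_prefix m m' F : avg (m + m') (fun s => F (take m s)) = avg m F.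
Proof.
rewrite avg_cat; apply: eq_avg => s sm.
rewrite -[RHS](avg_cst m'); apply: eq_avg => s' _.
by rewrite take_size_cat.
Qed.

Lemma avg_pred1 m s0 : size s0 = m -> avg m (fun s => (s0 == s)%:R) = 2 ^- m.
Proof.
elim: m s0 => [|m IHm] [|b s0] //= => [_|[sm]]; first by rewrite invr1.
have e c : avg m ((fun s => (b :: s0 == s)%:R) \o cons c) = (b == c)%:R * 2 ^- m :> R.
  rewrite -(IHm s0 sm) -avgZ; apply: eq_avg => s _ /=.
  by rewrite eqseq_cons; case: (b == c); rewrite ?mul1r ?mul0r.
rewrite !e exprS invfM.
by case: (b) => /=; rewrite mul1r mul0r ?addr0 ?add0r mulrC.
Qed.

Lemma avg_head m F : avg m.+1 (fun s => F [:: head false s]) = avg 1 F.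
Proof. by rewrite /= /comp /= !avg_cst. Qed.

Definition xors (s t : seq bool) := [seq p.1 (+) p.2 | p <- zip s t].

Lemma size_xors s t : size s = size t -> size (xors s t) = size t.
Proof. by move=> st; rewrite size_map size_zip st minnn. Qed.

Lemma avg_xors m u F :
  size u = m -> avg m (fun s => F (xors u s)) = avg m F.
Proof.
elim: m u F => [|m IHm] [|b u] F //= [um].
rewrite /comp /=.
rewrite (IHm u (fun s => F (b (+) true :: s))) //.
rewrite (IHm u (fun s => F (b (+) false :: s))) //.
by case: b => //=; rewrite addrC.
Qed.

End Average.

(** * Toeplitz hashing and Nisan's generator *)

Fixpoint inner (a x : seq bool) : bool :=
  match a, x with
  | a0 :: a', x0 :: x' => (a0 && x0) (+) inner a' x'
  | _, _ => false
  end.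

(* The affine map [x |-> M x + b] where row i of the matrix M is [drop i a]; for
   [size a = 2 * size x] no row is truncated. *)
Fixpoint hash (a b x : seq bool) : seq bool :=
  if b is b0 :: b' then (inner a x (+) b0) :: hash (behead a) b' x else [::].

Lemma size_hash a b x : size (hash a b x) = size b.
Proof. by elim: b a => //= b0 b IHb a; rewrite IHb. Qed.

Definition toeplitz (m : nat) (a x : seq bool) := hash a (nseq m false) x.

Lemma size_toeplitz m a x : size (toeplitz m a x) = m.
Proof. by rewrite size_hash size_nseq. Qed.

Lemma hashE a b x : hash a b x = xors (toeplitz (size b) a x) b.
Proof.
rewrite /toeplitz; elim: b a => //= b0 b IHb a.
by rewrite addbF IHb.
Qed.

Lemma inner_xors a x y :
  size x = size y -> inner a (xors x y) = inner a x (+) inner a y.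
Proof.
elim: a x y => [|a0 a IHa] [|x0 x] [|y0 y] //= [xy].
by rewrite -/(xors x y) IHa // andb_addr -!addbA; congr addb; rewrite addbCA.
Qed.

Lemma toeplitz_xors m a x y : size x = size y ->
  toeplitz m a (xors x y) = xors (toeplitz m a x) (toeplitz m a y).
Proof.
move=> xy; rewrite /toeplitz; elim: m a => //= m IHm a.
by rewrite IHm !addbF inner_xors.
Qed.

Lemma xors_cons a s b t : xors (a :: s) (b :: t) = (a (+) b) :: xors s t.
Proof. by []. Qed.

Lemma xorsA s t u : xors (xors s t) u = xors s (xors t u).
Proof.
elim: s t u => [|s0 s IHs] [|t0 t] [|u0 u] //.
by rewrite !xors_cons IHs addbA.
Qed.

Lemma xorsC s t : xors s t = xors t s.
Proof.
by elim: s t => [|s0 s IHs] [|t0 t] //; rewrite !xors_cons IHs addbC.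
Qed.

Lemma xorsKl s t : size s = size t -> xors s (xors s t) = t.
Proof.
elim: s t => [|s0 s IHs] [|t0 t] //= [st].
by rewrite !xors_cons IHs // addbA addbb.
Qed.

Lemma xors_eq0 s t : size s = size t -> true \notin xors s t -> s = t.
Proof.
elim: s t => [|s0 s IHs] [|t0 t] //= [st].
rewrite xors_cons inE negb_or => /andP[h /(IHs _ st) ->].
by congr (_ :: _); case: s0 t0 h => [] [].
Qed.

(** * Discrepancy of Toeplitz hashing on rectangles *)

Section PairwiseIndependence.
Variable R : realFieldType.
Implicit Types F : seq bool -> R.

(** The [true] after [z1] is the last one of the vector, so the bits of [a] behind [b] meet only
    [false], and [b] enters additively. *)
Lemma inner_cat_rcons w b a z1 z2 : size w = size z1 -> true \notin z2 ->
  inner (w ++ b :: a) (z1 ++ true :: z2) = inner w z1 (+) b.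
Proof.
elim: w z1 => [|w0 w IHw] [|z0 z1] //= => [_|[wz]] z20; last first.
  by rewrite IHw // addbA.
rewrite andbT; suff -> : inner a z2 = false by rewrite addbF.
by elim: z2 a z20 => [|[] z2 IHz] [|a0 a] //=; rewrite inE => /IHz ->; rewrite andbF.
Qed.

(** Successive rows are shifts of one bit string, so the entry facing the last [true] of the vector
    is a fresh bit in each row: given the earlier rows, the new output bit is uniform. [w] holds the
    bits to the left of the next fresh one. *)
Lemma avg_toeplitz_window m m' w z1 z2 F :
  size w = size z1 -> true \notin z2 ->
  avg (m + m') (fun a => F (toeplitz m (w ++ a) (z1 ++ true :: z2))) = avg m F.
Proof.
move=> wz z20; elim: m w wz F => [|m IHm] w wz F.
  by rewrite add0n /toeplitz /= avg_cst.
have e b : avg (m + m')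
    ((fun a => F (toeplitz m.+1 (w ++ a) (z1 ++ true :: z2))) \o cons b) =
    avg m (fun s => F ((inner w z1 (+) b) :: s)).
  rewrite -(IHm (behead (rcons w b))); last by rewrite size_behead size_rcons.
  apply: eq_avg => a _; rewrite /= /toeplitz /= addbF inner_cat_rcons //.
  by congr (F (_ :: hash _ _ _)); case: (w) => //= w0 w'; rewrite cat_rcons.
rewrite addSn /= !e.
by case: (inner w z1) => //=; rewrite addrC.
Qed.

Lemma avg_toeplitz m z F : size z = m -> true \in z ->
  avg (m + m) (fun a => F (toeplitz m a z)) = avg m F.
Proof.
move=> zm zt.
have [z1 [z2 [ez z20]]] : exists z1 z2, z = z1 ++ true :: z2 /\ true \notin z2.
  elim: z zt {zm} => //= z0 z IHz; rewrite inE.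
  have [/IHz [z1 [z2 [-> h]]] _|zt] := boolP (true \in z).
    by exists (z0 :: z1), z2.
  by rewrite orbF => /eqP <-; exists [::], z.
(* The bits before the first fresh one, then one fresh bit for each of the [m] rows, then bits that
   never influence the result. *)
have e : (m + m = size z1 + (m + (size z2).+1))%N.
  by rewrite -{2}zm ez size_cat /=; lia.
rewrite e avg_cat -[RHS](avg_cst (size z1)) ez.
apply: eq_avg => w wz; exact: avg_toeplitz_window.
Qed.

Definition avg_hash m (F : seq bool -> seq bool -> R) :=
  avg (m + m) (fun a => avg m (F a)).

(** Translating the shift [b] by the image of [x] preserves averages and turns the two hashes into
    [b] and [b] plus the image of [xors x y]. That vector is nonzero, so for fixed [b] the second
    hash is uniform, and [F] has mean 0. *)
Lemma avg_hash_pair m x y F : size x = m -> size y = m -> x != y ->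
  avg m F = 0 ->
  avg_hash m (fun a b => F (hash a b x) * F (hash a b y)) = 0.
Proof.
move=> xm ym xy F0; rewrite /avg_hash.
pose z := xors x y.
have zm : size z = m by rewrite size_xors ?ym.
transitivity (avg (m + m) (fun a => avg m (fun b =>
    F b * F (xors b (toeplitz m a z))))).
  apply: eq_avg => a _.
  rewrite -(@avg_xors _ m (toeplitz m a x)) ?size_toeplitz //.
  apply: eq_avg => b bm.
  rewrite !hashE !size_xors ?size_toeplitz ?bm // xorsKl ?size_toeplitz ?bm //.
  congr (_ * F _); rewrite toeplitz_xors ?xm // -xorsA xorsC.
  by congr xors; rewrite xorsC.
rewrite avg_swap -[RHS](avg_cst m); apply: eq_avg => b bm.
rewrite avgZ (avg_toeplitz (fun u => F (xors b u))) // ?avg_xors ?F0 ?mulr0 //.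
apply: contraNT xy => /xors_eq0 -> //; by rewrite xm.
Qed.

(** Second moment: in the expanded square, pairs with [x != y] contribute 0 by [avg_hash_pair], and
    the diagonal has weight [2 ^- m]. *)
Lemma avg_hash_sqr m (al : seq bool -> bool) F :
  avg m F = 0 -> (forall s, `|F s| <= 1) ->
  avg_hash m (fun a b => (avg m (fun x => (al x)%:R * F (hash a b x))) ^+ 2)
    <= 2 ^- m.
Proof.
move=> F0 F1; rewrite /avg_hash.
pose H a b x := (al x)%:R * F (hash a b x).
have e a b : (avg m (H a b)) ^+ 2 =
    avg m (fun x => avg m (fun y => H a b x * H a b y)).
  rewrite expr2 -avgZr; apply: eq_avg => x _; by rewrite avgZ.
under eq_avg => a _ do under eq_avg => b _ do rewrite e.
under eq_avg => a _ do rewrite avg_swap.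
rewrite avg_swap.
under eq_avg => x _ do under eq_avg => a _ do rewrite avg_swap.
under eq_avg => x _ do rewrite avg_swap.
apply: (@le_trans _ _ (avg m (fun x => avg m (fun y => (x == y)%:R)))); last first.
  by rewrite -[leRHS](avg_cst m); apply: le_avg => x xm; rewrite avg_pred1.
apply: le_avg => x xm; apply: le_avg => y ym.
have [<-|xy] := eqVneq x y; last first.
  rewrite (_ : avg _ _ = (al x)%:R * (al y)%:R *
    avg_hash m (fun a b => F (hash a b x) * F (hash a b y))).
    by rewrite avg_hash_pair // mulr0.
  rewrite /avg_hash -avgZ; apply: eq_avg => a _; rewrite -avgZ.
  by apply: eq_avg => b _; rewrite /H; ring.
rewrite /= -[leRHS](avg_cst (m + m)); apply: le_avg => a _.
rewrite -[leRHS](avg_cst m); apply: le_avg => b _.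
rewrite -expr2 -real_normK ?num_real // /H normrM.
apply: exprn_ile1; first by rewrite mulr_ge0.
by apply: mulr_ile1 => //; case: (al x); rewrite ?normr0 ?normr1.
Qed.

(* The square root of Cauchy-Schwarz is avoided by
   [|D| <= (D^2 / d + d) / 2] at [d = 2 ^- m]. *)
Lemma avg_hash_discrepancy m (al be : seq bool -> bool) :
  avg_hash m.*2 (fun a b =>
    `|avg m.*2 (fun x => (al x)%:R * (be (hash a b x))%:R)
      - avg m.*2 (fun x => (al x)%:R) * avg m.*2 (fun x => (be x)%:R)|)
  <= 2 ^- m.
Proof.
pose f (s : seq bool -> bool) x : R := (s x)%:R.
set l := m.*2; rewrite -/(f al) -/(f be); set mu := avg l (f be).
have mu01 : 0 <= mu <= 1.
  apply/andP; split.
    by rewrite -(avg_cst l 0); apply: le_avg => s _; rewrite ler0n.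
  by rewrite -(avg_cst l 1); apply: le_avg => s _; rewrite lern1 leq_b1.
(* Centring turns the discrepancy into one average involving a function of mean 0, to which
   [avg_hash_sqr] applies at length [l]. *)
pose F s : R := f be s - mu.
have F0 : avg l F = 0 by rewrite avgB avg_cst subrr.
have F1 s : `|F s| <= 1.
  case/andP: mu01 => mu0 mu1; rewrite /F /f ler_norml.
  by case: (be s); rewrite /= ?mulr1n ?mulr0n; apply/andP; split; lra.
have d0 : 0 < 2 ^- m :> R by rewrite invr_gt0 exprn_gt0.
have lm : 2 ^- l = 2 ^- m * 2 ^- m :> R.
  by rewrite -invfM -exprD /l addnn.
have := avg_hash_sqr al F0 F1; rewrite /avg_hash lm => sq.
set D := fun a b => avg l (fun x => (al x)%:R * F (hash a b x)).
apply: (@le_trans _ _ (avg (l + l) (fun a => avg l (fun b =>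
   ((2 ^- m)^-1 * D a b ^+ 2 + 2 ^- m) / 2)))).
  apply: le_avg => a _; apply: le_avg => b _.
  have -> : avg l (fun x => f al x * f be (hash a b x)) - avg l (f al) * mu
    = D a b.
    rewrite /D -avgZr -avgB; apply: eq_avg => x _.
    by rewrite /F mulrBr.
  move: (D a b) => x; rewrite -(real_normK (num_real x)).
  move: (`|x|) => {}x; move: d0; set d := 2 ^- m => d0.
  rewrite -subr_ge0.
  have -> : (d^-1 * x ^+ 2 + d) / 2 - x = d^-1 * (x - d) ^+ 2 / 2.
    by field; rewrite gt_eqF.
  apply: mulr_ge0; last by rewrite invr_ge0.
  by apply: mulr_ge0; [rewrite invr_ge0 ltW | exact: sqr_ge0].
under eq_avg => a _ do rewrite avgZr avgD avgZ avg_cst.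
rewrite avgZr avgD avgZ avg_cst.
move: sq; rewrite -/D; set A := avg _ _; set d := 2 ^- m in d0 *.
move=> Ad; have : d^-1 * A <= d by rewrite ler_pdivrMl.
lra.
Qed.

End PairwiseIndependence.

Definition expand (h : seq bool * seq bool) (l : seq (seq bool)) :=
  flatten [seq [:: v; hash h.1 h.2 v] | v <- l].

Definition leaves (hs : seq (seq bool * seq bool)) (l : seq (seq bool)) :=
  foldl (fun l h => expand h l) l hs.

(** The head of [hs] acts at the root of the tree. Each leaf contributes a single bit, so leaf
    positions are output positions. *)
Definition nisan hs x := map (head false) (leaves hs [:: x]).

(* [l + l] bits for the Toeplitz matrix and [l] for the shift, j times. *)
Fixpoint parse_hashes (l j : nat) (u : seq bool) :=
  if j is j'.+1
  then (take (l + l) u, take l (drop (l + l) u))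
         :: parse_hashes l j' (drop (l + l + l) u)
  else [::].

Lemma size_parse_hashes l j u : size (parse_hashes l j u) = j.
Proof. by elim: j u => //= j IHj u; rewrite IHj. Qed.

Lemma leaves_cat hs l1 l2 : leaves hs (l1 ++ l2) = leaves hs l1 ++ leaves hs l2.
Proof.
elim: hs l1 l2 => //= h hs IHhs l1 l2.
by rewrite -IHhs /expand map_cat flatten_cat.
Qed.

Lemma nisan_cons h hs x :
  nisan (h :: hs) x = nisan hs x ++ nisan hs (hash h.1 h.2 x).
Proof. by rewrite /nisan /= -map_cat -leaves_cat. Qed.

Lemma size_nisan hs x : size (nisan hs x) = (2 ^ size hs)%N.
Proof.
elim: hs x => //= h hs IHhs x.
by rewrite nisan_cons size_cat !IHhs addnn -mul2n expnS.
Qed.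

Lemma parse_hashes_cat l j u v : size u = (l + l + l)%N ->
  parse_hashes l j.+1 (u ++ v) =
  (take (l + l) u, take l (drop (l + l) u)) :: parse_hashes l j v.
Proof.
move=> ul; have al : size (take (l + l) u) = (l + l)%N.
  by rewrite size_takel ?ul ?leq_addr.
have bl : size (drop (l + l) u) = l by rewrite size_drop ul addKn.
rewrite -(cat_take_drop (l + l) u); move: al bl.
move: (take _ u) (drop _ u) => a b al bl /=.
rewrite [drop (l + l + l) _]drop_size_cat ?size_cat ?al ?bl // -catA.
have ta w : take (l + l) (a ++ w) = a by rewrite take_size_cat.
have da w : drop (l + l) (a ++ w) = w by rewrite drop_size_cat.
by rewrite !ta !da take_size_cat // take_oversize ?bl.
Qed.

(* The families [al], [be] may depend only on the lengths of the two windows and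
   of the prefix: the same hash functions serve all fixed surroundings of a block,
   and only the subset P of rectangles changes with them. *)
Definition rectangular (K : nat) (F : seq bool -> bool) :=
  forall o m1 m2, exists (Q : finType) (al be : Q -> seq bool -> bool),
    (#|Q| <= K)%N /\
    forall pre post, size pre = o -> exists P : pred Q,
      forall s1 s2, size s1 = m1 -> size s2 = m2 ->
      (F (pre ++ s1 ++ s2 ++ post) : nat)
        = (\sum_(q | P q) al q s1 * be q s2)%N.

Section Nisan.
Variable R : realFieldType.

Lemma avg_split_hash l (G : seq bool -> seq bool -> R) :
  avg (l + l + l) (fun u => G (take (l + l) u) (take l (drop (l + l) u)))
  = avg_hash l G.
Proof.
rewrite avg_cat; apply: eq_avg => a al; apply: eq_avg => b bl.
by rewrite take_size_cat // drop_size_cat // take_oversize ?bl.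
Qed.

(** One bound [B hs] has to serve all surroundings: in the recursion the prefix of the right half is
    the output of the left half, produced by the same hash functions. The factor [2 ^+ j - 1] counts
    the inner nodes of the recursion tree, each paying [K%:R * 2 ^- m]. *)
Lemma nisan_block (m K : nat) (F : seq bool -> bool) (j o : nat) :
  (0 < m)%N -> rectangular K F ->
  exists B : seq (seq bool * seq bool) -> R,
  (forall hs pre post, size hs = j -> size pre = o ->
     `|avg m.*2 (fun x => (F (pre ++ nisan hs x ++ post))%:R)
       - avg (2 ^ j) (fun z => (F (pre ++ z ++ post))%:R)| <= B hs) /\
  avg (j * (m.*2 + m.*2 + m.*2)) (fun u => B (parse_hashes m.*2 j u))
    <= (2 ^+ j - 1) * (K%:R * 2 ^- m).
Proof.
move=> m0 rF; elim: j o => [|j IHj] o.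
  exists (fun=> 0); split; last by rewrite avg_cst expr0 subrr mul0r.
  move=> [|//] pre post _ _; rewrite (_ : avg _ _ = avg (2 ^ 0)%N
     (fun z => (F (pre ++ z ++ post))%:R)) ?subrr ?normr0 //.
  rewrite -(prednK (_ : 0 < m.*2)%N) ?double_gt0 //.
  exact: (avg_head _ (fun z => (F (pre ++ z ++ post))%:R)).
have [B1 [B1P B1avg]] := IHj o.
have [B2 [B2P B2avg]] := IHj (o + 2 ^ j)%N.
have [Q [al [be [QK QP]]]] := rF o (2 ^ j)%N (2 ^ j)%N.
set l := m.*2 in B1P B1avg B2P B2avg *.
pose f (s : seq bool -> bool) hs x : R := (s (nisan hs x))%:R.
(* The sum runs over all of [Q], not only over the rectangles selected by [P], because [D] must not
   depend on [pre] and [post]. *)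
pose D hs a b : R := \sum_q
  `|avg l (fun x => f (al q) hs x * f (be q) hs (hash a b x))
    - avg l (f (al q) hs) * avg l (f (be q) hs)|.
exists (fun hs => B1 (behead hs) + B2 (behead hs)
   + D (behead hs) (head ([::], [::]) hs).1 (head ([::], [::]) hs).2).
split; last first.
  rewrite mulSn avg_cat.
  under eq_avg => u ul do under eq_avg => v vl do
    rewrite parse_hashes_cat //=.
  under eq_avg => u ul do rewrite !avgD.
  rewrite !avgD !avg_cst avg_swap.
  have DK hs : avg_hash l (D hs) <= K%:R * 2 ^- m.
    rewrite /avg_hash; under eq_avg => a _ do rewrite avg_sum.
    rewrite avg_sum; apply: (@le_trans _ _ (\sum_(q : Q) 2 ^- m)).
      by apply: ler_sum => q _; exact: (avg_hash_discrepancy R m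
         (fun x => al q (nisan hs x)) (fun x => be q (nisan hs x))).
    rewrite sumr_const -[leLHS]mulr_natl; apply: ler_wpM2r.
      by rewrite invr_ge0 exprn_ge0.
    by rewrite ler_nat.
  apply: (le_trans (lerD (lerD B1avg B2avg)
    (_ : _ <= avg (j * (l + l + l)) (fun=> K%:R * 2 ^- m)))).
    by apply: le_avg => v _; have := DK (parse_hashes l j v); rewrite -avg_split_hash.
  rewrite avg_cst exprS; lra.
case=> // h hs pre post [hsj] preo.
pose t s : R := (F (pre ++ s ++ post))%:R.
have -> : avg l (fun x => (F (pre ++ nisan (h :: hs) x ++ post))%:R) =
    avg l (fun x => t (nisan hs x ++ nisan hs (hash h.1 h.2 x))).
  by apply: eq_avg => x _; rewrite nisan_cons.
(* [M1] gives the halves independent inputs; [M2] moreover makes the right half uniform. Passing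
   between [M3] and [M2] and between [M2] and [M1] are the two recursive calls; passing between [M1]
   and [A] is the discrepancy of the new hash. *)
pose M1 := avg l (fun x => avg l (fun y => t (nisan hs x ++ nisan hs y))).
pose M2 := avg l (fun x => avg (2 ^ j) (fun z => t (nisan hs x ++ z))).
have -> : avg (2 ^ j.+1) (fun z => (F (pre ++ z ++ post))%:R) =
    avg (2 ^ j) (fun z => avg (2 ^ j) (fun z' => t (z ++ z'))).
  by rewrite expnS mul2n -addnn avg_cat.
set A := avg l _; set M3 := avg (2 ^ j) _.
have -> : A - M3 = (M2 - M3) + (M1 - M2) + (A - M1) by ring.
apply: (le_trans (ler_normD _ _)); apply: lerD.
  apply: (le_trans (ler_normD _ _)); apply: lerD.
    rewrite /M2 /M3 avg_swap [X in _ - X]avg_swap -avgB.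
    apply: (le_trans (avg_norm _ _)); rewrite /= -[leRHS](avg_cst (2 ^ j)).
    apply: le_avg => z' z'j.
    have := B1P hs pre (z' ++ post) hsj preo.
    congr (`| _ - _| <= _); apply: eq_avg => z _; by rewrite /t -!catA.
  rewrite /M1 /M2 -avgB.
  apply: (le_trans (avg_norm _ _)); rewrite /= -[leRHS](avg_cst l).
  apply: le_avg => x _.
  have := B2P hs (pre ++ nisan hs x) post hsj.
  rewrite size_cat size_nisan hsj preo => /(_ erefl).
  by congr (`| _ - _| <= _); apply: eq_avg => z _; rewrite /t -!catA.
have [P PP] := QP pre post preo.
have tE s1 s2 : size s1 = (2 ^ j)%N -> size s2 = (2 ^ j)%N ->
    t (s1 ++ s2) = \sum_(q | P q) (al q s1)%:R * (be q s2)%:R.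
  move=> s1j s2j; rewrite /t -catA PP // natr_sum.
  by apply: eq_bigr => q _; rewrite natrM.
have sn x : size (nisan hs x) = (2 ^ j)%N by rewrite size_nisan hsj.
rewrite /A /M1.
under eq_avg => x _ do rewrite tE //.
under [X in _ - X]eq_avg => x _ do under eq_avg => y _ do rewrite tE //.
under [X in _ - X]eq_avg => x _ do rewrite avg_sum.
rewrite !avg_sum -sumrB /D /=.
apply: (le_trans (ler_norm_sum _ _ _)).
rewrite [leRHS](bigID P) /= -[leLHS]addr0; apply: lerD; last first.
  by apply: sumr_ge0 => q _; exact: normr_ge0.
apply: ler_sum => q Pq; rewrite le_eqVlt; apply/orP; left; apply/eqP.
congr (`| _ - _|); rewrite -avgZr; apply: eq_avg => x _; by rewrite avgZ.
Qed.

Lemma nisan_fools (m K j : nat) (F : seq bool -> bool) :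
  (0 < m)%N -> rectangular K F ->
  `|avg m.*2 (fun x => avg (j * (m.*2 + m.*2 + m.*2)) (fun u =>
       (F (nisan (parse_hashes m.*2 j u) x))%:R))
    - avg (2 ^ j) (fun z => (F z)%:R)| <= 2 ^+ j * (K%:R * 2 ^- m) :> R.
Proof.
move=> m0 rF; have [B [BP Bavg]] := nisan_block j 0 m0 rF.
rewrite avg_swap -[X in _ - X](avg_cst (j * (m.*2 + m.*2 + m.*2))) -avgB.
apply: (le_trans (avg_norm _ _)).
apply: (@le_trans _ _ ((2 ^+ j - 1) * (K%:R * 2 ^- m))); last first.
  apply: ler_wpM2r; last by lra.
  by rewrite mulr_ge0 // invr_ge0 exprn_ge0.
apply: le_trans Bavg; apply: le_avg => u _.
have := BP (parse_hashes m.*2 j u) [::] [::] (size_parse_hashes _ _ _) erefl.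
by congr (`| _ - _| <= _); apply: eq_avg => z _; rewrite /= cats0.
Qed.

End Nisan.

(** * Splitting the variables into parts *)

Section MonotonePartition.
Local Open Scope nat_scope.

Definition longest (ls : seq (seq nat)) : seq nat :=
  foldr (fun c b => if size b < size c then c else b) [::] ls.

Lemma longest_max ls c : c \in ls -> size c <= size (longest ls).
Proof.
elim: ls => //= b ls IHls; rewrite inE => /orP[/eqP ->|/IHls cl];
  case: ltnP => // bl; exact: leq_trans cl (ltnW bl).
Qed.

Lemma longest_mem ls : longest ls != [::] -> longest ls \in ls.
Proof.
elim: ls => //= b ls IHls; case: ifP => _; rewrite inE ?eqxx //.
by move=> /IHls ->; rewrite orbT.
Qed.

Variable f : nat -> nat.
Implicit Types (T p : seq nat).

(* For each element, a longest increasing chain ending there, listed downwards. *)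
Definition chains T : seq (seq nat) :=
  foldl (fun tbl e =>
    (e :: longest [seq c <- tbl | f (head 0 c) < f e]) :: tbl) [::] T.

Lemma chains_rcons T e :
  chains (rcons T e) =
  (e :: longest [seq c <- chains T | f (head 0 c) < f e]) :: chains T.
Proof. by rewrite /chains foldl_rcons. Qed.

Lemma map_head_chains T : [seq head 0 c | c <- chains T] = rev T.
Proof.
by elim/last_ind: T => // T e IHT; rewrite chains_rcons /= IHT rev_rcons.
Qed.

Lemma chains_nil T : [::] \notin chains T.
Proof. by elim/last_ind: T => // T e IHT; rewrite chains_rcons inE. Qed.

Definition below x y := (y < x) && (f y < f x).

Lemma chains_pairwise T c : pairwise ltn T -> c \in chains T ->
  pairwise below c /\ {subset c <= T}.
Proof.
elim/last_ind: T c => // T e IHT c; rewrite pairwise_rcons => /andP[/allP Te' sT].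
have Te x : x \in T -> x < e by move=> /Te'.
rewrite chains_rcons inE => /orP[/eqP ->|/(IHT _ sT)[pc cT]]; last first.
  by split=> // x /cT xT; rewrite mem_rcons inE xT orbT.
set l := longest _; have [l0|lN] := eqVneq l [::].
  by rewrite l0; split=> // x; rewrite mem_rcons !inE => ->.
have := longest_mem lN; rewrite mem_filter -/l => /andP[fl lc].
have [pl lT] := IHT _ sT lc; case: (l) lN fl pl lT => //= h r _ fh /andP[hr pr] lT.
have hT : h \in T by apply: lT; rewrite inE eqxx.
have he : below e h by rewrite /below fh Te.
split.
  rewrite he pr hr !andbT; apply/allP => y /(allP hr) /andP[yh fyh].
  by case/andP: he => he fhe; rewrite /below (ltn_trans yh he) (ltn_trans fyh fhe).
move=> x; rewrite mem_rcons !inE => /orP[->//|xl]; apply/orP; right.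
by apply: lT; rewrite inE.
Qed.

(** The dichotomy of Erdős and Szekeres: a chain ending at the smaller element can be prolonged by
    the larger one, so two elements with longest chains of equal length never increase in both
    position and value. *)
Lemma chains_height T c c' : pairwise ltn T ->
  c \in chains T -> c' \in chains T ->
  head 0 c' < head 0 c -> f (head 0 c') < f (head 0 c) -> size c' < size c.
Proof.
elim/last_ind: T c c' => // T e IHT c c'.
rewrite pairwise_rcons => /andP[/allP Te' sT]; rewrite chains_rcons !inE.
have Te x : x \in T -> x < e by move=> /Te'.
have hT b : b \in chains T -> head 0 b < e.
  move=> bT; apply: Te; rewrite -mem_rev -map_head_chains.
  exact: map_f.
move=> /orP[/eqP ->|cT] /orP[/eqP ->|c'T] /= hh ff.
- by rewrite ltnn in hh.
- by rewrite ltnS; apply: longest_max; rewrite mem_filter ff.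
- by have := hT _ cT; rewrite ltnNge (ltnW hh).
- exact: (IHT c c').
Qed.

Definition extract (st : seq nat * seq (seq nat)) :=
  let c := longest (chains st.1) in
  if size st.2 < size c
  then ([seq e <- st.1 | e \notin c], [seq e <- st.1 | e \in c] :: st.2)
  else st.

(* Once no chain is longer than the number of chains extracted, the elements whose
   longest chain has a given size form a decreasing class. *)
Definition monotone_partition T : seq (seq nat) :=
  let st := iter (size T) extract (T, [::]) in
  st.2 ++
  [seq [seq head 0 c | c <- [seq c <- rev (chains st.1) | size c == h]]
    | h <- iota 1 (size st.2)].

Definition monotone p :=
  (forall x y, x \in p -> y \in p -> x < y -> f x < f y) \/
  (forall x y, x \in p -> y \in p -> x < y -> f y < f x).

(** The last clause is the sum 1 + ... + m: a chain is taken only if it is longer than the number of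
    chains already taken. *)
Definition extract_inv T (st : seq nat * seq (seq nat)) :=
  [/\ subseq st.1 T,
      forall p, p \in st.2 -> subseq p T /\ monotone p,
      perm_eq (flatten (st.1 :: st.2)) T
    & size st.2 * (size st.2).+1 <= 2 * size (flatten st.2)].

Lemma subseq_pairwise_ltn p T : subseq p T -> pairwise ltn T -> pairwise ltn p.
Proof. exact: subseq_pairwise. Qed.

Lemma pairwise_ltn_uniq T : pairwise ltn T -> uniq T.
Proof. by apply: pairwise_uniq => x; rewrite /= ltnn. Qed.

Lemma extract_invP T st : pairwise ltn T -> extract_inv T st ->
  extract_inv T (extract st).
Proof.
case: st => r cs sT [/= rT csT pe sz]; rewrite /extract /=.
case: ltnP => //= lt; set c := longest _ in lt *.
have sr := subseq_pairwise_ltn rT sT.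
have cN : c != [::] by case: (c) lt.
have [pc cr] := chains_pairwise sr (longest_mem cN).
have crT : subseq [seq e <- r | e \in c] T.
  exact: subseq_trans (filter_subseq _ _) rT.
split=> /=.
- exact: subseq_trans (filter_subseq _ _) rT.
- move=> p; rewrite inE => /orP[/eqP ->|/csT//]; split=> //; left=> x y.
  rewrite !mem_filter => /andP[xc _] /andP[yc _] xy.
  have xc' : index x c < size c by rewrite index_mem.
  have yc' : index y c < size c by rewrite index_mem.
  have [lxy|lyx|exy] := ltngtP (index x c) (index y c).
  + have := pairwiseP 0 pc (index x c) (index y c) xc' yc' lxy.
    by rewrite /below !nth_index // ltnNge (ltnW xy).
  + have := pairwiseP 0 pc (index y c) (index x c) yc' xc' lyx.
    by rewrite /below !nth_index // => /andP[].
  + by move: xy; rewrite -(nth_index 0 xc) exy nth_index // ltnn.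
- apply: perm_trans pe; rewrite catA perm_cat2r.
  by rewrite perm_catC perm_filterC.
- rewrite size_cat; have -> : size [seq e <- r | e \in c] = size c.
    apply/perm_size/uniq_perm.
    + by rewrite filter_uniq // pairwise_ltn_uniq.
    + by apply: pairwise_uniq pc => x; rewrite /below ltnn.
    + by move=> x; rewrite mem_filter; case: (boolP (x \in c)) => //= /cr.
  by nia.
Qed.

Definition extracted (st : seq nat * seq (seq nat)) :=
  size (longest (chains st.1)) <= size st.2.

Lemma extract_step T st : pairwise ltn T -> extract_inv T st ->
  ~~ extracted st -> size (extract st).1 < size st.1.
Proof.
case: st => r cs sT [/= rT csT pe sz]; rewrite /extracted -ltnNge /extract /=.
move=> lt; rewrite lt /=; set c := longest _ in lt *.
have cN : c != [::] by case: (c) lt.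
have [_ cr] := chains_pairwise (subseq_pairwise_ltn rT sT) (longest_mem cN).
rewrite size_filter -[X in _ < X](count_predC (mem c)) -[X in X < _]add0n.
rewrite ltn_add2r -has_count; apply/hasP; exists (head 0 c).
  by apply: cr; rewrite -/c; case: (c) cN => //= x s; rewrite mem_head.
by case: (c) cN => //= x s; rewrite mem_head.
Qed.

(** A step before the stopping condition removes at least one element, so [size T] rounds
    suffice. *)
Lemma iter_extractP T i : pairwise ltn T ->
  let st := iter i extract (T, [::]) in
  extract_inv T st /\ (extracted st \/ size st.1 + i <= size T).
Proof.
move=> sT /=; elim: i => [|i [inv IHi]].
  split; last by right; rewrite addn0.
  by split=> //=; rewrite cats0.
rewrite iterS; set st := iter _ _ _ in inv IHi *; split; first exact: extract_invP.
have [ex|nex] := boolP (extracted st).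
  by left; move: (ex); rewrite /extracted leqNgt => /negbTE; rewrite /extract => ->.
case: IHi => [ex|le]; first by rewrite ex in nex.
right; apply: leq_trans le; rewrite addnS -addSn leq_add2r.
exact: extract_step inv nex.
Qed.

Lemma perm_flatten_classes (T : eqType) (g : T -> nat) m (s : seq T) :
  (forall x, x \in s -> 0 < g x <= m) ->
  perm_eq (flatten [seq [seq x <- s | g x == h] | h <- iota 1 m]) s.
Proof.
elim: m s => [|m IHm] s gs.
  by case: s gs => // x s /(_ x); rewrite inE eqxx => /(_ isT); lia.
rewrite -[m.+1]addn1 iotaD map_cat flatten_cat /= cats0 add1n.
rewrite perm_sym -(perm_filterC (fun x => g x == m.+1) s) perm_catC perm_sym perm_cat2r.
have := IHm [seq x <- s | predC (fun x => g x == m.+1) x].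
have -> : [seq [seq x <- [seq x <- s | predC (fun x => g x == m.+1) x] | g x == h]
    | h <- iota 1 m] = [seq [seq x <- s | g x == h] | h <- iota 1 m].
  apply/eq_in_map => h; rewrite mem_iota => hm; rewrite -filter_predI.
  apply: eq_in_filter => x xs /=; case: eqP => // -> /=.
  by apply/eqP; lia.
apply=> x; rewrite mem_filter /= => /andP[/eqP xm /gs]; lia.
Qed.

(** With [m] extracted chains and [m] decreasing classes, [(2m)^2 <= 4m(m+1) <= 8 * size T].
    Injectivity makes the decreasing classes strictly decreasing. *)
Lemma monotone_partitionP T : pairwise ltn T ->
  [/\ perm_eq (flatten (monotone_partition T)) T,
      forall p, p \in monotone_partition T ->
        subseq p T /\ ({in T &, injective f} -> monotone p)
    & size (monotone_partition T) ^ 2 <= 8 * size T].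
Proof.
move=> sT; rewrite /monotone_partition /=.
have [[rT csT pe sz] ex] := iter_extractP (size T) sT.
set st := iter _ _ _ in rT csT pe sz ex *.
have sr := subseq_pairwise_ltn rT sT.
have {}ex : extracted st.
  case: ex => // le; rewrite /extracted (_ : st.1 = [::]) //.
  by apply: size0nil; lia.
have hd1 : [seq head 0 c | c <- rev (chains st.1)] = st.1.
  by rewrite map_rev map_head_chains revK.
split.
- rewrite flatten_cat; apply: perm_trans pe; rewrite /= perm_catC perm_cat2r.
  rewrite (_ : map _ (iota _ _) = map (map (head 0))
    [seq [seq c <- rev (chains st.1) | size c == h] | h <- iota 1 (size st.2)]);
    last by rewrite -map_comp.
  rewrite -map_flatten -{2}hd1.
  apply/perm_map/perm_flatten_classes => c; rewrite mem_rev => cc.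
  rewrite (leq_trans (longest_max cc) ex) andbT lt0n size_eq0.
  by apply: contraTneq cc => ->; exact: chains_nil.
- move=> p; rewrite mem_cat => /orP[/csT[]//|/mapP[h _ ->]]; split.
    apply: subseq_trans rT; rewrite -{2}hd1.
    exact: map_subseq (filter_subseq _ _).
  move=> finj; right=> x y /mapP[c]; rewrite mem_filter mem_rev => /andP[/eqP ch cc] ->.
  move=> /mapP[c']; rewrite mem_filter mem_rev => /andP[/eqP c'h c'c] -> lt.
  have inT b : b \in chains st.1 -> head 0 b \in T.
    by move=> bc; apply: (mem_subseq rT); rewrite -mem_rev -map_head_chains map_f.
  rewrite ltn_neqAle; apply/andP; split.
    apply/eqP => /finj e; move: lt; rewrite e ?inT //; by rewrite ltnn.
  rewrite leqNgt; apply/negP => ff.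
  by have := chains_height sr c'c cc lt ff; rewrite ch c'h ltnn.
- rewrite size_cat size_map size_iota addnn -mul2n expnMn.
  have : size (flatten st.2) <= size T.
    by rewrite -(perm_size pe) /= size_cat leq_addl.
  move: sz; set m := size st.2; nia.
Qed.

End MonotonePartition.

(** * Cutting a part into alternating blocks of overlapping intervals *)

Section BlockSplit.
Local Open Scope nat_scope.
Variable ov : rel nat.
Implicit Types (T p : seq nat).

(* A block starts whenever [ov] fails between its leader l and the next element;
   blocks are collected alternately, with current colour c. *)
Fixpoint scan (l : nat) (c : bool) T : seq nat * seq nat :=
  if T is e :: T' then
    let c' := if ov l e then c else ~~ c in
    let r := scan (if ov l e then l else e) c' T' in
    if c' then (r.1, e :: r.2) else (e :: r.1, r.2)
  else ([::], [::]).

Definition block_split T :=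
  let r := scan (head 0 T) false T in [:: r.1; r.2].

(** Holds for overlap when the intervals move in one direction ([overlap_convex]). It allows
    comparisons with the leader alone to decide about all pairs of a block. *)
Definition convex T := forall x y z w,
  x \in T -> y \in T -> z \in T -> w \in T ->
  x <= y -> y <= z -> z <= w -> ov x w -> ov y z.

(** [b] numbers the blocks, starting with the current one [m]; colours are parities. By convexity a
    block is a clique, as its leader overlaps its last element, and elements whose numbers differ by
    at least 2 enclose the leaders of two consecutive blocks, which do not overlap. The middle
    clauses carry this through the induction. *)
Lemma scanP T0 l m T : pairwise ltn T -> (forall x, x \in T -> l <= x) ->
  {subset l :: T <= T0} -> convex T0 ->
  exists b : nat -> nat,
  [/\ scan l (odd m) T = ([seq x <- T | ~~ odd (b x)], [seq x <- T | odd (b x)]),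
      forall x, x \in T -> (b x = m -> ov l x) /\
        (m < b x -> exists y, [/\ y \in T, y <= x & ~~ ov l y]),
      forall x, x \in T -> m.+1 < b x ->
        exists y z, [/\ y \in T, z \in T, y <= z, z <= x & ~~ ov y z],
      forall x, x \in T -> m <= b x
    & forall x y, x \in T -> y \in T -> x < y ->
        [/\ b x <= b y, b x = b y -> ov x y & (b x).+1 < b y -> ~~ ov x y]].
Proof.
move=> sT lT sub cv; elim: T l m sT lT sub => [|e T IHT] l m.
  by move=> _ _ _; exists id; split.
move=> /= /andP[/allP eT sT] lT sub.
have le : l <= e by apply: lT; rewrite inE eqxx.
have e0 : e \in T0 by apply: sub; rewrite !inE eqxx orbT.
have T00 x : x \in T -> x \in T0 by move=> xT; apply: sub; rewrite !inE xT !orbT.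
have eN : e \notin T by apply/negP => /eT; rewrite /= ltnn.
have [m' [l' [em' el' l'0 el'e]]] : exists m' l',
    [/\ (if ov l e then odd m else ~~ odd m) = odd m',
        (if ov l e then l else e) = l', l' \in T0 & l' <= e /\
        (if ov l e then m' = m /\ l' = l else m' = m.+1 /\ l' = e)].
  case: (ov l e); [exists m, l | exists m.+1, e]; split=> //.
  by apply: sub; rewrite inE eqxx.
have lT' x : x \in T -> l' <= x.
  by move=> /eT xe; apply: leq_trans (ltnW xe); case: el'e.
have sub' : {subset l' :: T <= T0}.
  by move=> x; rewrite inE => /orP[/eqP ->//|/T00].
have [b [scanE b1 b2 b3 b4]] := IHT l' m' sT lT' sub'.
pose b' x := if x == e then m' else b x.
have b'T x : x \in T -> b' x = b x.
  by rewrite /b'; case: eqP => // -> eT'; rewrite eT' in eN.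
have b'e : b' e = m' by rewrite /b' eqxx.
exists b'; split.
- rewrite em' el' scanE b'e /=.
  have f1 : [seq x <- T | ~~ odd (b' x)] = [seq x <- T | ~~ odd (b x)].
    by apply: eq_in_filter => x /b'T ->.
  have f2 : [seq x <- T | odd (b' x)] = [seq x <- T | odd (b x)].
    by apply: eq_in_filter => x /b'T ->.
  by rewrite f1 f2; case: (odd m').
- move=> x; rewrite inE => /orP[/eqP ->|xT].
    rewrite b'e; case: el'e => _; case: (boolP (ov l e)) => ole [-> _].
      by split=> //; rewrite ltnn.
    split=> [|_]; first by move/eqP; rewrite -[_ == _]/(m.+1 == m) eqn_leq ltnn.
    by exists e; rewrite inE eqxx.
  rewrite b'T //; case: el'e => _; case: (boolP (ov l e)) => ole [mm ll].
    rewrite -mm -ll; have [c1 c2] := b1 x xT; split=> // /c2[y [yT yx oy]].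
    by exists y; rewrite inE yT orbT.
  split=> [bm|_]; first by have := b3 x xT; rewrite bm mm ltnn.
  by exists e; split=> //; [rewrite inE eqxx | exact/ltnW/eT].
- move=> x; rewrite inE => /orP[/eqP ->|xT].
    by rewrite b'e; case: el'e => _; case: (ov l e) => -[-> _]; rewrite ?ltnn // ltnNge leqnSn.
  rewrite b'T //; case: el'e => _; case: (boolP (ov l e)) => ole [mm ll].
    rewrite -mm => /(b2 x xT)[y [z [yT zT yz zx oyz]]].
    by exists y, z; rewrite !inE yT zT !orbT.
  rewrite -mm => /(proj2 (b1 x xT))[y [yT yx oy]].
  exists e, y; rewrite !inE eqxx yT orbT; split=> //; last by rewrite -ll.
  exact/ltnW/eT.
- move=> x; rewrite inE => /orP[/eqP ->|xT].
    by rewrite b'e; case: el'e => _; case: (ov l e) => -[-> _].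
  rewrite b'T //; apply: leq_trans (b3 x xT).
  by case: el'e => _; case: (ov l e) => -[-> _].
- move=> x y; rewrite !inE => /orP[/eqP ->|xT] /orP[/eqP ->|yT] xy.
  + by rewrite ltnn in xy.
  + rewrite b'e b'T //; split; first exact: b3.
    * move=> /esym by'; have [/(_ by') ol _] := b1 y yT.
      by apply: (cv l' e y y) => //; [exact: T00 | exact: T00 | case: el'e | exact: ltnW].
    * move=> /(b2 y yT)[z [w [zT wT zw wy]]]; apply: contra => oey.
      apply: (cv e z w y) => //; try exact: T00.
      exact/ltnW/eT.
  + by have := eT x xT; rewrite /= ltnNge (ltnW xy).
  + by rewrite !b'T //; exact: b4.
Qed.

(** Blocks of one colour have numbers of equal parity, so distinct ones differ by at least 2: within
    a colour, [ov] means lying in the same block. *)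
Lemma block_splitP T : pairwise ltn T -> convex T ->
  (forall x, x \in T -> ov x x) -> symmetric ov ->
  perm_eq (flatten (block_split T)) T /\
  forall p, p \in block_split T -> subseq p T /\
    forall x y z, x \in p -> y \in p -> z \in p -> ov x y -> ov y z -> ov x z.
Proof.
case: T => [|e T] sT cv ovxx ovC.
  by split=> // p; rewrite /block_split /= !inE orbb => /eqP ->.
set T0 := e :: T in sT cv ovxx *.
have sub : {subset e :: T0 <= T0} by move=> x; rewrite inE => /orP[/eqP ->|//]; rewrite inE eqxx.
have lT x : x \in T0 -> e <= x.
  rewrite inE => /orP[/eqP ->//|xT]; apply: ltnW.
  by move: sT => /= /andP[/allP/(_ x xT)].
have [b [sE _ _ _ bP]] := @scanP T0 e 0 T0 sT lT sub cv.
rewrite /block_split -[head 0 _]/e -[false]/(odd 0) sE.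
clearbody T0 => /=.
split.
  rewrite cats0 perm_catC; apply/permPl.
  exact: (perm_filterC (fun x => odd (b x))).
have ovE c x y : odd (b x) = c -> odd (b y) = c -> x \in T0 -> y \in T0 ->
    ov x y = (b x == b y).
  move=> bx by' xT yT; wlog: x y bx by' xT yT / x <= y.
    move=> W; have [xy|yx] := leqP x y; first exact: W.
    by rewrite ovC eq_sym W // ltnW.
  rewrite leq_eqVlt => /orP[/eqP ->|xy]; first by rewrite eqxx ovxx.
  have [bxy be bn] := bP x y xT yT xy.
  have [/be//|ne] := eqVneq (b x) (b y); apply/negbTE/bn.
  have : b x < b y by rewrite ltn_neqAle ne.
  rewrite leq_eqVlt => /orP[/eqP eS|//].
  by move: by'; rewrite -eS /= bx; case: (c).
move=> p; rewrite !inE => pE.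
have [c pc] : exists c, p = [seq x <- T0 | odd (b x) == c].
  case/orP: pE => /eqP ->; [exists false | exists true];
    by apply: eq_filter => x; case: (odd _).
split=> [|x y z]; first by rewrite pc filter_subseq.
rewrite pc !mem_filter => /andP[/eqP xc xT] /andP[/eqP yc yT] /andP[/eqP zc zT].
rewrite (ovE c x y) // (ovE c y z) // (ovE c x z) //.
by move=> /eqP -> /eqP ->.
Qed.

End BlockSplit.

(** * Separating an initial segment from its complement by three thresholds *)

Section Thresholds.
Local Open Scope nat_scope.

(** [M] is the value of an empty minimum. In the other case the minimiser is kept, because its
    interval is needed and not just the value. *)
Lemma exists_min_in (g : nat -> nat) (P : pred nat) M (p : seq nat) :
  exists d, (forall x, x \in p -> P x -> d <= g x) /\
    ((forall x, x \in p -> ~~ P x) /\ d = M \/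
     exists x, [/\ x \in p, P x & d = g x]).
Proof.
elim: p => [|e p [d [dP [[pN dM]|[x [xp Px dx]]]]]].
- by exists M; split=> //; left.
- have [Pe|Pe] := boolP (P e).
    exists (g e); split; last by right; exists e; rewrite inE eqxx.
    move=> x; rewrite inE => /orP[/eqP ->//|/pN /negP //].
  exists d; split.
    by move=> x; rewrite inE => /orP[/eqP ->|/dP//]; rewrite (negbTE Pe).
  by left; split=> // x; rewrite inE => /orP[/eqP ->|/pN].
- case: (boolP (P e && (g e < d))) => [/andP[Pe gd]|h].
    exists (g e); split; last by right; exists e; rewrite inE eqxx.
    move=> y; rewrite inE => /orP[/eqP ->//|/dP dy /dy].
    exact/leq_trans/ltnW.
  exists d; split; last by right; exists x; rewrite inE xp orbT.
  move=> y; rewrite inE => /orP[/eqP ->|/dP//] Pe.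
  by move: h; rewrite Pe /= -leqNgt.
Qed.

Definition side d1 d2 d3 q := (q < d1) || (d2 <= q < d3).

Lemma side_const d1 d2 d3 q q' : q <= q' ->
  (forall d, d \in [:: d1; d2; d3] -> ~~ (q < d <= q')) ->
  side d1 d2 d3 q = side d1 d2 d3 q'.
Proof.
move=> qq' h.
have lt d : d \in [:: d1; d2; d3] -> (q < d) = (q' < d).
  by move=> /h; lia.
rewrite /side !lt ?inE ?eqxx ?orbT // [d2 <= q]leqNgt [d2 <= q']leqNgt.
by rewrite lt // !inE eqxx orbT.
Qed.

Definition overlap (a b : nat -> nat) : rel nat :=
  fun x y => (a x < b y) && (a y < b x).

(** [d1] is the first [a]-read outside [t]. For keys in opposite directions, every read outside [t]
    lies between [d1] and the first [b]-read inside. For codirected keys, the [b]-reads inside end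
    before [d3], the first one outside, and transitivity of overlap keeps [a]-reads outside [t] from
    falling between [d2] and [d3]. *)
Lemma thresholds_ordered (a b : nat -> nat) (p : seq nat) (t : pred nat) :
  (forall x, x \in p -> a x < b x) ->
  (forall x y, x \in p -> y \in p -> x != y -> a x != b y) ->
  (forall x y, x \in p -> y \in p -> t x -> ~~ t y -> a x < a y) ->
  ((forall x y, x \in p -> y \in p -> t x -> ~~ t y -> b x < b y) /\
   (forall x y z, x \in p -> y \in p -> z \in p ->
      overlap a b x y -> overlap a b y z -> overlap a b x z)) \/
  (forall x y, x \in p -> y \in p -> t x -> ~~ t y -> b y < b x) ->
  exists d1 d2 d3, forall x, x \in p ->
    side d1 d2 d3 (a x) = t x /\ side d1 d2 d3 (b x) = t x.
Proof.
move=> ab anb ta tb.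
pose M := (\max_(x <- p) b x).+1.
have bM x : x \in p -> b x < M by move=> xp; rewrite ltnS; exact: leq_bigmax_seq.
have aM x : x \in p -> a x < M by move=> xp; apply: ltn_trans (bM x xp); exact: ab.
have [d1 [d1P d1E]] := exists_min_in a (predC t) M p.
have ltd1 x : x \in p -> t x -> a x < d1.
  move=> xp tx; case: d1E => [[_ ->]|[y [yp ty ->]]]; first exact: aM.
  exact: ta.
case: tb => [[tb tr]|tb]; last first.
  have [d2 [d2P d2E]] := exists_min_in b t M p.
  exists d1, d2, M => x xp; rewrite /side; have [tx|tx] := boolP (t x).
    by rewrite ltd1 // d2P // bM // orbT.
  have d1a : d1 <= a x by exact: d1P.
  have bd2 : b x < d2 by case: d2E => [[_ ->]|[y [yp ty ->]]]; [exact: bM | exact: tb].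
  have := ab x xp; split; apply/negbTE; lia.
have [d3 [d3P d3E]] := exists_min_in b (predC t) M p.
have ltd3 x : x \in p -> t x -> b x < d3.
  move=> xp tx; case: d3E => [[_ ->]|[y [yp ty ->]]]; first exact: bM.
  exact: tb.
(* The [b]-reads of [t] before [d1] are already classified correctly by [d1]. *)
have [d2 [d2P d2E]] := exists_min_in b (fun x => t x && (d1 < b x)) M p.
exists d1, d2, d3 => x xp; rewrite /side; have [tx|tx] := boolP (t x).
  rewrite ltd1 // ltd3 //; split=> //.
  have [//|db /=] := ltnP (b x) d1; rewrite andbT; apply: d2P => //.
  rewrite tx ltn_neqAle db andbT /=.
  case: d1E => [[pN ->]|[y [yp ty ->]]]; first by have := bM x xp; lia.
  by apply: anb => //; apply: contraNneq (ty : ~~ t y) => ->.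
have d1a : d1 <= a x by exact: d1P.
have d3b : d3 <= b x by exact: d3P.
have axb := ab x xp.
split; last by apply/negbTE; lia.
suff : (d2 <= a x) ==> (d3 <= a x) by move=> h; apply/negbTE; lia.
apply/implyP => d2a.
case: d2E => [[_ d2M]|[e [ep /andP[te d1e] d2e]]]; first by have := aM x xp; lia.
case: d1E => [[/(_ x xp)]|[r [rp tr0 d1r]]]; first by rewrite /= tx.
(* [e] realises [d2] and [r] realises [d1]. They overlap, and [e] ends no later than [x] begins; so
   [r] does not overlap [x] either, whence [d3 <= b r <= a x]. *)
have oer : overlap a b e r.
  by rewrite /overlap -d1r d1e andbT; have := ab r rp; have := ta e r ep rp te tr0; lia.
have noex : ~~ overlap a b e x by rewrite /overlap; lia.
have norx : ~~ overlap a b r x by apply: contra noex; exact: (tr e r x).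
have := d3P r rp tr0; move: norx; rewrite /overlap; lia.
Qed.

(** When [a] decreases along the part, the complement of [s] is read first: the ordered statement is
    then applied to [predC s] and the answer negated. *)
Lemma thresholds (a b : nat -> nat) (p : seq nat) (s : pred nat) :
  (forall x, x \in p -> a x < b x) ->
  (forall x y, x \in p -> y \in p -> x != y -> a x != b y) ->
  monotone a p -> monotone b p ->
  ((forall x y, x \in p -> y \in p -> (a x < a y) = (b x < b y)) ->
   forall x y z, x \in p -> y \in p -> z \in p ->
      overlap a b x y -> overlap a b y z -> overlap a b x z) ->
  (forall x y, x \in p -> y \in p -> x < y -> s y -> s x) ->
  exists D : seq nat, size D = 3 /\ exists g : nat -> bool,
    (forall q q', q <= q' -> (forall d, d \in D -> ~~ (q < d <= q')) -> g q = g q')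
    /\ forall x, x \in p -> g (a x) = s x /\ g (b x) = s x.
Proof.
move=> ab anb ma mb tr sP.
have sx x y : x \in p -> y \in p -> s x -> ~~ s y -> x < y.
  move=> xp yp sx sy; rewrite ltnNge leq_eqVlt; apply/negP => /orP[/eqP e|yx].
    by move: sy; rewrite e sx.
  by move: sy; rewrite (sP y x).
have codir (c : bool) : (forall x y, x \in p -> y \in p -> x < y -> if c then a x < a y else a y < a x) ->
    (forall x y, x \in p -> y \in p -> x < y -> if c then b x < b y else b y < b x) ->
    forall x y, x \in p -> y \in p -> (a x < a y) = (b x < b y).
  move=> ca cb x y xp yp; have [xy|yx|->] := ltngtP x y; last by rewrite !ltnn.
    have := ca x y xp yp xy; have := cb x y xp yp xy; case: c {ca cb} => [-> -> //|]; lia.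
  have := ca y x yp xp yx; have := cb y x yp xp yx; case: c {ca cb} => [|-> -> //]; lia.
have concl (c : bool) : (exists d1 d2 d3, forall x, x \in p ->
    side d1 d2 d3 (a x) = c (+) s x /\ side d1 d2 d3 (b x) = c (+) s x) ->
  exists D : seq nat, size D = 3 /\ exists g : nat -> bool,
    (forall q q', q <= q' -> (forall d, d \in D -> ~~ (q < d <= q')) -> g q = g q')
    /\ forall x, x \in p -> g (a x) = s x /\ g (b x) = s x.
  move=> [d1 [d2 [d3 dP]]]; exists [:: d1; d2; d3]; split=> //.
  exists (fun q => c (+) side d1 d2 d3 q); split.
    by move=> q q' qq' h; rewrite (side_const qq' h).
  by move=> x /dP[-> ->]; rewrite addbA addbb.
case: ma => ma.
  apply: (concl false); apply: (thresholds_ordered (t := s)) => //.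
    by move=> x y xp yp s1 s2; apply: ma => //; exact: sx.
  case: mb => mb; last by right=> x y xp yp s1 s2; apply: mb => //; exact: sx.
  left; split; first by move=> x y xp yp s1 s2; apply: mb => //; exact: sx.
  by apply: tr; exact: (codir true).
apply: (concl true); apply: (thresholds_ordered (t := predC s)) => //.
  by move=> x y xp yp /= s1; rewrite negbK => s2; apply: ma => //; exact: sx.
case: mb => mb.
  by right=> x y xp yp /= s1; rewrite negbK => s2; apply: mb => //; exact: sx.
left; split.
  by move=> x y xp yp /= s1; rewrite negbK => s2; apply: mb => //; exact: sx.
by apply: tr; exact: (codir false).
Qed.

Lemma overlap_convex (a b : nat -> nat) p :
  (forall x, x \in p -> a x < b x) -> monotone a p -> monotone b p ->
  (forall x y, x \in p -> y \in p -> (a x < a y) = (b x < b y)) ->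
  convex (overlap a b) p.
Proof.
move=> ab ma mb co x y z w xp yp zp wp xy yz zw.
have mle (c : nat -> nat) : (forall u v, u \in p -> v \in p -> u < v -> c u < c v) ->
    forall u v, u \in p -> v \in p -> u <= v -> c u <= c v.
  move=> h u v up vp; rewrite leq_eqVlt => /orP[/eqP ->//|uv].
  exact/ltnW/h.
have mge (c : nat -> nat) : (forall u v, u \in p -> v \in p -> u < v -> c v < c u) ->
    forall u v, u \in p -> v \in p -> u <= v -> c v <= c u.
  move=> h u v up vp; rewrite leq_eqVlt => /orP[/eqP ->//|uv].
  exact/ltnW/h.
have xz := leq_trans xy yz; have yw := leq_trans yz zw.
have ay := ab y yp; have az := ab z zp.
case: ma => ma.
  have mb' u v : u \in p -> v \in p -> u < v -> b u < b v.
    by move=> up vp uv; rewrite -co // ma.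
  have := mle _ ma z w zp wp zw; have := mle _ ma y z yp zp yz.
  have := mle _ mb' x y xp yp xy; have := mle _ mb' y z yp zp yz.
  rewrite /overlap; lia.
have mb' u v : u \in p -> v \in p -> u < v -> b v < b u.
  by move=> up vp uv; rewrite -co // ma.
have := mge _ ma x y xp yp xy; have := mge _ ma y z yp zp yz.
have := mge _ mb' z w zp wp zw; have := mge _ mb' y z yp zp yz.
rewrite /overlap; lia.
Qed.

End Thresholds.

Section BlockSplitAny.
Variable ov : rel nat.

(** Valid for every relation and list, so all parts can be split blindly, including those on which
    two keys run in opposite directions. *)
Lemma scan_partition l c T :
  perm_eq ((scan ov l c T).1 ++ (scan ov l c T).2) T /\
  (subseq (scan ov l c T).1 T /\ subseq (scan ov l c T).2 T).
Proof.
elim: T l c => //= e T IHT l c.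
move: (if ov l e then l else e) (if ov l e then c else ~~ c) => l' c'.
have [p1 [s1 s2]] := IHT l' c'.
case: c' p1 s1 s2 => p1 s1 s2 /=; rewrite eqxx.
  rewrite perm_catC /= perm_cons perm_catC; split=> //; split=> //.
  exact: subseq_trans s1 (subseq_cons _ _).
rewrite perm_cons; split=> //; split=> //.
exact: subseq_trans s2 (subseq_cons _ _).
Qed.

Lemma perm_block_split T : perm_eq (flatten (block_split ov T)) T.
Proof. by rewrite /block_split /= cats0; case: (scan_partition (head 0%N T) false T). Qed.

Lemma subseq_block_split T p : p \in block_split ov T -> subseq p T.
Proof.
have [_ [s1 s2]] := scan_partition (head 0%N T) false T.
by rewrite /block_split !inE => /orP[] /eqP ->.
Qed.

End BlockSplitAny.

(** * Iterated refinement and the number of parts *)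

Section Parts.
Local Open Scope nat_scope.

(** Dropping empty pieces keeps the number of parts at most [size D] and the encoding of a partition
    linear in that of [D]. *)
Definition refine (f : seq nat -> seq (seq nat)) (P : seq (seq nat)) :=
  [seq p <- flatten [seq f p | p <- P] | ~~ nilp p].

Definition index_pairs k :=
  flatten [seq [seq (j, j') | j' <- iota j.+1 (k - j.+1)] | j <- iota 0 k].

Definition nonempty_part (D : seq nat) := [seq p <- [:: D] | ~~ nilp p].
Arguments nonempty_part : simpl never.

(** Monotone splitting starts at key 1 because key 0 is the identity. Block cutting is applied to
    every pair without testing directions; between opposite keys it is harmless. *)
Definition parts (K : nat -> nat -> nat) (D : seq nat) (k : nat) :=
  foldl (fun P jj => refine (block_split (overlap (K jj.1) (K jj.2))) P)
    (foldl (fun P j => refine (monotone_partition (K j)) P)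
       (nonempty_part D) (iota 1 k.-1))
    (index_pairs k).

Lemma mem_index_pairs k j j' : ((j, j') \in index_pairs k) = (j < j' < k).
Proof.
apply/flatten_mapP/idP => [[i]|/andP[jj jk]].
  by rewrite mem_iota => ik /mapP[i']; rewrite mem_iota => ii [-> ->]; lia.
exists j; first by rewrite mem_iota /= add0n (ltn_trans jj).
by apply/mapP; exists j' => //; rewrite mem_iota; lia.
Qed.

Lemma size_index_pairs k : size (index_pairs k) <= k * k.-1.
Proof.
rewrite /index_pairs; set s := iota 0 k; rewrite -[X in _ <= X * _](size_iota 0 k) -/s.
elim: s => //= j s IHs; rewrite size_cat size_map size_iota mulSn leq_add //.
by lia.
Qed.

Lemma perm_flatten_filter (P : seq (seq nat)) :
  flatten [seq p <- P | ~~ nilp p] = flatten P.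
Proof. by elim: P => //= -[|x p] P /= ->. Qed.

Definition subparts (D : seq nat) (P : seq (seq nat)) :=
  perm_eq (flatten P) D /\ forall p, p \in P -> ~~ nilp p /\ subseq p D.

Lemma refineP (D : seq nat) f P (Q : seq nat -> Prop) :
  (forall p, subseq p D -> perm_eq (flatten (f p)) p /\
     forall q, q \in f p -> subseq q p /\ Q q) ->
  subparts D P ->
  subparts D (refine f P) /\
  forall q, q \in refine f P -> Q q /\ exists2 p, p \in P & subseq q p.
Proof.
move=> fP [PD Pp].
have step q : q \in refine f P -> exists p, [/\ p \in P, q \in f p & ~~ nilp q].
  by rewrite mem_filter => /andP[nq /flatten_mapP[p pP qp]]; exists p.
split; first split.
- apply: perm_trans PD; rewrite perm_flatten_filter.
  elim: P Pp {step} => //= p P IHP Pp; rewrite flatten_cat; apply: perm_cat.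
    by apply: (fP p _).1; apply: (Pp p _).2; rewrite inE eqxx.
  by apply: IHP => q qP; apply: Pp; rewrite inE qP orbT.
- move=> q /step[p [pP qp nq]]; split=> //; have pD := (Pp p pP).2.
  exact: subseq_trans ((fP p pD).2 q qp).1 pD.
- move=> q /step[p [pP qp nq]]; have pD := (Pp p pP).2.
  by split; [exact: ((fP p pD).2 q qp).2 | exists p => //; exact: ((fP p pD).2 q qp).1].
Qed.

Lemma size_refine f P : size (refine f P) <= sumn [seq size (f p) | p <- P].
Proof.
rewrite size_filter (leq_trans (count_size _ _)) // size_flatten /shape -map_comp.
by rewrite leqnn.
Qed.

(** Cauchy-Schwarz. The mixed term is bounded by [nat_Cauchy] after multiplication by the length,
    which keeps everything in integers. *)
Lemma sumn_sqr (I : Type) (g : I -> nat) (s : seq I) :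
  sumn [seq g i | i <- s] ^ 2 <= size s * sumn [seq g i ^ 2 | i <- s].
Proof.
elim: s => //= i s; move: (sumn _) (sumn _) (size s) (g i) => Q S n a IH.
rewrite -!mulnn in IH *; have [n0|n0] := posnP n.
  by move: IH; rewrite n0 mul0n leqn0 muln_eq0 orbb => /eqP ->; nia.
suff : 2 * (a * S) <= n * (a * a) + Q by nia.
have := nat_Cauchy (n * a) S; rewrite -!mulnn => h.
rewrite -(leq_pmul2l n0) mulnCA [n * (a * S)]mulnA.
have e : n * (n * (a * a)) = n * a * (n * a) by rewrite mulnACA mulnA.
by apply: (leq_trans h); rewrite mulnDr e leq_add2l.
Qed.

Lemma refine_count (D : seq nat) f P c : subparts D P ->
  (forall p, subseq p D -> size (f p) ^ 2 <= c * size p) ->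
  size (refine f P) ^ 2 <= c * size P * size D.
Proof.
move=> [PD Pp] fc; apply: (@leq_trans (sumn [seq size (f p) | p <- P] ^ 2)).
  by rewrite leq_exp2r // size_refine.
apply: leq_trans (sumn_sqr _ _) _; rewrite -mulnA mulnCA leq_mul2l; apply/orP; right.
rewrite -(perm_size PD) size_flatten /shape.
elim: P Pp {PD} => [|p P IHP] Pp; first by rewrite muln0.
rewrite /= mulnDr leq_add //; last first.
  by apply: IHP => q qP; apply: Pp; rewrite inE qP orbT.
by apply: fc; apply: (Pp p _).2; rewrite inE eqxx.
Qed.

(** The recurrence [N' <= sqrt(c N d)] is solved by [N <= c d^(1 - 1/2^j)]; powers [2 ^ j] avoid the
    roots. This is the origin of the exponent of [n] in the seed length. *)
Lemma count_root N N' c d j : N' ^ 2 <= c * N * d ->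
  N ^ (2 ^ j) <= c ^ (2 ^ j) * d ^ (2 ^ j - 1) ->
  N' ^ (2 ^ j.+1) <= c ^ (2 ^ j.+1) * d ^ (2 ^ j.+1 - 1).
Proof.
move=> h h'; have e0 : 0 < 2 ^ j by rewrite expn_gt0.
rewrite expnS expnM; apply: (@leq_trans ((c * N * d) ^ (2 ^ j))).
  by rewrite leq_exp2r.
rewrite !expnMn mulnAC mul2n -addnn expnD -!mulnA leq_mul2l; apply/orP; right.
have -> : 2 ^ j + 2 ^ j - 1 = 2 ^ j + (2 ^ j - 1) by lia.
by rewrite expnD mulnCA leq_mul2l h' orbT.
Qed.

Variables (K : nat -> nat -> nat) (D : seq nat) (k : nat).
Hypothesis k_gt0 : 0 < k.
Hypothesis D_lt : pairwise ltn D.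
Hypothesis K0 : forall x, x \in D -> K 0 x = x.
Hypothesis K_lt : forall x j j', x \in D -> j < j' -> j' < k -> K j x < K j' x.
Hypothesis K_neq : forall x y j j', x \in D -> y \in D -> j < k -> j' < k ->
  x != y -> K j x != K j' y.

Definition codirected a b (p : seq nat) :=
  forall x y : nat, x \in p -> y \in p -> (a x < a y) = (b x < b y).

Definition overlap_trans a b (p : seq nat) :=
  forall x y z, x \in p -> y \in p -> z \in p ->
    overlap a b x y -> overlap a b y z -> overlap a b x z.

Lemma subseq_monotone f (p q : seq nat) :
  subseq q p -> monotone f p -> monotone f q.
Proof.
move=> /mem_subseq qp [] m; [left|right] => x y /qp xp /qp; exact: m.
Qed.

Lemma monotone_phase m : m < k ->
  let P := foldl (fun P j => refine (monotone_partition (K j)) P)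
    (nonempty_part D) (iota 1 m) in
  [/\ subparts D P, forall p j, p \in P -> j <= m -> monotone (K j) p
    & size P ^ (2 ^ m) <= 8 ^ (2 ^ m) * size D ^ (2 ^ m - 1)].
Proof.
elim: m => [|m IHm] mk.
  split=> /=.
  - split; first by rewrite /nonempty_part perm_flatten_filter /= cats0.
    move=> p; rewrite mem_filter inE => /andP[np /eqP pD].
    by rewrite -pD np subseq_refl.
  - move=> p [|//]; rewrite mem_filter inE => /andP[np /eqP ->] _.
    by left=> x y xD yD xy; rewrite !K0.
  - by rewrite expn0 !expn1 subnn expn0 muln1 /nonempty_part /=; case: ifP.
have [sP mP cP] := IHm (ltnW mk).
have -> : iota 1 m.+1 = rcons (iota 1 m) m.+1 by rewrite -[X in iota _ X]addn1 iotaD cats1.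
rewrite foldl_rcons /=; set P := foldl _ _ _ in sP mP cP *.
have fP p : subseq p D -> [/\ perm_eq (flatten (monotone_partition (K m.+1) p)) p,
     forall q, q \in monotone_partition (K m.+1) p -> subseq q p /\ monotone (K m.+1) q
   & size (monotone_partition (K m.+1) p) ^ 2 <= 8 * size p].
  move=> pD; have [h1 h2 h3] := monotone_partitionP (K m.+1) (subseq_pairwise_ltn pD D_lt).
  split=> // q /h2[qp mq]; split=> //; apply: mq => x y /(mem_subseq pD) xD /(mem_subseq pD) yD /eqP exy.
  by apply/eqP; apply: contraLR exy => xy; exact: K_neq.
have [sR rP] := refineP (fun p pD => let: And3 h1 h2 _ := fP p pD in conj h1 h2) sP.
split=> //.
  move=> p j pR; rewrite leq_eqVlt => /orP[/eqP ->|jm]; first by case: (rP p pR).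
  have [_ [p' p'P pp']] := rP p pR; apply: subseq_monotone pp' _.
  by apply: mP => //; lia.
apply: count_root cP; apply: refine_count => // p pD.
by case: (fP p pD).
Qed.

(** A subpart may be codirected where the larger part is not. But keys monotone in opposite
    directions on [p] disagree on any two elements, so such a [q] has at most one. *)
Lemma overlap_trans_sub a b (p q : seq nat) :
  subseq q p -> monotone a p -> monotone b p ->
  (codirected a b p -> overlap_trans a b q) ->
  codirected a b q -> overlap_trans a b q.
Proof.
move=> /mem_subseq qp ma mb tr co x y z xq yq zq.
have co' : (forall u v, u \in p -> v \in p -> u < v -> (a u < a v) = (b u < b v) /\ (a v < a u) = (b v < b u)) ->
    codirected a b p.
  move=> h u v up vp; have [uv|vu|->] := ltngtP u v; last by rewrite !ltnn.
    exact: (h u v up vp uv).1.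
  exact: (h v u vp up vu).2.
have lt2 m n : m < n -> (n < m) = false by move=> mn; apply/negbTE; rewrite -leqNgt ltnW.
have single : (forall u v, u < v -> u \in q -> v \in q -> False) ->
    overlap a b x y -> overlap a b y z -> overlap a b x z.
  move=> h; have eq u v : u \in q -> v \in q -> u = v.
    by move=> uq vq; case: (ltngtP u v) => // /h; case.
  by rewrite (eq x y) // (eq z y).
have tr' : codirected a b p -> overlap a b x y -> overlap a b y z -> overlap a b x z.
  by move=> /tr; apply.
case: ma mb => ma [] mb.
- apply/tr'/co' => u v up vp uv.
  have au := ma u v up vp uv; have bu := mb u v up vp uv.
  by rewrite au bu (lt2 _ _ au) (lt2 _ _ bu).
- apply: single => u v uv uq vq; have := co u v uq vq.
  by rewrite ma ?qp // lt2 // mb ?qp.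
- apply: single => u v uv uq vq; have := co u v uq vq.
  by rewrite mb ?qp // lt2 // ma ?qp.
- apply/tr'/co' => u v up vp uv.
  have au := ma u v up vp uv; have bu := mb u v up vp uv.
  by rewrite au bu (lt2 _ _ au) (lt2 _ _ bu).
Qed.

Lemma block_phase L P0 : (forall jj, jj \in L -> jj.1 < jj.2 < k) ->
  subparts D P0 -> (forall p j, p \in P0 -> j < k -> monotone (K j) p) ->
  let P := foldl (fun P jj => refine (block_split (overlap (K jj.1) (K jj.2))) P) P0 L in
  [/\ subparts D P, forall p j, p \in P -> j < k -> monotone (K j) p,
      forall p jj, p \in P -> jj \in L -> codirected (K jj.1) (K jj.2) p ->
        overlap_trans (K jj.1) (K jj.2) p
    & size P <= 2 ^ size L * size P0].
Proof.
elim/last_ind: L => [|L [j j'] IHL] Lk sP0 mP0 /=.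
  by split=> //; rewrite expn0 mul1n.
have [] := IHL _ sP0 mP0.
  by move=> jj jL; apply: Lk; rewrite mem_rcons inE jL orbT.
rewrite foldl_rcons /=; set P := foldl _ _ _ => sP mP tP cP.
have [lt jk] : j < j' /\ j' < k.
  by have := Lk (j, j'); rewrite mem_rcons inE eqxx => /(_ isT) /andP.
set ov := overlap (K j) (K j').
have ltK x : x \in D -> K j x < K j' x by move=> xD; exact: K_lt.
have ovxx x : x \in D -> ov x x by move=> xD; rewrite /ov /overlap ltK.
have ovC : symmetric ov by move=> x y; rewrite /ov /overlap andbC.
have splitP p : subseq p D ->
    perm_eq (flatten (block_split ov p)) p /\
    forall q, q \in block_split ov p -> subseq q p /\ True.
  move=> _; split; first exact: perm_block_split.
  by move=> q qp; split=> //; exact: subseq_block_split qp.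
have [sR rP] := refineP splitP sP.
have trR p : p \in P -> codirected (K j) (K j') p ->
    forall q, q \in block_split ov p -> overlap_trans (K j) (K j') q.
  move=> pP co q qp; have pD := (sP.2 p pP).2.
  have sub x : x \in p -> x \in D by exact: (mem_subseq pD).
  have cv : convex ov p.
    apply: overlap_convex => //; try by apply: mP => //; exact: ltn_trans jk.
      by move=> x /sub xD; exact: ltK.
  have [||||_ tr] := @block_splitP ov p; rewrite ?(subseq_pairwise_ltn pD) //.
    by move=> x /sub; exact: ovxx.
  exact: (tr q qp).2.
split=> //.
- move=> p i pR ik; have [_ [p' p'P pp']] := rP p pR.
  by apply: subseq_monotone pp' _; exact: mP.
- move=> p jj pR; have [_ [p' p'P pp']] := rP p pR.
  rewrite mem_rcons inE => /orP[/eqP ->|jL] /=; last first.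
    have /andP[jj1 jj2] : jj.1 < jj.2 < k by apply: Lk; rewrite mem_rcons inE jL orbT.
    apply: (overlap_trans_sub pp'); [exact: mP (ltn_trans jj1 jj2) | exact: mP |].
    move=> co x y z /(mem_subseq pp') xp /(mem_subseq pp') yp /(mem_subseq pp').
    exact: (tP p' jj p'P jL co).
  have := pR; rewrite mem_filter => /andP[_ /flatten_mapP[r rP' pr]].
  apply: (overlap_trans_sub (subseq_block_split pr)).
  + exact: mP (ltn_trans lt jk).
  + exact: mP.
  + by move=> co; exact: (trR r).
- rewrite size_rcons expnS -mulnA; apply: leq_trans (size_refine _ _) _.
  apply: leq_trans (_ : 2 * size P <= _); last by rewrite leq_mul2l cP orbT.
  by elim: (P) => //= p P' IHP'; rewrite mulnS leq_add.
Qed.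

Lemma partsP : let P := parts K D k in
  [/\ perm_eq (flatten P) D,
      forall p, p \in P -> [/\ ~~ nilp p, subseq p D,
        forall j, j < k -> monotone (K j) p
        & forall j j', j < j' < k -> codirected (K j) (K j') p ->
            overlap_trans (K j) (K j') p],
      exists N, size P <= 2 ^ (k * k.-1) * N /\
        N ^ (2 ^ k.-1) <= 8 ^ (2 ^ k.-1) * size D ^ (2 ^ k.-1 - 1)
    & size P <= size D].
Proof.
have kk : k.-1 < k by rewrite prednK.
have [s1 m1 c1] := monotone_phase kk.
have Lk jj : jj \in index_pairs k -> jj.1 < jj.2 < k.
  by case: jj => j j'; rewrite mem_index_pairs.
have [|[pD sD] mP tP cP] := block_phase Lk s1.
  by move=> p j pP jk; apply: m1 => //; rewrite -ltnS prednK.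
rewrite /parts; set P := foldl _ _ (index_pairs k) in pD sD mP tP cP *.
set P1 := foldl _ _ (iota _ _) in c1 cP.
split=> //.
- move=> p pP; have [np pDs] := sD p pP; split=> // j; first exact: mP.
  by move=> j' jj; apply: (tP p (j, j')) => //; rewrite mem_index_pairs.
- exists (size P1); split=> //; apply: leq_trans cP _.
  by rewrite leq_mul2r leq_exp2l // size_index_pairs orbT.
- rewrite -(perm_size pD) size_flatten /shape.
  elim: (P) sD => //= p P' IH sD; rewrite -add1n leq_add //.
    by have [] := sD p (mem_head _ _); case: (p).
  by apply: IH => q qP; apply: sD; rewrite inE qP orbT.
Qed.

End Parts.

(** * Names of variables and positions of their occurrences *)

Section Keys.
Local Open Scope nat_scope.

Definition first_occ (s : seq nat) := [seq index v s | v <- s].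
(** For [u = first_occ s] these fixed points are the first occurrences, one for each variable, in
    increasing order. *)
Definition dom (u : seq nat) := [seq p <- iota 0 (size u) | nth 0 u p == p].
Definition occ (u : seq nat) x := [seq q <- iota 0 (size u) | nth 0 u q == x].
Definition key (u : seq nat) j x := nth 0 (occ u x) j.

Implicit Types s u : seq nat.

Lemma mem_occ u x q : (q \in occ u x) = (q < size u) && (nth 0 u q == x).
Proof. by rewrite mem_filter mem_iota /= add0n andbC. Qed.

Lemma mem_dom u x : (x \in dom u) = (x < size u) && (nth 0 u x == x).
Proof. by rewrite mem_filter mem_iota /= add0n andbC. Qed.

Lemma pairwise_iota m n : pairwise ltn (iota m n).
Proof. by rewrite -sorted_pairwise ?iota_ltn_sorted //; exact: ltn_trans. Qed.

Lemma pairwise_dom u : pairwise ltn (dom u).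
Proof. exact: subseq_pairwise_ltn (filter_subseq _ _) (pairwise_iota _ _). Qed.

Lemma pairwise_occ u x : pairwise ltn (occ u x).
Proof. exact: subseq_pairwise_ltn (filter_subseq _ _) (pairwise_iota _ _). Qed.

Lemma keyP u j x : j < size (occ u x) -> key u j x < size u /\ nth 0 u (key u j x) = x.
Proof.
by move=> /(mem_nth 0); rewrite -/(key u j x) mem_occ => /andP[h /eqP].
Qed.

Lemma key_lt u x j j' : j < j' -> j' < size (occ u x) -> key u j x < key u j' x.
Proof.
move=> jj j's; have := pairwiseP 0 (pairwise_occ u x) j j'.
by apply=> //; rewrite inE // (ltn_trans jj).
Qed.

Lemma key_neq u x y j j' : j < size (occ u x) -> j' < size (occ u y) ->
  x != y -> key u j x != key u j' y.
Proof.
move=> /keyP[_ kx] /keyP[_ ky]; apply: contraNneq => e.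
by rewrite -kx e ky.
Qed.

Lemma size_occ u x : size (occ u x) = count_mem x u.
Proof.
by rewrite /occ size_filter -{3}(mkseq_nth 0 u) /mkseq count_map.
Qed.

Lemma nth_first_occ s q : q < size s -> nth 0 (first_occ s) q = index (nth 0 s q) s.
Proof. by move=> qs; rewrite (nth_map 0). Qed.

Lemma first_occ_le s q : nth 0 (first_occ s) q <= q.
Proof.
have [qs|qs] := ltnP q (size s); last by rewrite nth_default ?size_map.
rewrite nth_first_occ // leqNgt; apply/negP => /(before_find 0) /=.
by rewrite eqxx.
Qed.

Lemma first_occ_dom s q : q < size s -> nth 0 (first_occ s) q \in dom (first_occ s).
Proof.
move=> qs; rewrite mem_dom size_map (leq_ltn_trans (first_occ_le s q)) //=.
rewrite (nth_first_occ qs) nth_first_occ ?index_mem ?mem_nth //.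
by rewrite nth_index // mem_nth.
Qed.

Lemma key0 s x : x \in dom (first_occ s) -> key (first_occ s) 0 x = x.
Proof.
rewrite mem_dom => /andP[xs ux].
have xo : x \in occ (first_occ s) x by rewrite mem_occ xs.
have k0 : 0 < size (occ (first_occ s) x) by case: (occ _ _) xo.
have [_ kx] := keyP k0.
have xk : x <= key (first_occ s) 0 x by rewrite -{1}kx first_occ_le.
apply/eqP; rewrite eqn_leq xk andbT.
have [i io ix] := nthP 0 xo.
have [i0|i0] := posnP i; first by rewrite -[X in _ <= X]ix i0.
by rewrite -[X in _ <= X]ix ltnW //; exact: key_lt.
Qed.

(* The padding gives each variable at least k occurrences. *)
Definition word n k s : seq nat := s ++ flatten (nseq k (iota 0 n)).

Lemma count_flatten_nseq (T : eqType) (x : T) k (s : seq T) :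
  count_mem x (flatten (nseq k s)) = k * count_mem x s.
Proof. by elim: k => //= k IHk; rewrite count_cat IHk. Qed.

Lemma count_first_occ s x : x < size s ->
  nth 0 (first_occ s) x = x -> count_mem x (first_occ s) = count_mem (nth 0 s x) s.
Proof.
move=> xs ux; rewrite count_map; apply: eq_in_count => v vs /=.
rewrite -{1}ux nth_first_occ //; apply/eqP/eqP => [e|->//].
by rewrite -(nth_index 0 vs) e nth_index // mem_nth.
Qed.

Lemma size_occ_word n k s x : all (ltn^~ n) s ->
  x \in dom (first_occ (word n k s)) -> k <= size (occ (first_occ (word n k s)) x).
Proof.
move=> sn; rewrite mem_dom size_map => /andP[xs /eqP ux].
rewrite size_occ count_first_occ //; set v := nth 0 _ x.
have vn : v < n.
  have : v \in word n k s by exact: mem_nth.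
  rewrite mem_cat => /orP[/(allP sn)//|/flattenP[t /nseqP[-> _]]].
  by rewrite mem_iota.
rewrite count_cat count_flatten_nseq (count_uniq_mem _ (iota_uniq _ _)).
by rewrite mem_iota vn muln1 leq_addl.
Qed.

(** Padding comes last, so the occurrences inside [s] are listed first, and there are at most [k] of
    them. *)
Lemma key_cover n k s q : (forall v, count_mem v s <= k) -> q < size s ->
  let u := first_occ (word n k s) in
  exists2 j, j < k & key u j (nth 0 u q) = q.
Proof.
move=> sk qs u; set x := nth 0 u q.
have qw : q < size (word n k s) by rewrite size_cat ltn_addr.
have qo : q \in occ u x by rewrite mem_occ size_map qw /=.
exists (index q (occ u x)); last by rewrite /key nth_index.
have xw : x < size (word n k s) by apply: leq_ltn_trans qw; exact: first_occ_le.
have oE : occ u x = [seq q <- iota 0 (size s) | nth 0 u q == x] ++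
    [seq q <- iota (size s) (size u - size s) | nth 0 u q == x].
  rewrite -filter_cat -iotaD subnKC // size_map size_cat leq_addr //.
have qm : q \in [seq q <- iota 0 (size s) | nth 0 u q == x].
  by rewrite mem_filter mem_iota eqxx.
rewrite oE index_cat qm; move: qm; rewrite -index_mem => /leq_trans; apply.
apply: leq_trans (sk (nth 0 s q)); rewrite size_filter.
rewrite -[X in count_mem _ X](mkseq_nth 0 s) /mkseq count_map.
rewrite leq_eqVlt; apply/orP; left; apply/eqP/eq_in_count => i.
rewrite mem_iota /= add0n => is_; rewrite /x !nth_first_occ ?size_cat ?ltn_addr //.
rewrite [nth 0 _ i]nth_cat is_ [nth 0 _ q]nth_cat qs.
have mw v : v \in s -> v \in word n k s by move=> vs; rewrite mem_cat vs.
apply/eqP/eqP => /= [e|->//].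
by rewrite -(nth_index 0 (mw _ (mem_nth 0 is_))) e nth_index ?mw ?mem_nth.
Qed.

Lemma perm_dom n k s : 0 < k -> all (ltn^~ n) s ->
  perm_eq [seq index i (word n k s) | i <- iota 0 n] (dom (first_occ (word n k s))).
Proof.
move=> k0 sn; set w := word n k s.
have iw i : i < n -> i \in w.
  move=> i_n; rewrite mem_cat; apply/orP; right; apply/flattenP.
  by exists (iota 0 n); rewrite ?mem_nseq ?k0 ?eqxx // mem_iota.
have wn q : q < size w -> nth 0 w q < n.
  move=> /(mem_nth 0); rewrite mem_cat => /orP[/(allP sn)//|/flattenP[t /nseqP[-> _]]].
  by rewrite mem_iota.
apply: uniq_perm.
- rewrite map_inj_in_uniq ?iota_uniq // => i j; rewrite !mem_iota => /iw iw' /iw jw' e.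
  by rewrite -(nth_index 0 iw') e nth_index.
- exact/pairwise_ltn_uniq/pairwise_dom.
- move=> x; apply/mapP/idP => [[i]|].
    rewrite mem_iota => /iw iw' ->; have lt : index i w < size w by rewrite index_mem.
    have := first_occ_dom lt; rewrite nth_first_occ // nth_index //.
  rewrite mem_dom size_map => /andP[xw /eqP ux]; exists (nth 0 w x).
    by rewrite mem_iota /= add0n wn.
  by rewrite -nth_first_occ.
Qed.

End Keys.

(** * Polynomial time in the WHILE language *)

Fixpoint tree_size (t : tree) : nat :=
  if t is Defs.Cons a b then (tree_size a + tree_size b).+1 else 1.

Lemma tree_size_gt0 t : (0 < tree_size t)%N.
Proof. by case: t. Qed.

Class encodable (A : Type) := code : A -> tree.
#[global] Instance encodable_bool : encodable bool := enc_bool.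
#[global] Instance encodable_nat : encodable nat := enc_unary.
#[global] Instance encodable_unit : encodable unit := fun=> Defs.Nil.
#[global] Instance encodable_seq A (eA : encodable A) : encodable (seq A) :=
  enc_seq eA.
#[global] Instance encodable_prod A B (eA : encodable A) (eB : encodable B) :
  encodable (A * B) := fun p => Defs.Cons (code p.1) (code p.2).

Section PolynomialTime.
Local Open Scope nat_scope.

Definition csize {A} {eA : encodable A} (a : A) : nat := tree_size (code a).

(** The base is at least 2, so a single exponent absorbs constants, sums and products. *)
Definition pbound {A} {eA : encodable A} (g : A -> nat) :=
  exists e, forall a, g a <= (csize a).+1 ^ e.

Definition run (c : cmd) (st : store) (t : nat) (Q : store -> Prop) :=
  exists t' st', [/\ exec c st t' st', t' <= t & Q st'].

(* Variable d serves for input and output, the variables below d are preserved, and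
   nothing is assumed of those above d, so that programs compose without renaming. *)
Definition ptime {A B} {eA : encodable A} {eB : encodable B} (f : A -> B) :=
  pbound (fun a => csize (f a)) /\
  exists (c : nat -> cmd) (T : A -> nat), pbound T /\
    forall d st a, st d = code a ->
    run (c d) st (T a)
      (fun st' => st' d = code (f a) /\ forall j, j < d -> st' j = st j).

Section Bounds.
Context {A B : Type} {eA : encodable A} {eB : encodable B}.
Implicit Types g h : A -> nat.

Lemma pbound_le g h : (forall a, g a <= h a) -> pbound h -> pbound g.
Proof. by move=> gh [e eP]; exists e => a; apply: leq_trans (gh a) (eP a). Qed.

Lemma pbound_cst m : pbound (fun _ : A => m).
Proof.
exists m => a; apply: (leq_trans (ltnW (ltn_expl m (isT : 1 < 2)))).
case: m => // m; rewrite leq_exp2r // ltnS; exact: tree_size_gt0.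
Qed.

Lemma pboundM g h : pbound g -> pbound h -> pbound (fun a => g a * h a).
Proof.
by move=> [e eP] [e' eP']; exists (e + e') => a; rewrite expnD leq_mul.
Qed.

Lemma pboundX g m : pbound g -> pbound (fun a => g a ^ m).
Proof.
move=> [e eP]; exists (e * m) => a; rewrite expnM.
by case: m => [|m]; rewrite ?expn0 // leq_exp2r.
Qed.

Lemma pboundD g h : pbound g -> pbound h -> pbound (fun a => g a + h a).
Proof.
move=> [e eP] [e' eP']; exists (e + e').+1 => a.
have b2 : 2 <= (csize a).+1 by rewrite ltnS tree_size_gt0.
rewrite expnS; apply: (@leq_trans (2 * (csize a).+1 ^ (e + e'))); last first.
  by rewrite leq_mul2r b2 orbT.
rewrite mul2n -addnn leq_add //.
  by apply: leq_trans (eP a) _; rewrite leq_pexp2l ?leq_addr.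
by apply: leq_trans (eP' a) _; rewrite leq_pexp2l ?leq_addl.
Qed.

Lemma pbound_csize : pbound (fun a : A => csize a).
Proof. by exists 1 => a; rewrite expn1. Qed.

Lemma pbound_comp (g : B -> nat) (f : A -> B) :
  pbound g -> pbound (fun a => csize (f a)) -> pbound (fun a => g (f a)).
Proof.
move=> [e eP] bf.
apply: (@pbound_le _ (fun a => (csize (f a) + 1) ^ e)).
  by move=> a; rewrite addn1.
exact: pboundX (pboundD bf (pbound_cst 1)).
Qed.

End Bounds.

Lemma csize_pair A B (eA : encodable A) (eB : encodable B) (p : A * B) :
  csize p = (csize p.1 + csize p.2).+1.
Proof. by []. Qed.

Lemma csize_cons A (eA : encodable A) (x : A) s :
  csize (x :: s) = (csize x + csize s).+1.
Proof. by []. Qed.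

Lemma csize_gt0 A {eA : encodable A} (x : A) : 0 < csize x.
Proof. exact: tree_size_gt0. Qed.

Lemma csize_mem A {eA : encodable A} (x : A) (s : seq A) i : i < size s -> csize (nth x s i) <= csize s.
Proof.
elim: s i => //= y s IHs [|i] /=; rewrite csize_cons; first by lia.
by rewrite ltnS => /IHs; lia.
Qed.

Lemma size_le_csize A {eA : encodable A} (s : seq A) : size s <= csize s.
Proof. by elim: s => //= x s IHs; rewrite csize_cons; lia. Qed.

Section Run.
Implicit Types (c : cmd) (st : store) (Q : store -> Prop).

Lemma run_le c st t t' Q Q' :
  t <= t' -> (forall s, Q s -> Q' s) -> run c st t Q -> run c st t' Q'.
Proof.
move=> tt' QQ' [u [s [ex ut Qs]]]; exists u, s; split=> //.
  exact: leq_trans tt'.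
exact: QQ'.
Qed.

Lemma run_assign st i e Q :
  Q (upd st i (Defs.eval st e)) -> run (Assign i e) st (cost e).+1 Q.
Proof. by move=> Qst; do 2 eexists; split; [exact: ExecAssign | exact: leqnn |]. Qed.

Lemma run_seq c1 c2 st t1 t2 Q :
  run c1 st t1 (fun s => run c2 s t2 Q) -> run (Seq c1 c2) st (t1 + t2) Q.
Proof.
move=> [u [s [ex ut [v [s' [ex' vt Qs]]]]]].
by do 2 eexists; split; [apply: ExecSeq; eassumption | exact: leq_add |].
Qed.

Lemma run_if_true e c1 c2 st t Q : Defs.eval st e <> Defs.Nil ->
  run c1 st t Q -> run (If e c1 c2) st (cost e + t).+1 Q.
Proof.
move=> ne [u [s [ex ut Qs]]]; do 2 eexists; split;
  [exact: ExecIfTrue ex | by rewrite ltnS leq_add2l | by []].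
Qed.

Lemma run_if_false e c1 c2 st t Q : Defs.eval st e = Defs.Nil ->
  run c2 st t Q -> run (If e c1 c2) st (cost e + t).+1 Q.
Proof.
move=> ne [u [s [ex ut Qs]]]; do 2 eexists; split;
  [exact: ExecIfFalse ex | by rewrite ltnS leq_add2l | by []].
Qed.

(** The list still to be processed indexes the invariant and counts the rounds. Each round costs 2
    beyond its body, and the last, failing test costs 2. *)
Lemma run_while (C : Type) i c (inv : seq C -> store -> Prop) t :
  (forall st, inv [::] st -> st i = Defs.Nil) ->
  (forall x s st, inv (x :: s) st -> st i <> Defs.Nil /\ run c st t (inv s)) ->
  forall s st, inv s st ->
  run (While (EVar i) c) st (2 + size s * (t + 2)) (inv [::]).
Proof.
move=> inv0 invS; elim=> [|x s IHs] st invs.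
  by do 2 eexists; split; [apply: ExecWhileFalse; exact: inv0 | | ].
have [nz [u [s1 [ex1 ut inv1]]]] := invS _ _ _ invs.
have [v [s2 [ex2 vt inv2]]] := IHs _ inv1.
do 2 eexists; split; [exact: ExecWhileTrue ex1 ex2 | | exact: inv2].
by rewrite /= mulSn; move: (size s * _) vt => n; lia.
Qed.

End Run.

Section Combinators.
Context {A B C : Type} {eA : encodable A} {eB : encodable B} {eC : encodable C}.

(** A program sees only codes, so the result types may differ: a number is a list of [true], a
    nonempty list is a pair. *)
Lemma ptime_code (D : Type) (eD : encodable D) (f : A -> B) (g : A -> D) :
  (forall a, code (g a) = code (f a)) -> ptime f -> ptime g.
Proof.
move=> gf [bf [c [T [bT cP]]]]; split.
  by apply: pbound_le bf => a; rewrite /csize gf.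
by exists c, T; split=> // d st a std; rewrite gf; exact: cP.
Qed.

Lemma ptime_ext (f g : A -> B) : f =1 g -> ptime f -> ptime g.
Proof. by move=> fg; apply: ptime_code => a; rewrite fg. Qed.

Lemma ptime_expr (e : nat -> expr) (m : nat) (f : A -> B) :
  pbound (fun a => csize (f a)) -> (forall d, cost (e d) <= m) ->
  (forall d st a, st d = code a -> Defs.eval st (e d) = code (f a)) -> ptime f.
Proof.
move=> bf me ef; split=> //.
exists (fun d => Assign d (e d)), (fun=> m.+1); split; first exact: pbound_cst.
move=> d st a std.
apply: (@run_le _ _ (cost (e d)).+1 _ (fun s => s = upd st d (Defs.eval st (e d)))).
- by rewrite ltnS.
- move=> _ ->; rewrite /upd eqxx (ef _ _ _ std); split=> // j jd.
  by rewrite ltn_eqF.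
- exact: run_assign.
Qed.

Lemma ptime_comp (f : A -> B) (g : B -> C) :
  ptime f -> ptime g -> ptime (fun a => g (f a)).
Proof.
move=> [bf [c [T [bT cP]]]] [bg [c' [T' [bT' cP']]]]; split.
  exact: (pbound_comp bg bf).
exists (fun d => Seq (c d) (c' d)), (fun a => T a + T' (f a)); split.
  exact: pboundD bT (pbound_comp bT' bf).
move=> d st a std; apply: run_seq.
apply: run_le (cP _ _ _ std) => // s [sd ss].
apply: run_le (cP' _ _ _ sd) => // s' [sd' ss']; split=> // j jd.
by rewrite ss' // ss.
Qed.

Lemma ptime_pair (f : A -> B) (g : A -> C) :
  ptime f -> ptime g -> ptime (fun a => (f a, g a)).
Proof.
move=> [bf [c [T [bT cP]]]] [bg [c' [T' [bT' cP']]]]; split.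
  apply: (@pbound_le _ _ _ (fun a => csize (f a) + csize (g a) + 1)) => [a|].
    by rewrite csize_pair addn1.
  by do !apply: pboundD => //; exact: pbound_cst.
exists (fun d => Seq (Assign d.+1 (EVar d)) (Seq (c d.+1)
   (Seq (Assign d.+2 (EVar d)) (Seq (c' d.+2)
   (Assign d (ECons (EVar d.+1) (EVar d.+2))))))).
exists (fun a => 2 + (T a + (2 + (T' a + 4)))); split.
  by do !apply: pboundD => //; exact: pbound_cst.
move=> d st a std; apply/run_seq/run_assign/run_seq.
apply: run_le (cP _ _ a _) => // [s [sd ss]|]; last by rewrite /upd eqxx.
have sd0 : s d = code a by rewrite ss // /upd ltn_eqF.
apply/run_seq/run_assign/run_seq.
apply: run_le (cP' _ _ a _) => // [s' [sd' ss']|]; last by rewrite /upd eqxx.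
apply: run_assign; rewrite /= /upd eqxx; split.
  rewrite sd' ss' // /upd ltn_eqF // sd //.
move=> j jd; rewrite ltn_eqF // ss' ?(ltn_trans jd) // /upd ltn_eqF //.
  by rewrite ss /upd ?ltn_eqF //; lia.
by lia.
Qed.

Lemma ptime_if (f : A -> bool) (g h : A -> B) :
  ptime f -> ptime g -> ptime h -> ptime (fun a => if f a then g a else h a).
Proof.
move=> [bf [c [T [bT cP]]]] [bg [c' [T' [bT' cP']]]].
move=> [bh [c2 [T2 [bT2 cP2]]]]; split.
  apply: (@pbound_le _ _ _ (fun a => csize (g a) + csize (h a))) => [a|].
    by case: (f a); rewrite ?leq_addr ?leq_addl.
  exact: pboundD.
exists (fun d => Seq (Assign d.+1 (EVar d)) (Seq (c d.+1)
   (If (EVar d.+1) (c' d) (c2 d)))).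
exists (fun a => 2 + (T a + (1 + (T' a + T2 a)).+1)); split.
  apply: (@pbound_le _ _ _ (fun a => 2 + (T a + (2 + (T' a + T2 a))))) => //.
  by do !apply: pboundD => //; exact: pbound_cst.
move=> d st a std; apply/run_seq/run_assign/run_seq.
apply: run_le (cP _ _ a _) => // [s [sd ss]|]; last by rewrite /upd eqxx.
have sd0 : s d = code a by rewrite ss // /upd ltn_eqF.
have sj j : j < d -> s j = st j.
  by move=> jd; rewrite ss /upd ?ltn_eqF //; lia.
case: (f a) sd => sd.
  apply: (@run_le _ _ (cost (EVar d.+1) + T' a).+1 _ _ _ _ (fun _ Q => Q)).
    by rewrite /= ltnS; lia.
  apply: run_if_true; first by rewrite /= sd.
  by apply: run_le (cP' _ _ a _) => // s' [sd' ss']; split=> // j jd;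
    rewrite ss' // sj.
apply: (@run_le _ _ (cost (EVar d.+1) + T2 a).+1 _ _ _ _ (fun _ Q => Q)).
  by rewrite /= ltnS; lia.
apply: run_if_false; first by rewrite /= sd.
by apply: run_le (cP2 _ _ a _) => // s' [sd' ss']; split=> // j jd;
  rewrite ss' // sj.
Qed.

(** Iterating a polynomial-time function can square sizes at each step, hence the bound [b] on all
    intermediate accumulators. *)
Lemma ptime_foldl (F : A -> B -> C -> B) (z : A -> B) (l : A -> seq C)
    (b : A -> nat) :
  ptime (fun p : A * B * C => F p.1.1 p.1.2 p.2) -> ptime z -> ptime l ->
  pbound b ->
  (forall a i, csize (foldl (F a) (z a) (take i (l a))) <= b a) ->
  ptime (fun a => foldl (F a) (z a) (l a)).
Proof.
move=> [bF [c [T [[e bT] cP]]]] [bz [cz [Tz [bTz czP]]]] [bl [cl [Tl [bTl clP]]]].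
move=> bb bP; split.
  by apply: pbound_le bb => a; rewrite -{1}(take_size (l a)).
(* Variable [d] holds the parameter, [d+1] the rest of the list, [d+2] the accumulator, and [d+3]
   the argument, then the result, of one step. *)
pose body d := Seq (Assign d.+3 (ECons (ECons (EVar d) (EVar d.+2)) (EHd (EVar d.+1))))
  (Seq (c d.+3) (Seq (Assign d.+2 (EVar d.+3)) (Assign d.+1 (ETl (EVar d.+1))))).
exists (fun d => Seq (Assign d.+1 (EVar d)) (Seq (cl d.+1)
  (Seq (Assign d.+2 (EVar d)) (Seq (cz d.+2)
  (Seq (While (EVar d.+1) (body d)) (Assign d (EVar d.+2))))))).
pose (M := fun a : A => (csize a + b a + csize (l a) + 3) ^ e).
pose tb (a : A) := 7 + (M a + (2 + 3)).
exists (fun a : A => 2 + (Tl a + (2 + (Tz a +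
   ((2 + csize (l a) * (tb a + 2)) + 2))))); split.
  have bM : pbound M.
    apply: pboundX; do !apply: pboundD => //; exact: pbound_csize || exact: pbound_cst.
  do ?[apply: pboundD || apply: pboundM] => //; exact: pbound_cst.
move=> d st a std; apply/run_seq/run_assign/run_seq.
apply: run_le (clP _ _ a _) => // [s1 [s1d ss1]|]; last by rewrite /upd eqxx.
have s1d0 : s1 d = code a by rewrite ss1 // /upd ltn_eqF.
apply/run_seq/run_assign/run_seq.
apply: run_le (czP _ _ a _) => // [s2 [s2d ss2]|]; last by rewrite /upd eqxx.
have s2j j : j < d -> s2 j = st j.
  by move=> jd; rewrite ss2 /upd ?ltn_eqF ?ss1 /upd ?ltn_eqF //; lia.
have s2d0 : s2 d = code a by rewrite ss2 // /upd ltn_eqF.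
have s2d1 : s2 d.+1 = code (l a) by rewrite ss2 // /upd ltn_eqF.
pose (inv := fun (r : seq C) (s : store) => [/\ s d = code a, s d.+1 = code r,
  exists i, r = drop i (l a) /\ s d.+2 = code (foldl (F a) (z a) (take i (l a)))
  & forall j, j < d -> s j = st j]).
apply: run_seq.
apply: (@run_le _ _ (2 + size (l a) * (tb a + 2)) _ (inv [::])).
- by rewrite leq_add2l leq_mul2r size_le_csize orbT.
- move=> s [sd sd1 [i [li sd2]] sj]; apply: run_assign; rewrite /= /upd eqxx.
  split=> [|j jd]; last by rewrite ltn_eqF // sj.
  rewrite sd2; congr (code (foldl _ _ _)).
  by rewrite -[RHS](cat_take_drop i) -li cats0.
- apply: run_while; last first.
  + by split=> //; exists 0; rewrite drop0 take0.
  + move=> x s st' [sd sd1 [i [li sd2]] sj]; split; first by rewrite sd1.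
    have il : i < size (l a).
      by rewrite ltnNge; apply/negP => /drop_oversize; rewrite -li.
    have xE : x = nth x (l a) i by rewrite -[i]addn0 -nth_drop -li.
    have sE : s = drop i.+1 (l a) by rewrite -addn1 addnC -drop_drop -li /= drop0.
    apply/run_seq/run_assign/run_seq.
    set s0 := upd _ _ _; set acc := foldl _ _ _ in sd2.
    have s0d : s0 d.+3 = code ((a, acc), x).
      by rewrite /s0 /upd eqxx /= sd sd1 sd2.
    have s0j j : j < d.+3 -> s0 j = st' j by move=> jd; rewrite /s0 /upd ltn_eqF.
    apply: run_le (cP _ _ _ s0d).
      apply: (leq_trans (bT _)); rewrite /M; case: (e) => // e'.
      rewrite leq_exp2r // !csize_pair /= xE.
      by have := csize_mem (eA := eC) x il; have := bP a i; rewrite -/acc; lia.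
    move=> s3 [s3d s3j]; apply/run_seq/run_assign/run_assign.
    rewrite /inv /= /upd; split.
    * by rewrite !ltn_eqF // ?s3j ?s0j //; lia.
    * by rewrite eqxx [d.+1 == _]ltn_eqF // ?s3j ?s0j ?sd1 //; lia.
    * exists i.+1; split=> //; rewrite [d.+2 == d.+1]gtn_eqF // eqxx s3d.
      by rewrite (take_nth x) // -cats1 foldl_cat /= -xE.
    * move=> j jd; rewrite !ltn_eqF ?s3j ?s0j ?sj //; lia.
  + by move=> s [].
Qed.

End Combinators.
Section Library.
Context {A B C D : Type}.
Context {eA : encodable A} {eB : encodable B} {eC : encodable C} {eD : encodable D}.

Lemma ptime_id : ptime (fun a : A => a).
Proof.
apply: (@ptime_expr _ _ _ _ EVar 1) => //; exact: pbound_csize.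
Qed.

Fixpoint quote (t : tree) : expr :=
  if t is Defs.Cons t1 t2 then ECons (quote t1) (quote t2) else ENil.

Lemma ptime_cst (b : B) : ptime (fun _ : A => b).
Proof.
apply: (@ptime_expr _ _ _ _ (fun=> quote (code b)) (cost (quote (code b)))) => //.
  exact: pbound_cst.
move=> d st _ _; by elim: (code b) => //= t1 -> t2 ->.
Qed.

Lemma ptime_fst (f : A -> B * C) : ptime f -> ptime (fun a => (f a).1).
Proof.
move=> pf; apply: (ptime_comp (g := fst) pf); apply: (@ptime_expr _ _ _ _ (fun d => EHd (EVar d)) 2) => //.
  by exists 1 => -[x y]; rewrite expn1 csize_pair /=; lia.
by move=> d st [x y] /= ->.
Qed.

Lemma ptime_snd (f : A -> B * C) : ptime f -> ptime (fun a => (f a).2).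
Proof.
move=> pf; apply: (ptime_comp (g := snd) pf); apply: (@ptime_expr _ _ _ _ (fun d => ETl (EVar d)) 2) => //.
  by exists 1 => -[x y]; rewrite expn1 csize_pair /=; lia.
by move=> d st [x y] /= ->.
Qed.

Lemma ptime_cons (f : A -> B) (g : A -> seq B) :
  ptime f -> ptime g -> ptime (fun a => f a :: g a).
Proof. by move=> pf pg; apply: ptime_code (ptime_pair pf pg). Qed.

Lemma ptime_behead (f : A -> seq B) : ptime f -> ptime (fun a => behead (f a)).
Proof.
move=> pf; apply: (ptime_comp (g := behead) pf); apply: (@ptime_expr _ _ _ _ (fun d => ETl (EVar d)) 2) => //.
  by exists 1 => -[|x y] //=; rewrite expn1 csize_cons /=; lia.
by move=> d st [|x y] /= ->.
Qed.

(** [hd] sends [Nil] to [Nil], so the default has to be coded by [Nil]. *)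
Lemma ptime_head (b : B) (f : A -> seq B) : code b = Defs.Nil ->
  ptime f -> ptime (fun a => head b (f a)).
Proof.
move=> b0 pf; apply: (ptime_comp (g := head b) pf).
apply: (@ptime_expr _ _ _ _ (fun d => EHd (EVar d)) 2) => //.
  exists 1 => -[|x y] /=; rewrite expn1; first by rewrite /csize b0.
  by rewrite csize_cons; lia.
by move=> d st [|x y] /= -> /=.
Qed.

Lemma ptime_nilp (f : A -> seq B) : ptime f -> ptime (fun a => nilp (f a)).
Proof.
move=> pf; apply: (@ptime_comp A (seq B) bool _ _ _ f (fun s => nilp s)) => //; split.
  by exists 2 => -[|x s] //=; rewrite csize_cons.
exists (fun d => If (EVar d) (Assign d ENil) (Assign d (ECons ENil ENil))).
exists (fun=> 6); split; first exact: pbound_cst.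
move=> d st [|x s] std.
  apply: (@run_le _ _ (cost (EVar d) + 4).+1 _ _ _ _ (fun _ Q => Q)) => //.
  apply: run_if_false; first by rewrite /= std.
  apply: run_assign; rewrite /upd eqxx; split=> // j jd; by rewrite ltn_eqF.
apply: (@run_le _ _ (cost (EVar d) + 2).+1 _ _ _ _ (fun _ Q => Q)) => //.
apply: run_if_true; first by rewrite /= std.
apply: run_assign; rewrite /upd eqxx; split=> // j jd; by rewrite ltn_eqF.
Qed.

End Library.

Section Boolean.
Context {A : Type} {eA : encodable A}.

Lemma ptime_negb (f : A -> bool) : ptime f -> ptime (fun a => ~~ f a).
Proof.
move=> pf; apply: ptime_ext (ptime_if pf (ptime_cst false) (ptime_cst true)).
by move=> a; case: (f a).
Qed.

Lemma ptime_and (f g : A -> bool) :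
  ptime f -> ptime g -> ptime (fun a => f a && g a).
Proof. by move=> pf pg; apply: (ptime_if pf pg (ptime_cst false)). Qed.

Lemma ptime_addb (f g : A -> bool) :
  ptime f -> ptime g -> ptime (fun a => f a (+) g a).
Proof.
move=> pf pg; apply: ptime_ext (ptime_if pf (ptime_negb pg) pg) => a.
by case: (f a).
Qed.

End Boolean.

Lemma csize_take A {eA : encodable A} i (s : seq A) : csize (take i s) <= csize s.
Proof.
elim: s i => [|x s IHs] [|i] //.
by rewrite /= !csize_cons; have := IHs i; lia.
Qed.

Lemma csize_nil A {eA : encodable A} : csize ([::] : seq A) = 1.
Proof. by []. Qed.

Lemma csize_catrev A {eA : encodable A} (s t : seq A) :
  (csize (catrev s t)).+1 = csize s + csize t.
Proof.
elim: s t => [|x s IHs] t /=; first by rewrite csize_nil.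
by rewrite IHs !csize_cons; lia.
Qed.

Lemma csize_rev A {eA : encodable A} (s : seq A) : csize (rev s) = csize s.
Proof.
by apply: succn_inj; rewrite csize_catrev csize_nil addn1.
Qed.

Lemma csize_cat A {eA : encodable A} (s t : seq A) :
  (csize (s ++ t)).+1 = csize s + csize t.
Proof.
elim: s => [|x s IHs] /=; first by rewrite csize_nil.
by rewrite !csize_cons; lia.
Qed.

Section Folds.
Context {A B C : Type} {eA : encodable A} {eB : encodable B} {eC : encodable C}.

Lemma csize_foldl (F : B -> C -> B) b m (s : seq C) w :
  csize s <= m -> (forall x y, csize y <= m -> csize (F x y) <= csize x + b) ->
  csize (foldl F w s) <= csize w + size s * b.
Proof.
move=> sm Fb; elim: s w sm => [|y s IHs] w; first by rewrite addn0.
rewrite csize_cons /= mulSn => sm; have ym : csize y <= m by lia.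
have := IHs (F w y); have := Fb w y ym; move: (size s * b); lia.
Qed.

Lemma ptime_foldl_growth (F : A -> B -> C -> B) (z : A -> B) (l : A -> seq C)
    (b : A -> nat) :
  ptime (fun p : A * B * C => F p.1.1 p.1.2 p.2) -> ptime z -> ptime l ->
  pbound b ->
  (forall a x y, csize y <= csize (l a) -> csize (F a x y) <= csize x + b a) ->
  ptime (fun a => foldl (F a) (z a) (l a)).
Proof.
move=> pF pz pl bb bP.
apply: (ptime_foldl (b := fun a => csize (z a) + csize (l a) * b a)) => //.
  by apply: pboundD; [case: pz | apply: pboundM => //; case: pl].
move=> a i; apply: leq_trans (csize_foldl _ (csize_take _ _) (bP a)) _.
rewrite leq_add2l leq_mul2r; apply/orP; right.
exact: leq_trans (size_le_csize _) (csize_take _ _).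
Qed.

End Folds.

Lemma ptime_rev A B {eA : encodable A} {eB : encodable B} (l : A -> seq B) :
  ptime l -> ptime (fun a => rev (l a)).
Proof.
move=> pl; apply: (@ptime_ext _ _ _ _ (fun a => foldl (fun r x => x :: r) [::] (l a))).
  by move=> a; rewrite /rev; elim: (l a) [::] => //= x s IHs t; rewrite IHs.
apply: (ptime_foldl_growth (F := fun a r x => x :: r) (b := fun a => csize (l a) + 1)) => //.
- apply: ptime_cons; first exact/ptime_snd/ptime_id.
  exact/ptime_snd/ptime_fst/ptime_id.
- exact: ptime_cst.
- by apply: pboundD; [case: pl | exact: pbound_cst].
- by move=> a x y yl; rewrite csize_cons; lia.
Qed.

Section Foldr.
Context {A B C : Type} {eA : encodable A} {eB : encodable B} {eC : encodable C}.

Lemma ptime_foldr (F : A -> C -> B -> B) (z : A -> B) (l : A -> seq C)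
    (b : A -> nat) :
  ptime (fun p : A * C * B => F p.1.1 p.1.2 p.2) -> ptime z -> ptime l ->
  pbound b ->
  (forall a x y, csize y <= csize (l a) -> csize (F a y x) <= csize x + b a) ->
  ptime (fun a => foldr (F a) (z a) (l a)).
Proof.
move=> pF pz pl bb bP.
apply: (@ptime_ext _ _ _ _ (fun a => foldl (fun x y => F a y x) (z a) (rev (l a)))).
  by move=> a; rewrite foldl_rev.
apply: (ptime_foldl_growth (F := fun a x y => F a y x) (b := b)) => //.
- have pp : ptime (fun p : A * B * C => (p.1.1, p.2, p.1.2)).
    apply: ptime_pair; first apply: ptime_pair.
    + exact/ptime_fst/ptime_fst/ptime_id.
    + exact/ptime_snd/ptime_id.
    + exact/ptime_snd/ptime_fst/ptime_id.
  exact: (ptime_comp pp pF).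
- exact: ptime_rev.
- by move=> a x y; rewrite csize_rev; exact: bP.
Qed.

End Foldr.
End PolynomialTime.

Section PTimeMap.
Local Open Scope nat_scope.

Lemma pbound_ptime A B {eA : encodable A} {eB : encodable B} (f : A -> B) :
  ptime f -> pbound (fun a => csize (f a)).
Proof. by case. Qed.

Lemma ptime_map A B C {eA : encodable A} {eB : encodable B} {eC : encodable C}
    (F : A -> C -> B) (l : A -> seq C) :
  ptime (fun p : A * C => F p.1 p.2) -> ptime l ->
  ptime (fun a => [seq F a x | x <- l a]).
Proof.
move=> pF pl; case: (pF) => [[e eP] _].
apply: (@ptime_ext _ _ _ _ (fun a => foldr (fun x r => F a x :: r) [::] (l a))).
  by move=> a; elim: (l a) => //= x s ->.
apply: (ptime_foldr (F := fun a x r => F a x :: r)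
  (b := fun a => (csize a + csize (l a) + 2) ^ e + 1)) => //.
- apply: ptime_cons; last exact/ptime_snd/ptime_id.
  have pp : ptime (fun p : A * C * seq B => (p.1.1, p.1.2)).
    by apply: ptime_pair; [exact/ptime_fst/ptime_fst/ptime_id |
      exact/ptime_snd/ptime_fst/ptime_id].
  exact: (ptime_comp pp pF).
- exact: ptime_cst.
- apply: pboundD; last exact: pbound_cst.
  apply: pboundX; apply: pboundD; last exact: pbound_cst.
  by apply: pboundD; [exact: pbound_csize | exact: pbound_ptime].
move=> a x y yl; rewrite csize_cons.
have : csize (F a y) <= (csize a + csize (l a) + 2) ^ e.
  apply: leq_trans (eP (a, y)) _; case: (e) => // e'.
  by rewrite leq_exp2r // csize_pair /=; lia.
by move: (_ ^ e) => n; lia.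
Qed.

End PTimeMap.

Ltac pt_user := fail.
Ltac pt_step := cbv beta;
  lazymatch goal with
  | |- ptime (fun _ => ?c) => exact: ptime_cst
  | |- ptime (fun x => x) => exact: ptime_id
  | |- ptime (fun x => (@?f x, @?g x)) => apply: ptime_pair
  | |- ptime fst => exact: (ptime_fst ptime_id)
  | |- ptime snd => exact: (ptime_snd ptime_id)
  | |- ptime (fun x => fst (@?f x)) => apply: ptime_fst
  | |- ptime (fun x => snd (@?f x)) => apply: ptime_snd
  | |- ptime (fun x => cons (@?f x) (@?g x)) => apply: ptime_cons
  | |- ptime (fun x => behead (@?f x)) => apply: ptime_behead
  | |- ptime (fun x => head (@?g x) (@?f x)) => apply: ptime_head; [reflexivity|]
  | |- ptime (fun x => nilp (@?f x)) => apply: ptime_nilp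
  | |- ptime (fun x => negb (@?f x)) => apply: ptime_negb
  | |- ptime (fun x => andb (@?f x) (@?g x)) => apply: ptime_and
  | |- ptime (fun x => addb (@?f x) (@?g x)) => apply: ptime_addb
  | |- ptime (fun x => rev (@?f x)) => apply: ptime_rev
  | |- ptime (fun x => map (@?g x) (@?f x)) => apply: ptime_map
  | |- _ => first [assumption | pt_user | apply: ptime_if]
  end.
Ltac pt := repeat pt_step.

Section PTimeLibrary.
Local Open Scope nat_scope.

Section Sequences.
Context {A B : Type} {eA : encodable A} {eB : encodable B}.

Lemma ptime_cat (f g : A -> seq B) : ptime f -> ptime g -> ptime (fun a => f a ++ g a).
Proof.
move=> pf pg.
apply: (@ptime_ext _ _ _ _ (fun a => foldr (fun x r => x :: r) (g a) (f a))) => [a|].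
  by elim: (f a) => //= x s ->.
apply: (ptime_foldr (F := fun a x r => x :: r) (b := fun a => csize (f a) + 1)).
- by pt.
- by [].
- by [].
- by apply: pboundD; [exact: pbound_ptime | exact: pbound_cst].
- by move=> a x y yl; rewrite csize_cons; lia.
Qed.

Lemma ptime_filter (P : A -> B -> bool) (f : A -> seq B) :
  ptime (fun p : A * B => P p.1 p.2) -> ptime f ->
  ptime (fun a => [seq x <- f a | P a x]).
Proof.
move=> pP pf.
apply: (@ptime_ext _ _ _ _ (fun a =>
   foldr (fun x r => if P a x then x :: r else r) [::] (f a))) => [a|].
  by elim: (f a) => //= x s ->.
apply: (ptime_foldr (F := fun a x r => if P a x then x :: r else r)
  (b := fun a => csize (f a) + 1)) => //.
- have pp : ptime (fun p : A * B * seq B => (p.1.1, p.1.2)) by pt.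
  have := ptime_comp pp pP; rewrite /= => pP'; by pt.
- exact: ptime_cst.
- by apply: pboundD; [exact: pbound_ptime | exact: pbound_cst].
- by move=> a x y yl; case: ifP => _; rewrite ?csize_cons; lia.
Qed.

End Sequences.

Lemma ptime_flatten A B {eA : encodable A} {eB : encodable B} (f : A -> seq (seq B)) :
  ptime f -> ptime (fun a => flatten (f a)).
Proof.
move=> pf; apply: (ptime_foldr (F := fun a x r => x ++ r) (z := fun=> [::])
  (b := fun a => csize (f a))) => //.
- by apply: ptime_cat; pt.
- exact: ptime_cst.
- exact: pbound_ptime.
- by move=> a x y yl; rewrite -ltnS csize_cat; lia.
Qed.

Lemma ptime_has A B {eA : encodable A} {eB : encodable B} (P : A -> B -> bool) (f : A -> seq B) :
  ptime (fun p : A * B => P p.1 p.2) -> ptime f ->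
  ptime (fun a => has (P a) (f a)).
Proof.
move=> pP pf.
apply: (@ptime_ext _ _ _ _ (fun a => ~~ nilp [seq x <- f a | P a x])) => [a|].
  by rewrite /nilp size_filter -lt0n -has_count.
apply/ptime_negb/ptime_nilp; exact: ptime_filter.
Qed.

Lemma csizeS (n : nat) : csize n.+1 = (csize n).+4.
Proof. by []. Qed.

Lemma csize_natE (n : nat) : csize n = (4 * n).+1.
Proof. by elim: n => // n IHn; rewrite csizeS IHn; lia. Qed.

Section Numbers.
Context {A B : Type} {eA : encodable A} {eB : encodable B}.

Lemma ptime_succ (f : A -> nat) : ptime f -> ptime (fun a => (f a).+1).
Proof.
move=> pf; apply: (@ptime_code _ _ _ _ _ _ (fun a => true :: nseq (f a) true)) => //.
apply: ptime_cons; first by pt.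
by apply: (ptime_code (f := f)).
Qed.

Lemma ptime_pred (f : A -> nat) : ptime f -> ptime (fun a => (f a).-1).
Proof.
move=> pf; apply: (@ptime_code _ _ _ _ _ _ (fun a => behead (nseq (f a) true))).
  by move=> a; case: (f a).
by apply: ptime_behead; apply: (ptime_code (f := f)).
Qed.

Lemma ptime_bits (f : A -> nat) : ptime f -> ptime (fun a => nseq (f a) true).
Proof. by move=> pf; apply: (ptime_code (f := f)). Qed.

Lemma ptime_eqn0 (f : A -> nat) : ptime f -> ptime (fun a => f a == 0).
Proof.
move=> pf; apply: (@ptime_ext _ _ _ _ (fun a => nilp (nseq (f a) true))) => [a|].
  by rewrite /nilp size_nseq.
exact/ptime_nilp/ptime_bits.
Qed.

Lemma ptime_iter (F : A -> B -> B) (n : A -> nat) (z : A -> B) (b : A -> nat) :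
  ptime (fun p : A * B => F p.1 p.2) -> ptime n -> ptime z -> pbound b ->
  (forall a i, i <= n a -> csize (iter i (F a) (z a)) <= b a) ->
  ptime (fun a => iter (n a) (F a) (z a)).
Proof.
move=> pF pn pz bb bP.
have iterE a m : foldl (fun x (_ : bool) => F a x) (z a) (nseq m true) = iter m (F a) (z a).
  elim: m => //= m <-; rewrite -[F a (z a)]/(iter 1 _ _); move: (z a).
  by elim: m => //= m IHm x; rewrite IHm.
apply: (@ptime_ext _ _ _ _ (fun a => foldl (fun x (_ : bool) => F a x) (z a) (nseq (n a) true))) => //.
apply: (ptime_foldl (F := fun a x (_ : bool) => F a x) (b := b)) => //.
- have pp : ptime (fun p : A * B * bool => (p.1.1, p.1.2)) by pt.
  exact: (ptime_comp pp pF).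
move=> a i; case: (leqP i (n a)) => ia.
  by rewrite take_nseq // iterE bP.
by rewrite take_oversize ?size_nseq ?iterE ?bP // ltnW.
Qed.

Lemma ptime_iter_growth (F : A -> B -> B) (n : A -> nat) (z : A -> B) (b : A -> nat) :
  ptime (fun p : A * B => F p.1 p.2) -> ptime n -> ptime z -> pbound b ->
  (forall a x, csize (F a x) <= csize x + b a) ->
  ptime (fun a => iter (n a) (F a) (z a)).
Proof.
move=> pF pn pz bb bP.
apply: (ptime_iter (b := fun a => csize (z a) + csize (n a) * b a)) => //.
  apply: pboundD; first exact: pbound_ptime.
  by apply: pboundM => //; exact: pbound_ptime.
move=> a i ia; apply: (@leq_trans (csize (z a) + i * b a)).
  elim: i {ia} => [|i IHi]; first by rewrite addn0.
  by rewrite iterS; apply: leq_trans (bP _ _) _; rewrite mulSn; lia.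
by rewrite leq_add2l leq_mul2r csize_natE (leq_trans ia) ?orbT //; lia.
Qed.

End Numbers.

Lemma ptime_addn A {eA : encodable A} (f g : A -> nat) : ptime f -> ptime g -> ptime (fun a => f a + g a).
Proof.
move=> pf pg; apply: (@ptime_code _ _ _ _ _ _ (fun a => nseq (f a) true ++ nseq (g a) true)).
  by move=> a; rewrite -nseqD.
by apply: ptime_cat; exact: ptime_bits.
Qed.

Lemma ptime_muln A {eA : encodable A} (f g : A -> nat) : ptime f -> ptime g -> ptime (fun a => f a * g a).
Proof.
move=> pf pg; apply: (@ptime_ext _ _ _ _ (fun a => iter (f a) (fun n => g a + n) 0)) => [a|].
  by rewrite iter_addn addn0 mulnC.
apply: (ptime_iter_growth (F := fun a n => g a + n) (b := fun a => csize (g a))) => //.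
- have pp : ptime (fun p : A * nat => p.1) by pt.
  by apply: ptime_addn; [exact: (ptime_comp pp pg) | pt].
- exact: ptime_cst.
- exact: pbound_ptime.
- by move=> a x; rewrite !csize_natE; lia.
Qed.

Lemma ptime_subn A {eA : encodable A} (f g : A -> nat) : ptime f -> ptime g -> ptime (fun a => f a - g a).
Proof.
move=> pf pg; apply: (@ptime_ext _ _ _ _ (fun a => iter (g a) predn (f a))) => [a|].
  by elim: (g a) => [|n IHn]; rewrite ?subn0 // iterS IHn -subnS.
apply: (ptime_iter_growth (F := fun _ => predn) (b := fun=> 0)) => //.
- by apply: ptime_pred; pt.
- exact: pbound_cst.
- by move=> a x; rewrite !csize_natE; lia.
Qed.

Lemma ptime_leq A {eA : encodable A} (f g : A -> nat) : ptime f -> ptime g -> ptime (fun a => f a <= g a).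
Proof. by move=> pf pg; apply: ptime_eqn0; exact: ptime_subn. Qed.

Lemma ptime_ltn A {eA : encodable A} (f g : A -> nat) : ptime f -> ptime g -> ptime (fun a => f a < g a).
Proof. by move=> pf pg; apply: ptime_leq => //; exact: ptime_succ. Qed.

Lemma ptime_eqn A {eA : encodable A} (f g : A -> nat) : ptime f -> ptime g -> ptime (fun a => f a == g a).
Proof.
move=> pf pg; apply: (@ptime_ext _ _ _ _ (fun a => (f a <= g a) && (g a <= f a))) => [a|].
  by rewrite eqn_leq.
by apply: ptime_and; exact: ptime_leq.
Qed.

Lemma csize_iota m n : csize (iota m n) <= (n * (4 * (m + n) + 2)).+1.
Proof.
elim: n m => // n IHn m.
by rewrite /= csize_cons csize_natE; have := IHn m.+1; nia.
Qed.

Lemma ptime_size A {eA : encodable A} (B : Type) (eB : encodable B) (f : A -> seq B) :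
  ptime f -> ptime (fun a => size (f a)).
Proof.
move=> pf.
apply: (@ptime_ext _ _ _ _ (fun a => foldr (fun _ n => n.+1) 0 (f a))) => [a|].
  by elim: (f a) => //= x s ->.
apply: (ptime_foldr (F := fun a x n => n.+1) (b := fun=> 4)) => //.
- by apply: ptime_succ; pt.
- exact: ptime_cst.
- exact: pbound_cst.
- by move=> a x y _; rewrite csizeS; lia.
Qed.

Lemma ptime_iota A {eA : encodable A} (f g : A -> nat) : ptime f -> ptime g -> ptime (fun a => iota (f a) (g a)).
Proof.
move=> pf pg.
apply: (@ptime_ext _ _ _ _ (fun a =>
    iter (g a) (fun s => s ++ [:: f a + size s]) [::])) => [a|].
  by elim: (g a) => // n IHn; rewrite iterS IHn size_iota -addn1 iotaD.
apply: (ptime_iter (F := fun a s => s ++ [:: f a + size s])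
  (b := fun a => (csize (g a) * (4 * (csize (f a) + csize (g a)) + 2)).+1)) => //.
- have pp : ptime (fun p : A * seq nat => p.1) by pt.
  apply: ptime_cat; first by pt.
  apply: ptime_cons; last by pt.
  apply: ptime_addn; first exact: (ptime_comp pp pf).
  by apply: ptime_size; pt.
- exact: ptime_cst.
- apply: (@pbound_le _ _ _ (fun a => csize (g a) * (4 * (csize (f a) + csize (g a)) + 2) + 1)).
    by move=> a; rewrite addn1.
  do ?[apply: pboundD || apply: pboundM]; try exact: pbound_cst; exact: pbound_ptime.
- move=> a i ia.
  have -> : iter i (fun s : seq nat => s ++ [:: f a + size s]) [::] = iota (f a) i.
    by elim: i {ia} => // n IHn; rewrite iterS IHn size_iota -addn1 iotaD.
  apply: leq_trans (csize_iota _ _) _; rewrite ltnS !csize_natE; nia.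
Qed.

Lemma ptime_nseq A {eA : encodable A} (B : Type) (eB : encodable B) (f : A -> nat) (x : A -> B) :
  ptime f -> ptime x -> ptime (fun a => nseq (f a) (x a)).
Proof.
move=> pf px.
apply: (@ptime_ext _ _ _ _ (fun a => [seq x a | _ <- nseq (f a) true])) => [a|].
  by rewrite map_nseq.
have pp : ptime (fun p : A * bool => p.1) by pt.
by apply: ptime_map; [exact: (ptime_comp pp px) | exact: ptime_bits].
Qed.

Lemma ptime_drop A {eA : encodable A} (B : Type) (eB : encodable B) (f : A -> nat) (s : A -> seq B) :
  ptime f -> ptime s -> ptime (fun a => drop (f a) (s a)).
Proof.
move=> pf ps.
apply: (@ptime_ext _ _ _ _ (fun a => iter (f a) behead (s a))) => [a|].
  elim: (f a) => [|n IHn]; first by rewrite drop0.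
  by rewrite iterS IHn -drop1 drop_drop.
apply: (ptime_iter_growth (F := fun _ => behead) (b := fun=> 0)) => //.
- by apply: ptime_behead; pt.
- exact: pbound_cst.
- by move=> a [|x r] //=; rewrite csize_cons; lia.
Qed.

Lemma ptime_take A {eA : encodable A} (B : Type) (eB : encodable B) (f : A -> nat) (s : A -> seq B) :
  ptime f -> ptime s -> ptime (fun a => take (f a) (s a)).
Proof.
move=> pf ps.
apply: (@ptime_ext _ _ _ _ (fun a => rev (drop (size (s a) - f a) (rev (s a))))) => [a|].
  case: (leqP (f a) (size (s a))) => fs; first by rewrite drop_rev revK subKn.
  by rewrite (eqP (ltnW fs)) drop0 revK take_oversize // ltnW.
apply/ptime_rev/ptime_drop; last exact: ptime_rev.
by apply: ptime_subn => //; exact: ptime_size.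
Qed.

Lemma ptime_nth A {eA : encodable A} (B : Type) (eB : encodable B) (x : B) (f : A -> nat) (s : A -> seq B) :
  code x = Defs.Nil -> ptime f -> ptime s -> ptime (fun a => nth x (s a) (f a)).
Proof.
move=> x0 pf ps.
apply: (@ptime_ext _ _ _ _ (fun a => head x (drop (f a) (s a)))) => [a|].
  by rewrite -nth0 nth_drop addn0.
by apply: ptime_head => //; exact: ptime_drop.
Qed.

Lemma ptime_index A {eA : encodable A} (f : A -> nat) (s : A -> seq nat) :
  ptime f -> ptime s -> ptime (fun a => index (f a) (s a)).
Proof.
move=> pf ps.
apply: (@ptime_ext _ _ _ _ (fun a =>
   foldr (fun x n => if x == f a then 0 else n.+1) 0 (s a))) => [a|].
  by elim: (s a) => //= x r ->.
apply: (ptime_foldr (F := fun a x n => if x == f a then 0 else n.+1)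
  (b := fun=> 4)) => //.
- have pp : ptime (fun p : A * nat * nat => p.1.1) by pt.
  apply: ptime_if; [|by pt|by apply: ptime_succ; pt].
  apply: ptime_eqn; first by pt.
  exact: (ptime_comp pp pf).
- exact: ptime_cst.
- exact: pbound_cst.
- by move=> a x y _; case: ifP => _; rewrite !csize_natE; lia.
Qed.

Lemma ptime_mem A {eA : encodable A} (f : A -> nat) (s : A -> seq nat) :
  ptime f -> ptime s -> ptime (fun a => f a \in s a).
Proof.
move=> pf ps.
apply: (@ptime_ext _ _ _ _ (fun a => has (fun x => x == f a) (s a))) => [a|].
  by elim: (s a) => //= x r ->; rewrite inE eq_sym.
have pp : ptime (fun p : A * nat => p.1) by pt.
apply: ptime_has => //; apply: ptime_eqn; first by pt.
exact: (ptime_comp pp pf).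
Qed.

Lemma ptime_zip A {eA : encodable A} (B C : Type) (eB : encodable B) (eC : encodable C)
    (x : B) (y : C) (s : A -> seq B) (t : A -> seq C) :
  code x = Defs.Nil -> code y = Defs.Nil -> ptime s -> ptime t ->
  ptime (fun a => zip (s a) (t a)).
Proof.
move=> x0 y0 ps pt'.
apply: (@ptime_ext _ _ _ _ (fun a => [seq (nth x (s a) i, nth y (t a) i) |
   i <- iota 0 (if size (s a) <= size (t a) then size (s a) else size (t a))])) => [a|].
  apply: (@eq_from_nth _ (x, y)) => [|i].
    by rewrite size_map size_iota size_zip /minn; case: ltngtP.
  rewrite size_map size_iota => il.
  rewrite (nth_map 0) ?size_iota // nth_iota // nth_zip_cond size_zip.
  have -> : i < minn (size (s a)) (size (t a)) by case: ifP il; lia.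
  by [].
have pp : ptime (fun p : A * nat => p.1) by pt.
apply: ptime_map.
  by apply: ptime_pair; apply: ptime_nth => //; by [pt | exact: (ptime_comp pp ps) | exact: (ptime_comp pp pt')].
have p1 := ptime_size ps; have p2 := ptime_size pt'.
apply: ptime_iota; first by pt.
by apply: ptime_if => //; exact: ptime_leq.
Qed.

End PTimeLibrary.

Ltac pt_more := fail.
Ltac pt_lib :=
  lazymatch goal with
  | |- ptime (fun x => cat (@?f x) (@?g x)) => apply: ptime_cat
  | |- ptime (fun x => flatten (@?f x)) => apply: ptime_flatten
  | |- ptime (fun x => seq.filter (@?g x) (@?f x)) => apply: ptime_filter
  | |- ptime (fun x => has (@?g x) (@?f x)) => apply: ptime_has
  | |- ptime (fun x => S (@?f x)) => apply: ptime_succ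
  | |- ptime (fun x => predn (@?f x)) => apply: ptime_pred
  | |- ptime (fun x => addn (@?f x) (@?g x)) => apply: ptime_addn
  | |- ptime (fun x => muln (@?f x) (@?g x)) => apply: ptime_muln
  | |- ptime (fun x => subn (@?f x) (@?g x)) => apply: ptime_subn
  | |- ptime (fun x => leq (S (@?f x)) (@?g x)) => apply: ptime_ltn
  | |- ptime (fun x => leq (@?f x) (@?g x)) => apply: ptime_leq
  | |- ptime (fun x => @eq_op _ (@?f x) (@?g x)) =>
      apply: ptime_eqn
  | |- ptime (fun x => iota (@?f x) (@?g x)) => apply: ptime_iota
  | |- ptime (fun x => nseq (@?f x) (@?g x)) => apply: ptime_nseq
  | |- ptime (fun x => size (@?f x)) => apply: ptime_size
  | |- ptime (fun x => drop (@?f x) (@?g x)) => apply: ptime_drop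
  | |- ptime (fun x => take (@?f x) (@?g x)) => apply: ptime_take
  | |- ptime (fun x => nth (@?h x) (@?f x) (@?g x)) => apply: ptime_nth; [reflexivity| |]
  | |- ptime (fun x => index (@?f x) (@?g x)) => apply: ptime_index
  | |- ptime (fun x => @?f x \in @?g x) => apply: ptime_mem
  end.
Ltac pt_user ::= first [pt_lib | pt_more].

(** * The generator and its running time *)

Section GeneratorTime.
Local Open Scope nat_scope.

Lemma csize_bool (b : bool) : csize b <= 3.
Proof. by case: b. Qed.

Lemma csize_seq_le A {eA : encodable A} m (s : seq A) :
  all (fun x => csize x <= m) s -> csize s <= (size s * m.+1).+1.
Proof.
elim: s => // x s IHs /= /andP[xm /IHs]; rewrite csize_cons mulSn.
by move: (size s * _); lia.
Qed.

Lemma all_csize A {eA : encodable A} m (s : seq A) :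
  csize s <= m -> all (fun x => csize x <= m) s.
Proof.
elim: s => //= x s IHs; rewrite csize_cons => sm.
by rewrite IHs ?andbT; lia.
Qed.

Lemma csize_filter A {eA : encodable A} (P : pred A) (s : seq A) :
  csize [seq x <- s | P x] + csize [seq x <- s | ~~ P x] = (csize s).+1.
Proof. by elim: s => //= x s IHs; case: (P x); rewrite /= !csize_cons; lia. Qed.

Lemma ptime_addb_foldr A {eA : encodable A} (s : A -> seq bool) :
  ptime s -> ptime (fun a => foldr addb false (s a)).
Proof.
move=> ps; apply: (ptime_foldr (F := fun _ => addb) (b := fun=> 2)) => //.
- by pt.
- exact: ptime_cst.
- exact: pbound_cst.
- by move=> a x y _; apply: leq_trans (csize_bool _) _; have := csize_gt0 (eA := encodable_bool) x; lia.
Qed.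

Lemma innerE a x : inner a x = foldr addb false [seq p.1 && p.2 | p <- zip a x].
Proof. by elim: a x => [|a0 a IHa] [|x0 x] //=; rewrite IHa. Qed.

Lemma hashE_map a b x :
  hash a b x = [seq inner (drop i a) x (+) nth false b i | i <- iota 0 (size b)].
Proof.
elim: b a => //= b0 b IHb a; rewrite drop0 IHb; congr (_ :: _).
rewrite -[1]addn0 iotaDl -map_comp; apply: eq_map => i /=.
by rewrite add1n -drop1 drop_drop addn1.
Qed.

Section Hash.
Context {A : Type} {eA : encodable A}.

Lemma ptime_inner (a x : A -> seq bool) :
  ptime a -> ptime x -> ptime (fun e => inner (a e) (x e)).
Proof.
move=> pa px; apply: (@ptime_ext _ _ _ _ (fun e => foldr addb false
  [seq p.1 && p.2 | p <- zip (a e) (x e)])) => [e|]; first by rewrite innerE.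
apply: ptime_addb_foldr; apply: ptime_map; first by pt.
exact: (@ptime_zip _ _ _ _ _ _ false false).
Qed.

End Hash.

Lemma ptime_hash A {eA : encodable A} (a b x : A -> seq bool) :
  ptime a -> ptime b -> ptime x -> ptime (fun e => hash (a e) (b e) (x e)).
Proof.
move=> pa pb px; apply: (@ptime_ext _ _ _ _ (fun e =>
  [seq inner (drop i (a e)) (x e) (+) nth false (b e) i | i <- iota 0 (size (b e))])) => [e|].
  by rewrite hashE_map.
have pp : ptime (fun p : A * nat => p.1) by pt.
have pa' := ptime_comp pp pa; have pb' := ptime_comp pp pb; have px' := ptime_comp pp px.
apply: ptime_map; last by pt.
by apply: ptime_addb; [apply: ptime_inner; pt | pt].
Qed.

Lemma parse_hashesE l j u : parse_hashes l j u =
  [seq (take (l + l) (drop (i * (l + l + l)) u),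
        take l (drop (l + l) (drop (i * (l + l + l)) u))) | i <- iota 0 j].
Proof.
elim: j u => //= j IHj u; rewrite mul0n drop0 IHj; congr (_ :: _).
rewrite -[1]addn0 iotaDl -map_comp; apply: eq_map => i /=.
by rewrite drop_drop mulSn addnC.
Qed.

Lemma ptime_parse_hashes A {eA : encodable A} (l j : A -> nat) (u : A -> seq bool) :
  ptime l -> ptime j -> ptime u -> ptime (fun a => parse_hashes (l a) (j a) (u a)).
Proof.
move=> pl pj pu; apply: (ptime_ext (fun a => esym (parse_hashesE (l a) (j a) (u a)))).
have pp : ptime (fun p : A * nat => p.1) by pt.
have pl' := ptime_comp pp pl; have pu' := ptime_comp pp pu.
by apply: ptime_map; pt.
Qed.

Lemma size_leaves hs l : size (leaves hs l) = 2 ^ size hs * size l.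
Proof.
elim: hs l => [|h hs IHhs] l /=; first by rewrite mul1n.
rewrite IHhs /expand size_flatten /shape -map_comp expnSr -mulnA; congr (_ * _).
by elim: l => //= x l ->; rewrite mulnS.
Qed.

Lemma csize_hash a b x : csize (hash a b x) <= 4 * csize b + 1.
Proof.
apply: (leq_trans (@csize_seq_le _ _ 3 _ _)).
  by apply/allP => y _; exact: csize_bool.
by rewrite size_hash addn1 ltnS mulnC leq_mul2l size_le_csize.
Qed.

Lemma all_csize_leaves m hs l :
  all (fun v => csize v <= m) l -> all (fun h => 4 * csize h.2 + 1 <= m) hs ->
  all (fun v => csize v <= m) (leaves hs l).
Proof.
elim: hs l => //= h hs IHhs l lm /andP[hm hsm]; apply: IHhs => //.
elim: l lm => //= v l IHl /andP[vm lm]; rewrite vm IHl // andbT.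
exact: leq_trans (csize_hash _ _ _) hm.
Qed.

Lemma csize_leaves hs l : csize (leaves hs l) <=
  (2 ^ size hs * csize l * (4 * csize hs + csize l + 2)).+1.
Proof.
apply: (leq_trans (@csize_seq_le _ _ (4 * csize hs + csize l + 1) _ _)).
  apply: all_csize_leaves; first by apply: sub_all (all_csize (leqnn _)) => v; lia.
  apply: sub_all (all_csize (leqnn _)) => h; rewrite csize_pair; lia.
rewrite ltnS size_leaves -addnS leq_mul2r; apply/orP; right.
by rewrite leq_mul2l size_le_csize orbT.
Qed.

(** The number of leaves is exponential in the number of hash functions, so a bound on it is
    assumed; later it comes from [levels_le]. *)
Lemma ptime_leaves A {eA : encodable A} (hs : A -> seq (seq bool * seq bool))
    (l : A -> seq (seq bool)) :
  ptime hs -> ptime l -> pbound (fun a => 2 ^ size (hs a)) ->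
  ptime (fun a => leaves (hs a) (l a)).
Proof.
move=> ph pl bh; apply: (ptime_foldl (F := fun _ l h => expand h l)
  (b := fun a => 2 ^ size (hs a) * csize (l a) * (4 * csize (hs a) + csize (l a) + 2) + 1)) => //.
- apply: ptime_flatten; apply: ptime_map; last by pt.
  by apply: ptime_cons; [pt|apply: ptime_cons; [apply: ptime_hash; pt|pt]].
- do ?[apply: pboundD || apply: pboundM] => //; try exact: pbound_cst; exact: pbound_ptime.
move=> a i; apply: (leq_trans (csize_leaves _ _)); rewrite addn1 ltnS.
apply: leq_mul; last by have := @csize_take _ (encodable_prod (encodable_seq encodable_bool) (encodable_seq encodable_bool)) i (hs a); lia.
by rewrite leq_mul2r leq_exp2l // size_take_min geq_minr orbT.
Qed.

Lemma ptime_nisan A {eA : encodable A} (hs : A -> seq (seq bool * seq bool))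
    (x : A -> seq bool) :
  ptime hs -> ptime x -> pbound (fun a => 2 ^ size (hs a)) ->
  ptime (fun a => nisan (hs a) (x a)).
Proof.
move=> ph px bh; rewrite /nisan.
apply: (ptime_map (F := fun _ v => head false v)); first by pt.
by apply: ptime_leaves => //; pt.
Qed.

(** The least L with [n <= 2 ^ L], found by doubling. The fixed number of [n] rounds is enough and
    fits [ptime_iter]. *)
Definition levels n :=
  (iter n (fun p => if p.1 < n then (p.1 + p.1, p.2.+1) else p) (1, 0)).2.

Lemma levels_iter n i :
  let p := iter i (fun p => if p.1 < n then (p.1 + p.1, p.2.+1) else p) (1, 0) in
  [/\ p.1 = 2 ^ p.2, p.1 <= 2 * n + 1, p.2 <= i & (n <= p.1) || (p.2 == i)].
Proof.
elim: i => [|i [IH1 IH2 IH3 IH4]] /=; first by split=> //; lia.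
case: ltnP IH4 => /= h IH4; split=> //.
- by rewrite expnS mul2n -addnn IH1.
- by lia.
- by rewrite (eqP IH4) eqxx orbT.
- exact: leqW.
- by rewrite h.
Qed.

Lemma levels_ge n : n <= 2 ^ levels n.
Proof.
have [-> _ _ /orP[//|/eqP e]] := levels_iter n n.
by rewrite /levels e ltnW // ltn_expl.
Qed.

Lemma levels_le n : 2 ^ levels n <= 2 * n + 1.
Proof. by have [<-] := levels_iter n n. Qed.

Lemma ptime_levels A {eA : encodable A} (n : A -> nat) :
  ptime n -> ptime (fun a => levels (n a)).
Proof.
move=> pn; apply: ptime_snd.
apply: (ptime_iter (F := fun a p => if p.1 < n a then (p.1 + p.1, p.2.+1) else p)
  (b := fun a => 12 * csize (n a) + 12)) => //.
- have pp : ptime (fun p : A * (nat * nat) => p.1) by pt.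
  by have pn' := ptime_comp pp pn; pt.
- exact: ptime_cst.
- do ?[apply: pboundD || apply: pboundM] => //; try exact: pbound_cst; exact: pbound_ptime.
move=> a i ia; have [h1 h2 h3 _] := levels_iter (n a) i.
rewrite csize_pair !csize_natE; lia.
Qed.

Lemma ptime_longest A {eA : encodable A} (ls : A -> seq (seq nat)) :
  ptime ls -> ptime (fun a => longest (ls a)).
Proof.
move=> pl; apply: (ptime_foldr (F := fun _ c b => if size b < size c then c else b)
  (b := fun a => csize (ls a))) => //.
- by pt.
- exact: ptime_cst.
- exact: pbound_ptime.
- by move=> a x y yl; case: ifP; lia.
Qed.

Lemma ptime_key A {eA : encodable A} (u : A -> seq nat) (j x : A -> nat) :
  ptime u -> ptime j -> ptime x -> ptime (fun a => key (u a) (j a) (x a)).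
Proof.
move=> pu pj px; rewrite /key /occ.
have pp : ptime (fun p : A * nat => p.1) by pt.
by have pu' := ptime_comp pp pu; have px' := ptime_comp pp px; pt.
Qed.

Lemma csize_longest m (ls : seq (seq nat)) :
  all (fun c => all (fun x => csize x <= m) c) ls ->
  all (fun x => csize x <= m) (longest ls).
Proof. by elim: ls => //= c ls IHls /andP[cm /IHls h]; case: ifP. Qed.

Lemma size_longest m (ls : seq (seq nat)) :
  all (fun c => size c <= m) ls -> size (longest ls) <= m.
Proof. by elim: ls => //= c ls IHls /andP[cm /IHls h]; case: ifP. Qed.

Lemma csize_chains f m (T : seq nat) : all (fun x => csize x <= m) T ->
  csize (chains f T) <= (size T * (size T * m.+1 + 2)).+1.
Proof.
move=> Tm; have szc : size (chains f T) = size T.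
  by rewrite -(size_map (head 0)) map_head_chains size_rev.
apply: leq_trans (@csize_seq_le _ _ (size T * m.+1 + 1) _ _) _; last first.
  by rewrite szc addn1 addn2.
suff : all (fun c => (size c <= size T) &&
    all (fun x => csize (eA := encodable_nat) x <= m) c) (chains f T).
  apply: sub_all => c /andP[cT /csize_seq_le h]; apply: leq_trans h _.
  by rewrite addn1 ltnS leq_mul2r cT orbT.
elim/last_ind: T Tm {szc} => // T e IHT; rewrite all_rcons => /andP[em /IHT {IHT}IHT].
rewrite chains_rcons /= em size_rcons ltnS /=.
have all1 : all (fun c => size c <= size T) (chains f T).
  by apply: sub_all IHT => c /andP[].
have all2 : all (fun c =>
    all (fun x => csize (eA := encodable_nat) x <= m) c) (chains f T).
  by apply: sub_all IHT => c /andP[].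
rewrite size_longest ?csize_longest /=; last 2 first.
- by rewrite all_filter; apply: sub_all all2 => c h; apply/implyP.
- by rewrite all_filter; apply: sub_all all1 => c h; apply/implyP.
by apply: sub_all IHT => c /andP[/leqW -> ->].
Qed.

Section CombinatorialTime.
Context {A : Type} {eA : encodable A}.

Lemma ptime_chains (u T : A -> seq nat) (j : A -> nat) :
  ptime u -> ptime j -> ptime T ->
  ptime (fun a => chains (key (u a) (j a)) (T a)).
Proof.
move=> pu pj pT; apply: (ptime_foldl (F := fun a tbl e =>
    (e :: longest [seq c <- tbl | key (u a) (j a) (head 0 c) < key (u a) (j a) e]) :: tbl)
  (z := fun=> [::])
  (b := fun a => csize (T a) * (csize (T a) * (csize (T a) + 1) + 2) + 1)) => //.
- have pp : ptime (fun p : A * seq (seq nat) * nat * seq nat => p.1.1.1) by pt.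
  have pu' := ptime_comp pp pu; have pj' := ptime_comp pp pj.
  apply: ptime_cons; last by pt.
  apply: ptime_cons; first by pt.
  apply: ptime_longest; apply: ptime_filter; last by pt.
  by apply: ptime_ltn; apply: ptime_key; pt.
- exact: ptime_cst.
- do ?[apply: pboundD || apply: pboundM] => //; try exact: pbound_cst; exact: pbound_ptime.
move=> a i; rewrite -/(chains _ _).
have tT : size (take i (T a)) <= csize (T a).
  by apply: leq_trans (size_le_csize _) _; exact: csize_take.
apply: leq_trans (csize_chains _ (all_csize _)) _.
  exact: csize_take.
rewrite !addn1 ltnS; apply: leq_mul => //.
by rewrite leq_add2r leq_mul.
Qed.

End CombinatorialTime.

(** Elements only move from the remainder to a new class; the growth is one list cell and one list
    end. *)
Lemma csize_extract f st : csize (extract f st) <= csize st + 2.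
Proof.
rewrite /extract; case: ifP => _; last by rewrite leq_addr.
rewrite !csize_pair csize_cons /=.
have := csize_filter (eA := encodable_nat) (fun e => e \notin longest (chains f st.1)) st.1.
have -> : [seq x <- st.1 | ~~ (x \notin longest (chains f st.1))] =
    [seq x <- st.1 | x \in longest (chains f st.1)].
  by apply: eq_filter => x; rewrite negbK.
have aux (a b r c : nat) : a + b = r.+1 -> (a + (b + c).+1).+1 <= (r + c).+1 + 2.
  by lia.
exact: aux.
Qed.

Lemma ptime_extract A {eA : encodable A} (u : A -> seq nat) (j : A -> nat)
    (st : A -> seq nat * seq (seq nat)) :
  ptime u -> ptime j -> ptime st ->
  ptime (fun a => extract (key (u a) (j a)) (st a)).
Proof.
move=> pu pj ps; rewrite /extract.
have pc : ptime (fun a => longest (chains (key (u a) (j a)) (st a).1)).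
  by apply/ptime_longest/ptime_chains => //; pt.
have pp : ptime (fun p : A * nat => p.1) by pt.
have pc' := ptime_comp pp pc.
apply: ptime_if; last by pt.
  by apply: ptime_ltn; apply: ptime_size; pt.
apply: ptime_pair; first by apply: ptime_filter; pt.
by apply: ptime_cons; [apply: ptime_filter; pt | pt].
Qed.

Lemma ptime_monotone_partition A {eA : encodable A} (u T : A -> seq nat) (j : A -> nat) :
  ptime u -> ptime j -> ptime T ->
  ptime (fun a => monotone_partition (key (u a) (j a)) (T a)).
Proof.
move=> pu pj pT; rewrite /monotone_partition.
have ps : ptime (fun a => iter (size (T a)) (extract (key (u a) (j a))) (T a, [::])).
  apply: (ptime_iter_growth (F := fun a => extract (key (u a) (j a))) (b := fun=> 2)).
  - have pp : ptime (fun p : A * (seq nat * seq (seq nat)) => p.1) by pt.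
    by apply: ptime_extract; [exact: (ptime_comp pp pu)|exact: (ptime_comp pp pj)|pt].
  - by pt.
  - by pt.
  - exact: pbound_cst.
  - by move=> a x; exact: csize_extract.
have pp : ptime (fun p : A * nat => p.1) by pt.
have ps' := ptime_comp pp ps.
apply: ptime_cat; first by pt.
apply: ptime_map; last by pt.
apply: ptime_map; first by pt.
apply: ptime_filter; first by pt.
apply: ptime_rev; apply: ptime_chains; last by pt.
- exact: (ptime_comp pp pu).
- exact: (ptime_comp pp pj).
Qed.

(** [scan] builds its lists on the way back from the recursion; a loop has to carry leader, colour
    and both lists, the latter reversed. *)
Definition scan_step (ov : rel nat) (st : (nat * bool) * (seq nat * seq nat)) e :=
  if (if ov st.1.1 e then st.1.2 else ~~ st.1.2)
  then ((if ov st.1.1 e then st.1.1 else e, true), (st.2.1, e :: st.2.2))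
  else ((if ov st.1.1 e then st.1.1 else e, false), (e :: st.2.1, st.2.2)).

Lemma scan_foldl ov l c T :
  scan ov l c T =
  let r := foldl (scan_step ov) ((l, c), ([::], [::])) T in (rev r.2.1, rev r.2.2).
Proof.
suff gen p q : let r := foldl (scan_step ov) ((l, c), (p, q)) T in
    (rev r.2.1, rev r.2.2) = (rev p ++ (scan ov l c T).1, rev q ++ (scan ov l c T).2).
  by rewrite /= (gen [::] [::]); case: scan.
elim: T l c p q => [|e T IHT] l c p q /=; first by rewrite !cats0.
rewrite {2 4}/scan_step /=; case: (ov l e); case: c => /=;
  by rewrite IHT /= rev_cons cat_rcons.
Qed.

Lemma ptime_block_split A {eA : encodable A} (u T : A -> seq nat) (j j' : A -> nat) :
  ptime u -> ptime j -> ptime j' -> ptime T ->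
  ptime (fun a => block_split (overlap (key (u a) (j a)) (key (u a) (j' a))) (T a)).
Proof.
move=> pu pj pj' pT; rewrite /block_split.
pose ov a := overlap (key (u a) (j a)) (key (u a) (j' a)).
have pr : ptime (fun a =>
    foldl (scan_step (ov a)) ((head 0 (T a), false), ([::], [::])) (T a)).
  apply: (ptime_foldl_growth (F := fun a => scan_step (ov a))
    (b := fun a => 2 * csize (T a) + 10)).
  - set p1 := (fun p : A * (nat * bool * (seq nat * seq nat)) * nat => p.1.1).
    have pp : ptime p1 by rewrite /p1; pt.
    have pu' := ptime_comp pp pu; have pq := ptime_comp pp pj; have pq' := ptime_comp pp pj'.
    have po : ptime (fun p : A * (nat * bool * (seq nat * seq nat)) * nat =>
        ov p.1.1 p.1.2.1.1 p.2).
      by apply: ptime_and; apply: ptime_ltn; apply: ptime_key; pt.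
    rewrite /scan_step; cbv beta.
    apply: ptime_if; first by apply: ptime_if; pt.
      by pt.
    by pt.
  - by pt.
  - by pt.
  - do ?[apply: pboundD || apply: pboundM] => //; try exact: pbound_cst; exact: pbound_ptime.
  - move=> a [[l c] [p q]] y yl; rewrite /scan_step /=.
    have := csize_bool true; have := csize_bool false; have := csize_bool c.
    have := csize_gt0 (eA := encodable_bool) c.
    by case: (if ov a l y then c else ~~ c); case: (ov a l y);
      rewrite !csize_pair /= !csize_cons; lia.
apply: (@ptime_ext _ _ _ _ (fun a => let r := foldl (scan_step (ov a))
   ((head 0 (T a), false), ([::], [::])) (T a) in [:: rev r.2.1; rev r.2.2])) => [a|].
  by rewrite scan_foldl.
by cbv zeta; pt.
Qed.

Section PartsTime.

Lemma csize_seqE (A : Type) (eA : encodable A) (s : seq A) :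
  csize s = (sumn [seq (csize x).+1 | x <- s]).+1.
Proof. by elim: s => // x s IHs; rewrite csize_cons IHs /= addSn addnS. Qed.

Lemma csize_perm (s t : seq nat) : perm_eq s t -> csize s = csize t.
Proof.
by move=> st; rewrite !csize_seqE; congr _.+1; apply/perm_sumn/perm_map.
Qed.

(** Bounds the accumulators of both folds in [parts]: as parts are nonempty, the list overhead of
    each is charged to its elements. *)
Lemma csize_subparts (D : seq nat) P : subparts D P -> csize P <= 3 * csize D.
Proof.
case=> PD Pn; rewrite -(csize_perm PD).
have : forall p, p \in P -> ~~ nilp p by move=> p /Pn[].
elim: P {PD Pn} => //= p P IHP Pn; rewrite csize_cons.
have /IHP h : forall q, q \in P -> ~~ nilp q by move=> q qP; apply: Pn; rewrite inE qP orbT.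
have := csize_cat (eA := encodable_nat) p (flatten P).
have := Pn p (mem_head _ _); case: p {Pn} => //= x p _; rewrite !csize_cons.
have := csize_gt0 (eA := encodable_nat) x; lia.
Qed.

Lemma subparts_nonempty D : subparts D (nonempty_part D).
Proof.
split; first by rewrite /nonempty_part perm_flatten_filter /= cats0.
move=> p; rewrite mem_filter inE => /andP[np /eqP pD].
by rewrite -pD np subseq_refl.
Qed.

Lemma subparts_monotone (K : nat -> nat -> nat) D P js : pairwise ltn D -> subparts D P ->
  subparts D (foldl (fun P j => refine (monotone_partition (K j)) P) P js).
Proof.
move=> sD; elim: js P => //= j js IHjs P sP; apply: IHjs.
have fP p : subseq p D -> perm_eq (flatten (monotone_partition (K j) p)) p /\
    forall q, q \in monotone_partition (K j) p -> subseq q p /\ True.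
  move=> pD; have [h1 h2 _] := monotone_partitionP (K j) (subseq_pairwise_ltn pD sD).
  by split=> // q /h2[].
by have [] := refineP fP sP.
Qed.

Lemma subparts_block (ov : nat * nat -> rel nat) D P L : subparts D P ->
  subparts D (foldl (fun P jj => refine (block_split (ov jj)) P) P L).
Proof.
elim: L P => //= j L IHL P sP; apply: IHL.
have fP p : subseq p D -> perm_eq (flatten (block_split (ov j) p)) p /\
    forall q, q \in block_split (ov j) p -> subseq q p /\ True.
  move=> _; split; first exact: perm_block_split.
  by move=> q qp; split=> //; exact: subseq_block_split qp.
by have [] := refineP fP sP.
Qed.

Lemma ptime_dom A {eA : encodable A} (u : A -> seq nat) :
  ptime u -> ptime (fun a => dom (u a)).
Proof.
move=> pu; rewrite /dom; have pp : ptime (fun p : A * nat => p.1) by pt.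
by have pu' := ptime_comp pp pu; pt.
Qed.

Lemma ptime_parts A {eA : encodable A} (u : A -> seq nat) (k : A -> nat) :
  ptime u -> ptime k ->
  ptime (fun a => parts (key (u a)) (dom (u a)) (k a)).
Proof.
move=> pu pk; have pD := ptime_dom pu.
have bD : pbound (fun a => 3 * csize (dom (u a))).
  by apply: pboundM; [exact: pbound_cst | exact: pbound_ptime].
have sD a : pairwise ltn (dom (u a)) by exact: pairwise_dom.
pose p1 := (fun p : A * seq (seq nat) * nat * seq nat => p.1.1.1).
have pp1 : ptime p1 by rewrite /p1; pt.
have pu1 := ptime_comp pp1 pu.
pose p2 := (fun p : A * seq (seq nat) * (nat * nat) * seq nat => p.1.1.1).
have pp2 : ptime p2 by rewrite /p2; pt.
have pu2 := ptime_comp pp2 pu.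
pose p3 := (fun p : A * nat => p.1).
have pp3 : ptime p3 by rewrite /p3; pt.
have pk3 := ptime_comp pp3 pk.
rewrite /parts; apply: (ptime_foldl
  (F := fun a P jj => refine (block_split (overlap (key (u a) jj.1) (key (u a) jj.2))) P)
  (b := fun a => 3 * csize (dom (u a)))) => //.
- rewrite /refine; apply: ptime_filter; first by pt.
  apply: ptime_flatten; apply: ptime_map; last by pt.
  by apply: ptime_block_split; [exact: pu2|pt|pt|pt].
- apply: (ptime_foldl
    (F := fun a P j => refine (monotone_partition (key (u a) j)) P)
    (b := fun a => 3 * csize (dom (u a)))) => //.
  + rewrite /refine; apply: ptime_filter; first by pt.
    apply: ptime_flatten; apply: ptime_map; last by pt.
    by apply: ptime_monotone_partition; [exact: pu1|pt|pt].
  + by rewrite /nonempty_part; pt.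
  + by pt.
  + move=> a i; apply: csize_subparts; apply: subparts_monotone => //.
    exact: subparts_nonempty.
- rewrite /index_pairs; apply: ptime_flatten; apply: ptime_map; last by pt.
  apply: ptime_map; first by pt.
  by pt.
- move=> a i; apply: csize_subparts.
  apply: (subparts_block (fun jj => overlap (key (u a) jj.1) (key (u a) jj.2))).
  by apply: subparts_monotone => //; exact: subparts_nonempty.
Qed.

End PartsTime.

(* Exponents of the number of parts times the size of a part, of the number of
   rectangles for programs of width below 2 ^ bw, and of the accuracy 2 ^- be. *)
Definition half_length n k bw be :=
  2 * levels n + (9 * (k * k) + 2) * (bw + 1) + be.

(** The state is the list of (name, bit) pairs made so far and the unread seed. A part consumes [2m]
    bits for the input of Nisan's generator and [6m] bits for each of [L] hash functions; [zip] cuts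
    the output to the size of the part. *)
Definition assign_part m L (st : seq (nat * bool) * seq bool) T :=
  (zip T (nisan (parse_hashes (m + m) L (drop (m + m) st.2)) (take (m + m) st.2))
     ++ st.1,
   drop (m + m + L * (m + m + (m + m) + (m + m))) st.2).

Definition assignment n k bw be s y :=
  let u := first_occ (word n k s) in
  (foldl (assign_part (half_length n k bw be) (levels n)) ([::], y)
     (parts (key u) (dom u) k)).1.

Definition generate n k bw be s y :=
  [seq has (fun q => (q.1 == index i (word n k s)) && q.2)
         (assignment n k bw be s y) | i <- iota 0 n].

Lemma csize_zip (T : seq nat) (b : seq bool) : csize (zip T b) <= 5 * csize T.
Proof.
elim: T b => [|t T IHT] [|c b] //.
rewrite /= !csize_cons csize_pair /=; have := IHT b.
have := csize_bool c; move: (csize (zip T b)) => z; lia.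
Qed.

Lemma csize_drop A {eA : encodable A} i (s : seq A) : csize (drop i s) <= csize s.
Proof.
elim: s i => [|x s IHs] [|i] //=; apply: leq_trans (IHs i) _.
by rewrite csize_cons; lia.
Qed.

Lemma ptime_word A {eA : encodable A} (n k : A -> nat) (s : A -> seq nat) :
  ptime n -> ptime k -> ptime s -> ptime (fun a => word (n a) (k a) (s a)).
Proof. by move=> pn pk ps; rewrite /word; pt. Qed.

Lemma ptime_assignment A {eA : encodable A} (n k bw be : A -> nat)
    (s : A -> seq nat) (y : A -> seq bool) :
  ptime n -> ptime k -> ptime bw -> ptime be -> ptime s -> ptime y ->
  ptime (fun a => assignment (n a) (k a) (bw a) (be a) (s a) (y a)).
Proof.
move=> pn pk pbw pbe ps py; rewrite /assignment.
have pu : ptime (fun a => first_occ (word (n a) (k a) (s a))).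
  rewrite /first_occ; have pw := ptime_word pn pk ps.
  have pp : ptime (fun p : A * nat => p.1) by pt.
  by have pw' := ptime_comp pp pw; pt.
have pP := ptime_parts pu pk.
have pL := ptime_levels pn.
have pm : ptime (fun a => half_length (n a) (k a) (bw a) (be a)).
  by rewrite /half_length; pt.
pose B := (seq (nat * bool) * seq bool)%type.
pose p1 := (fun p : A * B * seq nat => p.1.1).
have pp : ptime p1 by rewrite /p1; pt.
have pL' := ptime_comp pp pL; have pm' := ptime_comp pp pm.
apply: ptime_fst; apply: (ptime_foldl_growth
  (F := fun a => assign_part (half_length (n a) (k a) (bw a) (be a)) (levels (n a)))
  (b := fun a => 5 * csize (parts (key (first_occ (word (n a) (k a) (s a))))
                              (dom (first_occ (word (n a) (k a) (s a)))) (k a)))) => //.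
- rewrite /assign_part; cbv beta; apply: ptime_pair; last by pt.
  apply: ptime_cat; last by pt.
  apply: (@ptime_zip _ _ _ _ _ _ 0 false) => //; first by pt.
  apply: ptime_nisan; [by apply: ptime_parse_hashes; pt | by pt |].
  have bn : pbound (fun p : A * B * seq nat => 2 * csize (n p.1.1) + 1).
    apply: pboundD; last exact: pbound_cst.
    apply: pboundM; first exact: pbound_cst.
    exact: (pbound_ptime (ptime_comp pp pn)).
  apply: pbound_le bn => p; rewrite size_parse_hashes.
  by apply: leq_trans (levels_le _) _; rewrite csize_natE; move: (n p.1.1) => v; lia.
- by pt.
- by apply: pboundM; [exact: pbound_cst | exact: pbound_ptime].
move=> a st T Tl; rewrite /assign_part !csize_pair.
set m := half_length _ _ _ _; set z := zip _ _; rewrite /=.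
have := csize_zip T (nisan (parse_hashes (m + m) (levels (n a)) (drop (m + m) st.2))
  (take (m + m) st.2)).
rewrite -/z => h1.
have h2 := csize_cat (eA := encodable_prod encodable_nat encodable_bool) z st.1.
have h3 := csize_drop (eA := encodable_bool)
  (m + m + levels (n a) * (m + m + (m + m) + (m + m))) st.2.
have aux (z' c1 c2 cc d T' P : nat) : T' <= P -> z' <= 5 * T' -> cc.+1 = z' + c1 ->
    d <= c2 -> (cc + d).+1 <= (c1 + c2).+1 + 5 * P by lia.
exact: (aux _ _ _ _ _ _ _ Tl h1 h2 h3).
Qed.

Lemma ptime_generate A {eA : encodable A} (n k bw be : A -> nat)
    (s : A -> seq nat) (y : A -> seq bool) :
  ptime n -> ptime k -> ptime bw -> ptime be -> ptime s -> ptime y ->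
  ptime (fun a => generate (n a) (k a) (bw a) (be a) (s a) (y a)).
Proof.
move=> pn pk pbw pbe ps py; rewrite /generate.
have pa := ptime_assignment pn pk pbw pbe ps py.
have pw := ptime_word pn pk ps.
have pp : ptime (fun p : A * nat => p.1) by pt.
have pa' := ptime_comp pp pa.
have pp2 : ptime (fun p : A * nat * (nat * bool) => p.1.1) by pt.
have pw' := ptime_comp pp2 pw.
by pt.
Qed.

(** Width and accuracy enter only through the lengths of their binary codes. Nested pairs ending in
    [tt] have the same tree as the list that forms the input. *)
Lemma generate_outputs_in_time : exists (c : cmd) (e : nat),
  forall (n k : nat) (wb eb y : seq bool) (s : seq nat),
  let x := (n, (k, (wb, (eb, (s, (y, tt)))))) in
  exists t, t <= (csize x).+1 ^ e /\
    outputs_in_time c (code x) t (enc_bits (generate n k (size wb) (size eb) s y)).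
Proof.
pose In := (nat * (nat * (seq bool * (seq bool * (seq nat * (seq bool * unit))))))%type.
have pg : ptime (fun x : In => generate x.1 x.2.1 (size x.2.2.1) (size x.2.2.2.1)
    x.2.2.2.2.1 x.2.2.2.2.2.1).
  by apply: ptime_generate; pt.
case: pg => _ [c [T [[e TP] cP]]]; exists (c 0), e => n k wb eb y s x.
have [] := cP 0 (upd (fun=> Defs.Nil) 0 (code x)) x; first by rewrite /upd.
move=> t [st [ex tT [st0 _]]]; exists t; split; first exact: leq_trans tT (TP x).
by exists st.
Qed.

End GeneratorTime.

(** * Branching programs are rectangular on a part *)

Section Automaton.
Local Open Scope nat_scope.

Definition run_from (V : Type) (tau : nat -> bool -> V -> V) (b : nat -> bool)
    (q : V) (ts : seq nat) : V :=
  foldl (fun q t => tau t (b t) q) q ts.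

(** A state at time [t] is an index among the vertices of layer [t] and the two sinks, which are
    added to every layer because a path may have ended early: hence [w + 2] states. *)
Lemma bp_automaton n w (S : seq 'I_n) (B : branching_program n)
    (f : n.-tuple bool -> bool) :
  reading_order B S -> bp_width B <= w -> bp_computes B f ->
  exists (tau : nat -> bool -> 'I_w.+2 -> 'I_w.+2) (q0 : 'I_w.+2) (acc : pred 'I_w.+2),
  forall (x : n.-tuple bool) (b : nat -> bool),
    (forall t i, onth S t = Some i -> b t = tnth x i) ->
    f x = acc (run_from tau b q0 (iota 0 (size S))).
Proof.
move=> ro wB fB.
pose sinks := [:: accept B; reject B].
pose V t : seq (vertex B) := sinks ++ enum [set v : vertex B | layer v == t].
have sV t : size (V t) <= w.+2.
  rewrite size_cat /= !ltnS -cardE.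
  have [v vt|none] := pickP (fun v : vertex B => layer v == t).
    apply: leq_trans wB; rewrite -(eqP vt).
    exact: (leq_bigmax (F := fun v : vertex B => #|[set u : vertex B | layer u == layer v]|) v).
  by rewrite eq_card0 // => v; rewrite !inE none.
pose enc t v : 'I_w.+2 := inord (index v (V t)).
pose dec t (q : 'I_w.+2) := nth (accept B) (V t) q.
have encK t v : v \in V t -> dec t (enc t v) = v.
  move=> vV; rewrite /dec inordK ?nth_index //.
  by apply: leq_trans (sV t); rewrite index_mem.
pose delta b (v : vertex B) := if label v is Some _ then succ v b else v.
pose tau t b q := enc t.+1 (delta b (dec t q)).
exists tau, (enc 0 (source B)), (fun q => dec (size S) q == accept B) => x b bx.
have sinkV v t : v \in sinks -> v \in V t by move=> vs; rewrite mem_cat vs.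
have stepV t v : v \in V t -> bp_step x v \in V t.+1 /\ bp_step x v = delta (b t) v.
  move=> vV; rewrite /bp_step /delta; case lv : (label v) => [i|]; last first.
    by split=> //; apply: sinkV; rewrite -sinkE lv.
  have lvN : label v != None by rewrite lv.
  have vt : layer v = t.
    move: vV; rewrite mem_cat -sinkE (negbTE lvN) /= mem_enum inE; exact: eqP.
  have -> : b t = tnth x i.
    apply: bx; apply/eqP; rewrite -ro /layers_reading mem_undup -vt.
    by apply: map_f; rewrite mem_enum inE lv.
  split=> //; rewrite mem_cat; apply/orP; right.
  by rewrite mem_enum inE succ_layer // vt.
have iterV t : iter t (bp_step x) (source B) \in V t /\
    run_from tau b (enc 0 (source B)) (iota 0 t) = enc t (iter t (bp_step x) (source B)).
  elim: t => [|t [IH1 IH2]].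
    split=> //; rewrite mem_cat; apply/orP; right.
    by rewrite mem_enum inE source_unique.
  rewrite iterS; have [s1 s2] := stepV _ _ IH1; split=> //.
  have -> : iota 0 t.+1 = rcons (iota 0 t) t by rewrite -[X in iota _ X]addn1 iotaD cats1.
  by rewrite /run_from foldl_rcons -/(run_from _ _ _ _) IH2 /tau encK // -s2.
have [vV ->] := iterV (size S); rewrite encK //; set v := iter _ _ _ in vV *.
have fixs u m : u \in sinks -> iter m (bp_step x) u = u.
  move=> us; elim: m => //= m ->; rewrite /bp_step.
  by have := sinkE u; rewrite us; case: label.
(* A labelled vertex in layer [size S] would read a position beyond the end of [S]. *)
have vs : v \in sinks.
  rewrite -sinkE; case lv : (label v) => [i|//].
  have vt : layer v = size S.
    by move: vV; rewrite mem_cat -sinkE lv /= mem_enum inE => /eqP.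
  have := ro (size S) i; rewrite /layers_reading mem_undup -vt map_f ?mem_enum ?inE ?lv //.
  by rewrite vt onth_default.
rewrite fB; apply/idP/eqP => [/iter_findex e|va]; last first.
  by rewrite -va fconnect_iter.
have accs : accept B \in sinks by rewrite inE eqxx.
(* Sinks are fixed by [bp_step], so the iterates [m] and [size S] coincide, whichever comes
   first. *)
move: e; set m := findex _ _ _ => e.
have [le|/ltnW le] := leqP m (size S).
  by rewrite /v -(subnK le) iterD e fixs.
by rewrite -e -(subnK le) iterD -/v fixs.
Qed.

End Automaton.

Section Rectangular.
Local Open Scope nat_scope.

Variables (W N k : nat) (tau : nat -> bool -> 'I_W -> 'I_W) (q0 : 'I_W).
Variables (acc : pred 'I_W) (phi : nat -> nat) (K : nat -> nat -> nat).
Variables (p : seq nat) (rho : nat -> bool).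

Definition update (z : seq bool) v :=
  if v \in p then nth false z (index v p) else rho v.

Hypothesis k_gt1 : 1 < k.
Hypothesis p_lt : pairwise ltn p.
Hypothesis K_lt : forall x j j', x \in p -> j < j' < k -> K j x < K j' x.
Hypothesis K_neq : forall x y j j', x \in p -> y \in p -> j < k -> j' < k ->
  x != y -> K j x != K j' y.
Hypothesis K_mono : forall j, j < k -> monotone (K j) p.
Hypothesis K_trans : forall j j', j < j' < k ->
  codirected (K j) (K j') p -> overlap_trans (K j) (K j') p.
Hypothesis K_cover : forall t, t < N -> phi t \in p ->
  exists2 j, j < k & K j (phi t) = t.

(** Two reading times of variables of [p] belong to keys [j] and [j'], and the three thresholds of
    this one pair classify both. *)
Lemma cut_thresholds (s : pred nat) :
  (forall x y, x \in p -> y \in p -> x < y -> s y -> s x) ->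
  exists D : seq nat, size D <= 3 * (k * k) /\
    forall t t', t <= t' -> t' < N -> phi t \in p -> phi t' \in p ->
      (forall d, d \in D -> ~~ (t < d <= t')) -> s (phi t) = s (phi t').
Proof.
move=> sP.
have [D [Dsz DP]] : exists D : seq nat, size D = 3 * size (index_pairs k) /\
  forall jj, jj \in index_pairs k -> exists g : nat -> bool,
    (forall q q', q <= q' -> (forall d, d \in D -> ~~ (q < d <= q')) -> g q = g q')
    /\ forall x, x \in p -> g (K jj.1 x) = s x /\ g (K jj.2 x) = s x.
  have : forall jj, jj \in index_pairs k -> jj.1 < jj.2 < k.
    by case=> j j'; rewrite mem_index_pairs.
  elim: (index_pairs k) => [|[j j'] L IHL] LP; first by exists [::].
  have /IHL[D [Dsz DP]] : forall jj, jj \in L -> jj.1 < jj.2 < k.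
    by move=> jj jL; apply: LP; rewrite inE jL orbT.
  have /= jj' := LP (j, j') (mem_head _ _); have [jlt jk] := andP jj'.
  have [||||||D' [D'sz [g [gc gs]]]] := @thresholds (K j) (K j') p s; rewrite //.
  - by move=> x xp; exact: K_lt.
  - by move=> x y xp yp; apply: K_neq => //; exact: ltn_trans jk.
  - by apply: K_mono; exact: ltn_trans jk.
  - exact: K_mono.
  - exact: K_trans.
  exists (D' ++ D); split; first by rewrite size_cat D'sz Dsz /= mulnS.
  move=> jj; rewrite inE => /orP[/eqP ->|/DP[g' [gc' gs']]].
    exists g; split=> // q q' qq' h; apply: gc => // d dD.
    by apply: h; rewrite mem_cat dD.
  exists g'; split=> // q q' qq' h; apply: gc' => // d dD.
  by apply: h; rewrite mem_cat dD orbT.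
exists D; split.
  rewrite Dsz leq_mul2l /=; apply: leq_trans (size_index_pairs k) _.
  by rewrite leq_mul2l leq_pred orbT.
move=> t t' tt' t'N tp t'p h.
have [j jk Kt] := K_cover (leq_ltn_trans tt' t'N) tp.
have [j' jk' Kt'] := K_cover t'N t'p.
have concl i i' : i < i' < k -> (j == i) || (j == i') -> (j' == i) || (j' == i') ->
    s (phi t) = s (phi t').
  rewrite -mem_index_pairs => /DP[g [gc gs]] ji ji'.
  have gt : g t = s (phi t).
    by rewrite -{1}Kt; have [] := gs _ tp; case/orP: ji => /eqP ->.
  have gt' : g t' = s (phi t').
    by rewrite -{1}Kt'; have [] := gs _ t'p; case/orP: ji' => /eqP ->.
  by rewrite -gt -gt'; exact: gc.
have [lt|gt|e] := ltngtP j j'.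
- by apply: (concl j j'); rewrite ?lt ?eqxx ?orbT.
- by apply: (concl j' j); rewrite ?gt ?eqxx ?orbT.
(* Equal keys are classified by any pair containing [j]; one exists because [k > 1]. *)
- have [j0|j0] := posnP j; first by apply: (concl 0 1); rewrite // -?e j0.
  apply: (concl j.-1 j); rewrite -?e ?eqxx ?orbT //; first by rewrite prednK ?leqnn.
Qed.

Lemma eq_run_from (V : Type) (tau' : nat -> bool -> V -> V) b b' q ts :
  (forall t, t \in ts -> b t = b' t) -> run_from tau' b q ts = run_from tau' b' q ts.
Proof.
elim: ts q => //= t ts IHts q bb'; rewrite bb' ?mem_head //.
by apply: IHts => t' t'ts; apply: bb'; rewrite inE t'ts orbT.
Qed.

Definition accepts z :=
  acc (run_from tau (fun t => update z (phi t)) q0 (iota 0 N)).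

Lemma index_initial c x y : x \in p -> y \in p -> x < y ->
  index y p < c -> index x p < c.
Proof.
move=> xp yp xy; apply: leq_ltn_trans; rewrite leqNgt; apply/negP => yx.
have := pairwiseP 0 p_lt (index y p) (index x p).
rewrite !inE !index_mem => /(_ yp xp yx); rewrite !nth_index //=.
by rewrite ltnNge (ltnW xy).
Qed.

(** The two windows have three borders, each with at most [3 k^2] thresholds. Together with both
    ends of the run this gives at most [9 k^2 + 2] checkpoints. Between checkpoints, the variables
    of [p] that are read all lie in the first window, all in the second, or all outside. *)
Lemma rectangular_accepts : rectangular (W ^ (9 * (k * k) + 2)) accepts.
Proof.
move=> o m1 m2.
have [D1 [D1sz D1P]] := cut_thresholds (@index_initial o).
have [D2 [D2sz D2P]] := cut_thresholds (@index_initial (o + m1)).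
have [D3 [D3sz D3P]] := cut_thresholds (@index_initial (o + m1 + m2)).
pose D := D1 ++ D2 ++ D3; pose M := size D.
pose T := sort leq [seq minn d N | d <- D].
have sizeT : size T = M by rewrite size_sort size_map.
(* The prepended 0 and the default [N] make [time 0] the start and [time M.+1] the end of the
   run. *)
pose time c := nth N (0 :: T) c.
have timeN c : time c <= N.
  rewrite /time; have [cs|cs] := ltnP c (size (0 :: T)); last by rewrite nth_default.
  have := mem_nth N cs; rewrite inE => /orP[/eqP -> //|].
  by rewrite mem_sort => /mapP[d _ ->]; rewrite geq_minr.
have timeE : time M.+1 = N by rewrite /time nth_default //= sizeT.
have time_le c c' : c <= c' -> time c <= time c'.
  move=> cc'; have [c's|c's] := ltnP c' (size (0 :: T)); last first.
    by rewrite [time c']nth_default.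
  rewrite /time; apply: (sorted_leq_nth leq_trans leqnn N) => //.
  - rewrite /= path_min_sorted; first exact: sort_sorted leq_total _.
    by apply/allP.
  - exact: leq_ltn_trans c's.
pose seg c := iota (time c) (time c.+1 - time c).
have segE c t : t \in seg c -> time c <= t < time c.+1.
  by rewrite mem_iota subnKC // time_le.
have segN c t : t \in seg c -> t < N.
  by move=> /segE/andP[_]/leq_trans; apply.
have segD c t t' d : t \in seg c -> t' \in seg c -> d \in D -> ~~ (t < d <= t').
  move=> tc t'c dD; apply/negP => /andP[td dt'].
  have /andP[ct _] := segE _ _ tc; have /andP[_ t'c1] := segE _ _ t'c.
  have dN : d < N by apply: leq_ltn_trans dt' (segN _ _ t'c).
  have dT : d \in T.
    by rewrite mem_sort; apply/mapP; exists d => //; rewrite (minn_idPl (ltnW dN)).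
  have dtime : time (index d T).+1 = d by rewrite /time /= nth_index.
  have [le|gt] := leqP c.+1 (index d T).+1.
    by have := time_le _ _ le; rewrite dtime; lia.
  by have := time_le _ _ (gt : (index d T).+1 <= c); rewrite dtime; lia.
have cutE c t t' : t \in seg c -> t' \in seg c -> phi t \in p -> phi t' \in p ->
    [/\ (index (phi t) p < o) = (index (phi t') p < o),
        (index (phi t) p < o + m1) = (index (phi t') p < o + m1)
      & (index (phi t) p < o + m1 + m2) = (index (phi t') p < o + m1 + m2)].
  move=> tc t'c tp t'p.
  wlog tt' : t t' tc t'c tp t'p / t <= t'.
    move=> Wl; have [/Wl|/ltnW/Wl] := leqP t t'; first exact.
    by move=> /(_ t'c tc t'p tp)[-> -> ->].
  have inD d : [|| d \in D1, d \in D2 | d \in D3] -> d \in D by rewrite !mem_cat.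
  split; [apply: D1P | apply: D2P | apply: D3P] => //; try exact: segN t'c;
    by move=> d dD; apply: segD tc t'c _; apply: inD; rewrite dD ?orbT.
pose inI x := (o <= index x p < o + m1).
pose inJ x := (o + m1 <= index x p < o + m1 + m2).
pose kI c := has (fun t => (phi t \in p) && inI (phi t)) (seg c).
pose kJ c := has (fun t => (phi t \in p) && inJ (phi t)) (seg c).
have kIP c t : kI c -> t \in seg c -> phi t \in p -> inI (phi t).
  move=> /hasP[t' t'c /andP[t'p]] + tc tp; rewrite /inI.
  by have [] := cutE _ _ _ t'c tc t'p tp; lia.
have kJP c t : kJ c -> t \in seg c -> phi t \in p -> inJ (phi t).
  move=> /hasP[t' t'c /andP[t'p]] + tc tp; rewrite /inJ.
  by have [] := cutE _ _ _ t'c tc t'p tp; lia.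
have kOP c t : ~~ kI c -> ~~ kJ c -> t \in seg c -> phi t \in p ->
    (index (phi t) p < o) || (o + m1 + m2 <= index (phi t) p).
  move=> /hasPn nI /hasPn nJ tc tp; have := nI t tc; have := nJ t tc.
  by rewrite tp /inI /inJ; lia.
pose bz z t := update z (phi t).
pose g c z q := run_from tau (bz z) q (seg c).
pose st z c := run_from tau (bz z) q0 (iota 0 (time c)).
have stS z c : st z c.+1 = g c z (st z c).
  rewrite /st /g /seg /run_from -foldl_cat -(iotaD 0) subnKC //; exact: time_le.
have g_ext c z z' q : (forall t, t \in seg c -> phi t \in p ->
    nth false z (index (phi t) p) = nth false z' (index (phi t) p)) ->
    g c z q = g c z' q.
  move=> h; apply: eq_run_from => t tc; rewrite /bz /update.
  by case: ifP => // tp; exact: h.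
pose Q := {ffun 'I_M.+2 -> 'I_W}.
pose ok z (c : 'I_M.+1) (q : Q) := g c z (q (inord c)) == q (inord c.+1).
(* Each factor sees one window only. The bits before it are filled with [false], harmlessly, since
   the segments it checks read none of them. *)
exists Q, (fun q s1 => [forall c : 'I_M.+1, kI c ==> ok (nseq o false ++ s1) c q]).
exists (fun q s2 => [forall c : 'I_M.+1, kJ c ==> ok (nseq (o + m1) false ++ s2) c q]).
split.
  rewrite card_ffun !card_ord; have [->|W0] := posnP W; first by rewrite !addn2 !exp0n.
  rewrite leq_pexp2l // /M /D !size_cat; lia.
move=> pre post preo.
exists (fun q : Q => [&& q ord0 == q0, acc (q ord_max) &
   [forall c : 'I_M.+1, ~~ kI c && ~~ kJ c ==> ok (pre ++ nseq (m1 + m2) false ++ post) c q]]).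
move=> s1 s2 s1m s2m; set z := pre ++ _.
have okI (c : 'I_M.+1) (q : Q) : kI c -> ok (nseq o false ++ s1) c q = ok z c q.
  move=> kc; rewrite /ok (@g_ext c _ z) // => t tc tp.
  have := kIP _ _ kc tc tp; rewrite /inI /z !nth_cat size_nseq preo s1m.
  move: (index _ _) => i ii; have -> : (i < o) = false by lia.
  by have -> : i - o < m1 by lia.
have okJ (c : 'I_M.+1) (q : Q) : kJ c -> ok (nseq (o + m1) false ++ s2) c q = ok z c q.
  move=> kc; rewrite /ok (@g_ext c _ z) // => t tc tp.
  have := kJP _ _ kc tc tp; rewrite /inJ /z !nth_cat size_nseq preo s1m s2m.
  move: (index _ _) => i ii; have -> : (i < o + m1) = false by lia.
  have -> : (i < o) = false by lia.
  have -> : (i - o < m1) = false by lia.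
  have -> : i - o - m1 < m2 by lia.
  by rewrite subnDA.
have okO (c : 'I_M.+1) (q : Q) : ~~ kI c -> ~~ kJ c ->
    ok (pre ++ nseq (m1 + m2) false ++ post) c q = ok z c q.
  move=> kc kc'; rewrite /ok (@g_ext c _ z) // => t tc tp.
  have := kOP _ _ kc kc' tc tp; rewrite /z !nth_cat size_nseq preo s1m s2m.
  move: (index _ _) => i; case: ltnP => //= oi ii.
  have -> : (i - o < m1 + m2) = false by lia.
  have -> : (i - o < m1) = false by lia.
  have -> : (i - o - m1 < m2) = false by lia.
  by rewrite subnDA.
pose qs : Q := [ffun c : 'I_M.+2 => st z c].
have all_ok (q : Q) : q ord0 == q0 -> (forall c, ok z c q) -> q = qs.
  move=> /eqP q00 okq; apply/ffunP => c; rewrite ffunE.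
  have : forall i, i <= M.+1 -> q (inord i) = st z i.
    elim=> [|i IHi] iM.
      rewrite /st /time /= -q00; congr (q _); apply: val_inj.
      by rewrite /= inordK.
    have := okq (Ordinal iM); rewrite /ok /= IHi; last exact: ltnW.
    by rewrite -stS => /eqP.
  by move=> /(_ c); rewrite inord_val; apply; rewrite -ltnS.
have qs_ok (c : 'I_M.+1) : ok z c qs.
  have cM := ltn_ord c.
  by rewrite /ok !ffunE !inordK ?stS // ltnS // ltnW.
have qs0 : qs ord0 = q0 by rewrite ffunE.
have qsM : acc (qs ord_max) = accepts z by rewrite ffunE /= /st timeE.
(* The true run [qs] is the only guess that can pass all checks. *)
transitivity (\sum_(q : Q) ((q == qs) && accepts z : nat)).
  rewrite (bigD1 qs) //= eqxx big1 ?addn0 // => q /negbTE ->.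
  by [].
rewrite [RHS]big_mkcond /=; apply: eq_bigr => q _.
have [->|qN] := eqVneq q qs.
  have -> : [forall c : 'I_M.+1, kI c ==> ok (nseq o false ++ s1) c qs].
    by apply/forallP => c; apply/implyP => kc; rewrite okI.
  have -> : [forall c : 'I_M.+1, kJ c ==> ok (nseq (o + m1) false ++ s2) c qs].
    by apply/forallP => c; apply/implyP => kc; rewrite okJ.
  have -> : [forall c : 'I_M.+1, ~~ kI c && ~~ kJ c ==>
      ok (pre ++ nseq (m1 + m2) false ++ post) c qs].
    by apply/forallP => c; apply/implyP => /andP[kc kc']; rewrite okO.
  by rewrite qs0 eqxx qsM /= andbT; case: (accepts z).
case: ifP => // /and3P[q00 _ /forallP hO].
case: forallP => // hI; case: forallP => // hJ; case/eqP: qN.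
apply: all_ok => // c; have [kc|kc] := boolP (kI c).
  by rewrite -okI //; exact: implyP (hI c) kc.
have [kc'|kc'] := boolP (kJ c).
  by rewrite -okJ //; exact: implyP (hJ c) kc'.
by rewrite -okO //; apply: (implyP (hO c)); rewrite kc kc'.
Qed.

End Rectangular.

(** * Fooling *)

Section Hybrid.
Variable R : realFieldType.

Lemma avg_tuple m (F : seq bool -> R) :
  avg m F = (\sum_(t : m.-tuple bool) F t) / 2 ^+ m.
Proof.
elim: m F => [|m IHm] F /=.
  by rewrite expr0 divr1 (big_pred1 [tuple]) // => t; apply/esym/eqP; exact: tuple0.
rewrite !IHm -mulrDl exprSr invfM mulrA; congr (_ / _ / _).
pose h (p : bool * m.-tuple bool) := cons_tuple p.1 p.2.
have hbij : bijective h.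
  exists (fun t : m.+1.-tuple bool => (thead t, behead_tuple t)).
    by move=> [b t]; congr (_, _); apply: val_inj.
  by case/tupleP=> b t; rewrite /h /= theadE; apply: val_inj.
rewrite (reindex h) /=; last exact: onW_bij.
rewrite -(pair_bigA _ (fun b (t : m.-tuple bool) => F (b :: t))) /= big_bool.
by [].
Qed.

Lemma prob_avg m (E : pred (m.-tuple bool)) (F : seq bool -> bool) :
  (forall t : m.-tuple bool, F t = E t) ->
  #|E|%:R / 2 ^+ m = avg m (fun s => (F s)%:R) :> R.
Proof.
move=> FE; rewrite avg_tuple; congr (_ / _).
rewrite -sum1_card natr_sum big_mkcond /=; apply: eq_bigr => t _.
by rewrite FE -[E t]/(t \in E); case: (t \in E).
Qed.

Local Open Scope nat_scope.

Definition part_bits l L y := nisan (parse_hashes l L (drop l y)) (take l y).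

(** The generator's list of pairs seen as an assignment, consuming the seed in the order of
    [assign_part], in a form suited to induction over the parts. *)
Fixpoint seeded l L (P : seq (seq nat)) (y : seq bool) : nat -> bool :=
  if P is T :: P'
  then update T (seeded l L P' (drop (l + L * (l + l + l)) y)) (part_bits l L y)
  else fun=> false.

Lemma update_comm (T T' : seq nat) rho z z' :
  ~~ has (mem T) T' ->
  update T (update T' rho z') z = update T' (update T rho z) z'.
Proof.
move=> TT'; apply/funext => v; rewrite /update.
case: ifP => vT; case: ifP => // vT'.
by case/hasP: TT'; exists v.
Qed.

Lemma update_cat (T T' : seq nat) rho z z' : size z = size T ->
  update (T ++ T') rho (z ++ z') = update T (update T' rho z') z.
Proof.
move=> zT; apply/funext => v; rewrite /update mem_cat index_cat nth_cat zT.
case: (boolP (v \in T)) => vT /=; first by rewrite index_mem vT.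
by case: ifP => // vT'; rewrite ltnNge leq_addr /= addKn.
Qed.

Lemma seeded_out l L P y v : v \notin flatten P -> seeded l L P y v = false.
Proof.
elim: P y => //= T P IHP y; rewrite mem_cat negb_or => /andP[/negbTE vT vP].
by rewrite /update vT IHP.
Qed.

Lemma has_zip (T : seq nat) (b : seq bool) v : uniq T ->
  has (fun q => (q.1 == v) && q.2) (zip T b) = (v \in T) && nth false b (index v T).
Proof.
elim: T b => [|t T IHT] [|c b] //=; first by rewrite nth_nil andbF.
move=> /andP[tT uT]; rewrite IHT // inE.
by case: (eqVneq t v) => [e|tv] //=; rewrite -e (negbTE tT) orbF.
Qed.

Lemma has_assign m L P asg y v : uniq (flatten P) ->
  has (fun q => (q.1 == v) && q.2) (foldl (assign_part m L) (asg, y) P).1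
  = has (fun q => (q.1 == v) && q.2) asg || seeded (m + m) L P y v.
Proof.
elim: P asg y => [|T P IHP] asg y /=; first by rewrite orbF.
rewrite cat_uniq => /and3P[uT TP uP].
rewrite {2}/assign_part /= IHP // has_cat has_zip // /update.
case: (boolP (v \in T)) => [vT|vT] //=.
rewrite (seeded_out _ _ _ (_ : v \notin flatten P)) ?orbF 1?orbC //.
by apply: contra TP => vP; apply/hasP; exists v.
Qed.

Lemma parse_hashes_prefix l j u v : size u = j * (l + l + l) ->
  parse_hashes l j (u ++ v) = parse_hashes l j u.
Proof.
elim: j u => // j IHj u uj.
have u1 : size (take (l + l + l) u) = l + l + l.
  by rewrite size_takel // uj mulSn leq_addr.
have u2 : size (drop (l + l + l) u) = j * (l + l + l).
  by rewrite size_drop uj mulSn addKn.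
rewrite -(cat_take_drop (l + l + l) u) -catA !parse_hashes_cat //.
by rewrite IHj.
Qed.

Lemma update_take T rho z : update T rho (take (size T) z) = update T rho z.
Proof.
apply/funext => v; rewrite /update; case: ifP => // vT.
by rewrite nth_take // index_mem.
Qed.

(** The tail is exchanged first, by induction for a modified [Phi], with the bits of the first part
    uniform and fixed; then the first part, with the seed of the tail fixed. So rectangularity is
    asked for every [rho]. *)
Lemma hybrid m K L (Phi : (nat -> bool) -> bool) (P : seq (seq nat)) :
  0 < m -> uniq (flatten P) -> (forall T, T \in P -> size T <= 2 ^ L) ->
  (forall T rho, T \in P -> rectangular K (fun z => Phi (update T rho z))) ->
  (`|avg (size P * (m.*2 + L * (m.*2 + m.*2 + m.*2)))
       (fun y => (Phi (seeded m.*2 L P y))%:R)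
     - avg (size (flatten P))
         (fun u => (Phi (update (flatten P) (fun=> false) u))%:R)|
    <= (size P)%:R * (2 ^+ L * (K%:R * 2 ^- m)) :> R)%R.
Proof.
move=> m0; elim: P Phi => [|T P IHP] Phi.
  move=> _ _ _; rewrite mul0r /= (_ : update [::] _ _ = fun=> false) ?subrr ?normr0 //.
rewrite /= cat_uniq => /and3P[uT TP uP] sP rP.
set l := m.*2; set Ml := l + L * (l + l + l).
set eps := (2 ^+ L * (K%:R * 2 ^- m))%R.
rewrite mulSn size_cat (avg_cat Ml) (avg_cat (size T)).
have -> : avg Ml (fun y1 => avg (size P * Ml) (fun y2 =>
    (Phi (update T (seeded l L P (drop Ml (y1 ++ y2))) (part_bits l L (y1 ++ y2))))%:R))
  = avg Ml (fun y1 => avg (size P * Ml) (fun y2 =>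
    (Phi (update T (seeded l L P y2) (part_bits l L y1)))%:R : R))%R.
  apply: eq_avg => y1 y1l; apply: eq_avg => y2 _.
  rewrite drop_size_cat // /part_bits take_cat drop_cat y1l.
  have [lt|ge] := ltnP l Ml; first by rewrite parse_hashes_prefix // size_drop y1l addKn.
  (* [Ml <= l] leaves no room for hash functions, so none are parsed. *)
  have L0 : L = 0 by move: ge; rewrite /Ml /l; case: (L) m0; case: (m); lia.
  have lM : l = Ml by rewrite /Ml L0 mul0n addn0.
  by rewrite L0 /= lM subnn take0 cats0 -y1l take_size.
have -> : avg (size T) (fun u1 => avg (size (flatten P)) (fun u2 =>
    (Phi (update (T ++ flatten P) (fun=> false) (u1 ++ u2)))%:R))
  = avg (size T) (fun u1 => avg (size (flatten P)) (fun u2 =>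
    (Phi (update T (update (flatten P) (fun=> false) u2) u1))%:R : R))%R.
  by apply: eq_avg => u1 u1T; apply: eq_avg => u2 _; rewrite update_cat.
set A := avg Ml _; set C := avg (size T) _.
pose B := avg (size T) (fun u1 => avg (size P * Ml) (fun y2 =>
    (Phi (update T (seeded l L P y2) u1))%:R : R))%R.
have -> : (A - C = (A - B) + (B - C))%R by ring.
apply: (le_trans (ler_normD _ _)).
rewrite -natr1 mulrDl mul1r addrC; apply: lerD.
  rewrite /B /C -avgB; apply: (le_trans (avg_norm _ _)).
  rewrite -[leRHS](avg_cst (size T)); apply: le_avg => u1 _.
  apply: (IHP (fun r => Phi (update T r u1))) => //.
    by move=> T' T'P; apply: sP; rewrite inE T'P orbT.
  move=> T' rho T'P.
  (* Updates on disjoint parts commute, so the fixed first part becomes another [rho] for [T']. *)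
  have -> : (fun z => Phi (update T (update T' rho z) u1)) =
      (fun z => Phi (update T' (update T rho u1) z)).
    apply/funext => z; rewrite update_comm //.
    apply: contra TP => /hasP[v vT' vT]; apply/hasP; exists v => //.
    by apply/flattenP; exists T'.
  by apply: rP; rewrite inE T'P orbT.
rewrite /A /B avg_swap [X in (_ - X)%R]avg_swap -avgB.
apply: (le_trans (avg_norm _ _)).
rewrite -[leRHS](avg_cst (size P * Ml)); apply: le_avg => y2 _.
set rho := seeded _ _ _ _.
have := nisan_fools R L m0 (rP T rho (mem_head _ _)).
congr (`|_ - _| <= _)%R.
  rewrite /Ml avg_cat; apply: eq_avg => x xl; apply: eq_avg => u ul.
  by rewrite /part_bits take_size_cat // drop_size_cat.
(* Nisan's generator yields [2 ^ L] bits; those beyond [size T] are ignored. *)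
rewrite -(subnKC (sP T (mem_head _ _))) -[RHS](avg_prefix _ (2 ^ L - size T)).
by apply: eq_avg => z _; rewrite update_take.
Qed.

(** Naming variables by [g] and looking names up in [F] permutes the coordinates of a uniform
    string. *)
Lemma avg_update n (F : seq nat) (f : n.-tuple bool -> bool) (g : nat -> nat) :
  uniq F -> perm_eq [seq g i | i <- iota 0 n] F ->
  (avg (size F) (fun u => (f [tuple update F (fun=> false) u (g i) | i < n])%:R)
   = (\sum_(x : n.-tuple bool) (f x)%:R) / 2 ^+ n :> R)%R.
Proof.
move=> uF gF; have sF : size F = n by rewrite -(perm_size gF) size_map size_iota.
have gin (i : 'I_n) : g i \in F.
  by rewrite -(perm_mem gF); apply: map_f; rewrite mem_iota /=.
have ug : uniq [seq g i | i <- iota 0 n] by rewrite (perm_uniq gF).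
have sg (i : 'I_n) : index (g i) F < n by rewrite -{2}sF index_mem.
pose s i := Ordinal (sg i).
have sinj : injective s.
  move=> i j /(congr1 val) /= e.
  have {e} : g i = g j by rewrite -(nth_index 0 (gin i)) e nth_index.
  move=> e; apply: val_inj => /=; apply/eqP.
  have := nth_uniq 0 (_ : i < size [seq g i | i <- iota 0 n])
    (_ : j < size [seq g i | i <- iota 0 n]) ug.
  rewrite size_map size_iota !ltn_ord => /(_ isT isT).
  by rewrite !(nth_map 0) ?size_iota // !nth_iota // !add0n e eqxx => <-.
pose h (u : n.-tuple bool) := [tuple tnth u (s i) | i < n].
have hinj : injective h.
  move=> u v huv; apply: eq_from_tnth => j.
  have [s' _ s'K] := injF_bij sinj.
  have := congr1 (fun t => tnth t (s' j)) huv.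
  by rewrite !tnth_mktuple s'K.
rewrite sF avg_tuple [in RHS](reindex_inj hinj) /=; congr (_ / _)%R.
apply: eq_bigr => u _; congr ((f _)%:R)%R; apply: eq_from_tnth => i.
by rewrite !tnth_mktuple /update gin (tnth_nth false).
Qed.

End Hybrid.

(** * The error of the generator for a given reading order *)

Section Fooling.
Variable R : realFieldType.
Local Open Scope nat_scope.

Variables (n k w bw be : nat) (S : seq 'I_n).
Hypothesis k_gt1 : 1 < k.
Hypothesis S_count : forall i : 'I_n, count_mem i S <= k.

Definition values : seq nat := [seq val i | i <- S].
Let wd := word n k values.
Let u := first_occ wd.
Definition var_parts := parts (key u) (dom u) k.

Lemma values_lt : all (ltn^~ n) values.
Proof. by apply/allP => v /mapP[i _ ->]; exact: ltn_ord. Qed.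

Lemma count_values v : count_mem v values <= k.
Proof.
have [vn|vn] := ltnP v n.
  apply: leq_trans (S_count (Ordinal vn)); rewrite count_map.
  by rewrite leq_eqVlt; apply/orP; left; apply/eqP/eq_count.
rewrite (eqP (_ : count_mem v values == 0)) // -leqn0 leqNgt -has_count has_pred1.
by apply/negP => /(allP values_lt); rewrite /= ltnNge vn.
Qed.

Lemma var_partsP :
  [/\ perm_eq (flatten var_parts) (dom u),
      forall p, p \in var_parts -> [/\ ~~ nilp p, subseq p (dom u),
        forall j, j < k -> monotone (key u j) p
        & forall j j', j < j' < k -> codirected (key u j) (key u j') p ->
            overlap_trans (key u j) (key u j') p],
      exists N, size var_parts <= 2 ^ (k * k.-1) * N /\
        N ^ (2 ^ k.-1) <= 8 ^ (2 ^ k.-1) * n ^ (2 ^ k.-1 - 1)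
    & size var_parts <= n].
Proof.
have k0 : 0 < k by exact: ltnW.
have occk x : x \in dom u -> k <= size (occ u x) by move=> xu; apply: size_occ_word values_lt xu.
have <- : size (dom u) = n.
  by rewrite -(perm_size (perm_dom k0 values_lt)) size_map size_iota.
apply: partsP => //.
- exact: pairwise_dom.
- by move=> x xu; exact: key0.
- move=> x j j' xu jj jk; apply: key_lt => //; exact: leq_trans (occk x xu).
- move=> x y j j' xu yu jk jk'; apply: key_neq.
    exact: leq_trans (occk x xu).
  exact: leq_trans (occk y yu).
Qed.

Definition output (y : seq bool) : n.-tuple bool :=
  [tuple nth false (generate n k bw be values y) i | i < n].

Lemma val_output y : output y = generate n k bw be values y :> seq bool.
Proof.
apply: (@eq_from_nth _ false); first by rewrite size_tuple size_map size_iota.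
move=> i; rewrite size_tuple => i_n.
by rewrite -[i]/(val (Ordinal i_n)) -tnth_nth tnth_mktuple.
Qed.

Definition seed_length :=
  let l := (half_length n k bw be).*2 in
  size var_parts * (l + levels n * (l + l + l)).

Lemma uniq_flatten_parts : uniq (flatten var_parts).
Proof.
have [pD _ _ _] := var_partsP.
by rewrite (perm_uniq pD) pairwise_ltn_uniq // pairwise_dom.
Qed.

Lemma half_length_gt0 : 0 < half_length n k bw be.
Proof. by rewrite /half_length; nia. Qed.

Lemma generator_error (B : branching_program n) (f : n.-tuple bool -> bool) :
  w.+2 <= 2 ^ (bw + 1) ->
  reading_order B S -> bp_width B <= w -> bp_computes B f ->
  (`|avg seed_length (fun y => (f (output y))%:R)
     - (\sum_(x : n.-tuple bool) (f x)%:R) / 2 ^+ n| <= 2 ^- be :> R)%R.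
Proof.
move=> wbw ro wB fB; have [pD pP _ Pn] := var_partsP.
have k0 : 0 < k by exact: ltnW.
pose Phi (rho : nat -> bool) := f [tuple rho (index (i : nat) wd) | i < n].
set m := half_length n k bw be; pose L := levels n.
have outE y : f (output y) = Phi (seeded m.*2 L var_parts y).
  congr f; apply: eq_from_tnth => i; rewrite !tnth_mktuple.
  rewrite (nth_map 0) ?size_iota // nth_iota // add0n.
  by rewrite has_assign ?uniq_flatten_parts //= addnn.
under eq_avg => y _ do rewrite outE.
have [tau [q0 [acc aP]]] := bp_automaton ro wB fB.
have rect T rho : T \in var_parts ->
    rectangular (w.+2 ^ (9 * (k * k) + 2)) (fun z => Phi (update T rho z)).
  move=> TP; have [_ Tu Tm Tt] := pP T TP.
  have Tin x : x \in T -> x \in dom u by exact: (mem_subseq Tu).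
  have occk x : x \in T -> k <= size (occ u x).
    by move=> /Tin xu; apply: size_occ_word values_lt xu.
  (* The automaton reads at time [t] the variable named [nth 0 u t]. *)
  have -> : (fun z => Phi (update T rho z)) =
      accepts (size S) tau q0 acc (fun t => nth 0 u t) T rho.
    apply/funext => z; apply: aP => t i St.
    have tS : t < size S by rewrite -onthTE St.
    have tv : t < size values by rewrite size_map.
    rewrite tnth_mktuple /u nth_first_occ; last by rewrite size_cat ltn_addr.
    congr (update _ _ _ (index _ _)); rewrite nth_cat tv /values (nth_map i) //.
    by have -> : nth i S t = i by exact: onth_nth.
  apply: (@rectangular_accepts _ _ k _ _ _ _ (key u)) => //.
  - exact: subseq_pairwise_ltn Tu (pairwise_dom _).
  - by move=> x j j' xT /andP[jj jk]; apply: key_lt => //; exact: leq_trans (occk x xT).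
  - move=> x y j j' xT yT jk jk'; apply: key_neq.
      exact: leq_trans (occk x xT).
    exact: leq_trans (occk y yT).
  - move=> t tS _; apply: key_cover; first exact: count_values.
    by rewrite size_map.
have sT T : T \in var_parts -> size T <= 2 ^ L.
  move=> TP; have [_ Tu _ _] := pP T TP.
  apply: leq_trans (levels_ge n); apply: leq_trans (size_subseq Tu) _.
  by rewrite -(perm_size (perm_dom k0 values_lt)) size_map size_iota.
have := hybrid R half_length_gt0 uniq_flatten_parts sT rect.
rewrite -/m -/L (@avg_update R n _ f (fun i => index i wd)) ?uniq_flatten_parts //; last first.
  by apply: perm_trans (perm_dom k0 values_lt) _; rewrite perm_sym.
move=> h; apply: le_trans h _.
set K := w.+2 ^ _.
have K2 : K <= 2 ^ ((9 * (k * k) + 2) * (bw + 1)).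
  by rewrite mulnC expnM leq_exp2r // addn2.
have P2 : size var_parts <= 2 ^ L by exact: leq_trans Pn (levels_ge n).
(* [half_length] is made for this product: [2 ^ L] for the parts, [2 ^ L] for the recursion tree,
   then the rectangles and the accuracy. *)
have nat_le : size var_parts * 2 ^ L * K * 2 ^ be <= 2 ^ m.
  apply: (@leq_trans (2 ^ L * 2 ^ L * 2 ^ ((9 * (k * k) + 2) * (bw + 1)) * 2 ^ be)).
    by rewrite !leq_mul.
  by rewrite -!expnD leq_exp2l // /m /half_length -/L; lia.
clearbody K; rewrite -(ler_nat R) !natrM !natrX in nat_le.
have m0 : (0 < 2 ^+ m :> R)%R by rewrite exprn_gt0.
have b0 : (0 < 2 ^+ be :> R)%R by rewrite exprn_gt0.
rewrite !mulrA ler_pdivrMr // -(ler_pM2r b0).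
rewrite [leRHS]mulrAC mulVf ?mul1r; first exact: nat_le.
by rewrite gt_eqF.
Qed.

End Fooling.

(** * Seed length *)

Section Bounds.
Variable R : realType.

Definition log2 (x : R) : R := ln x / ln 2.

Lemma ln2_gt0 : 0 < ln 2 :> R.
Proof. by rewrite ln_gt0 // ltr1n. Qed.

Lemma log2M x y : 0 < x -> 0 < y -> log2 (x * y) = log2 x + log2 y.
Proof. by move=> x0 y0; rewrite /log2 lnM ?posrE // mulrDl. Qed.

Lemma log2_nat m : log2 (2 ^+ m) = m%:R.
Proof.
rewrite /log2 lnXn ?ltr0n // -[ln 2 *+ m]mulr_natl mulfK //.
by rewrite gt_eqF // ln2_gt0.
Qed.

Lemma ler_log2 x y : 0 < x -> x <= y -> log2 x <= log2 y.
Proof.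
move=> x0 xy; rewrite /log2 ler_pM2r ?invr_gt0 ?ln2_gt0 // ler_ln ?posrE //.
exact: lt_le_trans xy.
Qed.

Lemma log2_ge (m : nat) x : 2 ^+ m <= x -> m%:R <= log2 x.
Proof. by move=> mx; rewrite -log2_nat; apply: ler_log2 => //; rewrite exprn_gt0. Qed.

Lemma lgE x : lg x = Num.max 1 (log2 x). Proof. by []. Qed.

Lemma lg_ge1 (x : R) : 1 <= lg x.
Proof. by rewrite lgE le_max lexx. Qed.

Lemma lg_ge_log2 (x : R) : log2 x <= lg x.
Proof. by rewrite lgE le_max lexx orbT. Qed.

Lemma up_log_le_log2 m : (0 < m)%N -> (up_log 2 m.+1)%:R <= 1 + log2 m%:R.
Proof.
move=> m0; have := up_log_gtn (isT : (1 < 2)%N) (m0 : (1 < m.+1)%N).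
have : (0 < up_log 2 m.+1)%N by rewrite up_log_gt0.
case: (up_log 2 m.+1) => // l _ /=; rewrite ltnS => lm.
rewrite -natr1 addrC lerD2l; apply: log2_ge.
by rewrite -natrX ler_nat.
Qed.

Lemma levels_le_log2 n : (0 < n)%N -> (levels n)%:R <= 2 + log2 n%:R.
Proof.
move=> n0; have h := levels_le n.
have -> : 2 + log2 n%:R = log2 ((4 * n)%N%:R).
  rewrite natrM log2M ?ltr0n // (_ : 4%:R = 2 ^+ 2) ?log2_nat //.
  by rewrite -natrX.
apply: log2_ge; rewrite -natrX ler_nat; lia.
Qed.

Lemma root_bound (N n j : nat) : (0 < n)%N ->
  (N ^ (2 ^ j) <= 8 ^ (2 ^ j) * n ^ (2 ^ j - 1))%N ->
  N%:R <= 8 * n%:R `^ (1 - 2 ^- j) :> R.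
Proof.
move=> n0 h; have e0 : (0 < 2 ^ j)%N by rewrite expn_gt0.
rewrite -(ler_pXn2r e0) ?nnegrE ?mulr_ge0 ?powR_ge0 //.
rewrite exprMn -[X in _ <= _ * X]powR_mulrn ?powR_ge0 // -powRrM.
have -> : (1 - 2 ^- j) * (2 ^ j)%:R = (2 ^ j - 1)%:R :> R.
  by rewrite mulrBl mul1r natrX mulVf ?expf_neq0 ?pnatr_eq0 // natrB // natrX.
by rewrite powR_mulrn // -!natrX -natrM ler_nat.
Qed.

Lemma pow2_le_expR m : (2 ^ m)%:R <= expR (m%:R : R).
Proof.
rewrite -[m%:R]mulr1 expRM_natl natrX lerXn2r ?nnegrE ?expR_ge0 //.
by have := expR_ge1Dx (1 : R); lra.
Qed.

Lemma ceil_bounds (eps : R) : 0 < eps ->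
  eps^-1 <= `|Num.ceil eps^-1|%N%:R /\ `|Num.ceil eps^-1|%N%:R <= eps^-1 + 1.
Proof.
move=> e0; have i0 : 0 < eps^-1 by rewrite invr_gt0.
have c0 : (0 <= Num.ceil eps^-1)%R by rewrite ceil_ge0 (lt_trans _ i0) // ltrN10.
have -> : `|Num.ceil eps^-1|%N%:R = (Num.ceil eps^-1)%:~R :> R.
  by rewrite natr_absz ger0_norm.
split; first exact: ceil_ge.
by have /andP[h _] := ceil_itv eps^-1; move: h; rewrite intrB ltrBlDr => /ltW.
Qed.

End Bounds.

Section SeedLength.
Variable R : realType.

Definition binary (m : nat) : seq bool :=
  [seq odd (m %/ 2 ^ i)%N | i <- iota 0 (up_log 2 m.+1)].

Lemma size_binary m : size (binary m) = up_log 2 m.+1.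
Proof. by rewrite size_map size_iota. Qed.

(** 33 is [11 * 3]: [9 k^2 + 2 <= 11 k^2], and the bit length of [w] plus 1 is at most [3 lg w]. The
    leading factor [k] is absorbed by [exp(k^2)] later. *)
Lemma half_length_le (n k w : nat) (eps : R) :
  (0 < n)%N -> (1 < k)%N -> (1 < w)%N -> 0 < eps -> eps < 1 ->
  (half_length n k (up_log 2 w.+1) (up_log 2 `|Num.ceil eps^-1|%N.+1))%:R
  <= 33 * k%:R * (lg (n%:R / eps) + k%:R * lg w%:R).
Proof.
move=> n0 k1 w1 e0 e1.
have [c1 c2] := ceil_bounds e0; set c := `|_|%N in c1 c2 *.
have i1 : 1 < eps^-1 by rewrite invf_gt1.
have c0 : (0 < c)%N by rewrite -(ltr_nat R); apply: lt_le_trans c1; apply: lt_trans i1.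
have be := up_log_le_log2 R c0; have bw := up_log_le_log2 R (ltnW w1).
have hL := levels_le_log2 R n0.
have hc : log2 c%:R <= 1 + log2 eps^-1.
  have one : log2 (2 : R) = 1 by have := log2_nat R 1; rewrite expr1.
  rewrite -[X in X + _]one -log2M ?invr_gt0 //; apply: ler_log2; first by rewrite ltr0n.
  lra.
have ng : log2 n%:R + log2 eps^-1 <= lg (n%:R / eps).
  by rewrite -log2M ?ltr0n ?invr_gt0 //; exact: lg_ge_log2.
have a0 : 0 <= log2 (n%:R : R) by apply: (@log2_ge R 0); rewrite expr0 ler1n.
have b0 : 0 <= log2 eps^-1 by apply: (@log2_ge R 0); rewrite expr0 ltW.
have g1 := lg_ge1 (n%:R / eps); have w1' := lg_ge1 (w%:R : R).
have lw := lg_ge_log2 (w%:R : R).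
have k2 : 2 <= k%:R :> R by rewrite ler_nat.
rewrite /half_length !natrD !natrM !natrD !natrM.
move: (lg (n%:R / eps)) (lg (w%:R : R)) (log2 n%:R) (log2 eps^-1) (log2 w%:R)
  (log2 c%:R) (levels n)%:R (up_log 2 w.+1)%:R (up_log 2 c.+1)%:R (k%:R : R)
  be bw hL hc ng a0 b0 g1 w1' lw k2 => g lw a b lw' lc L bw be q.
move=> hbe hbw hL hc ng a0 b0 g1 w1' lw1 q2.
have h1 : 2 * L + be <= 8 * g by lra.
have h2 : (9 * (q * q) + 2) * (bw + 1) <= 33 * (q * q) * lw.
  apply: (@le_trans _ _ ((9 * (q * q) + 2) * (3 * lw))).
    apply: ler_wpM2l; last by lra.
    by rewrite addr_ge0 // mulr_ge0 // mulr_ge0; lra.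
  have qq : 1 * 1 <= q * q by apply: ler_pM; lra.
  by rewrite mulrA; apply: ler_wpM2r; lra.
have h3 : 8 * g <= 33 * q * g by rewrite ler_wpM2r //; lra.
have -> : 33 * q * (g + q * lw) = 33 * q * g + 33 * (q * q) * lw by ring.
lra.
Qed.

Lemma seed_bound_ge0 (n k w : nat) (eps : R) : 0 <= seed_bound n k w eps.
Proof.
have g1 := lg_ge1 (n%:R / eps); have lw1 := lg_ge1 (w%:R : R).
have ln1 := lg_ge1 (n%:R : R).
apply: mulr_ge0.
  by apply: mulr_ge0; [apply: mulr_ge0; [exact: expR_ge0 | exact: powR_ge0] | lra].
by apply: addr_ge0; [lra | apply: mulr_ge0 => //; lra].
Qed.

(** 5280 is [2 * 8 * 33 * 10]: 2 for doubling the half length, 8 from [root_bound], 33 from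
    [half_length_le], and 10 from [1 + 3 * levels n <= 10 lg n]. *)
Lemma seed_length_le (n k w : nat) (eps : R) (S : seq 'I_n) :
  (1 < k)%N -> (1 < w)%N -> 0 < eps -> eps < 1 ->
  (forall i : 'I_n, (count_mem i S <= k)%N) ->
  (seed_length k (up_log 2 w.+1) (up_log 2 `|Num.ceil eps^-1|%N.+1) S)%:R
  <= 5280 * seed_bound n k w eps.
Proof.
move=> k1 w1 e0 e1 Sk; have [_ _ [N [PN Nb]] Pn] := var_partsP S k1.
have g1 := lg_ge1 (n%:R / eps); have lw1 := lg_ge1 (w%:R : R).
have ln1 := lg_ge1 (n%:R : R).
have sb0 := seed_bound_ge0 n k w eps.
have [n0|n0] := posnP n.
  rewrite /seed_length; have -> : size (var_parts k S) = 0%N.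
    by apply/eqP; rewrite -leqn0 -[X in (_ <= X)%N]n0.
  by rewrite mul0n mulr_ge0 ?ler0n.
have := half_length_le n0 k1 w1 e0 e1; rewrite /seed_length /seed_bound.
move: (half_length _ _ _ _) => m hm.
have hL := levels_le_log2 R n0.
have hN := root_bound R n0 Nb.
have {}PN : (size (var_parts k S))%:R <= (2 ^ (k * k.-1))%:R * N%:R :> R.
  by rewrite -natrM ler_nat.
have l2 := lg_ge_log2 (n%:R : R).
(* [k <= 2 ^ k] and [k + k(k-1) = k^2]. *)
have kE : k%:R * (2 ^ (k * k.-1))%:R <= expR (k%:R ^+ 2) :> R.
  apply: (le_trans _ (_ : (2 ^ (k ^ 2))%:R <= _)); last first.
    by rewrite -natrX pow2_le_expR.
  rewrite -natrM ler_nat.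
  have -> : (k ^ 2 = k + k * k.-1)%N by rewrite -mulnS (prednK (ltnW k1)) mulnn.
  by rewrite expnD leq_mul2r ltnW ?orbT // ltn_expl.
rewrite -muln2 !natrM !natrD !natrM !natrD !natrM.
set P := (size _)%:R in PN *; set L := (levels n)%:R in hL *.
set v := n%:R `^ _ in hN *; set X := lg (n%:R / eps) + _ in hm *.
have P0 : 0 <= P by [].
have m0 : 0 <= m%:R :> R by [].
have L0 : 0 <= L by [].
have v0 : 0 <= v by exact: powR_ge0.
have X0 : 0 <= X by apply: addr_ge0; [lra | apply: mulr_ge0 => //; lra].
set q := k%:R : R in hm kE *; set e2 := (2 ^ (k * k.-1))%:R in PN kE.
set E := expR _ in kE *; set lam := lg n%:R in l2 ln1 *.
have q0 : 0 <= q by [].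
have e20 : 0 <= e2 by rewrite /e2.
have h1 : P <= 8 * e2 * v.
  by apply: (le_trans PN); rewrite [8 * e2]mulrC -mulrA ler_wpM2l.
have h2 : 1 + 3 * L <= 10 * lam by lra.
have -> : P * (m%:R * 2 + L * (m%:R * 2 + m%:R * 2 + m%:R * 2)) =
    2 * (P * (m%:R * (1 + 3 * L))) by ring.
have h3 : m%:R * (1 + 3 * L) <= 33 * q * X * (10 * lam).
  by apply: ler_pM => //; lra.
have h4 : P * (m%:R * (1 + 3 * L)) <= 8 * e2 * v * (33 * q * X * (10 * lam)).
  by apply: ler_pM => //; apply: mulr_ge0 => //; lra.
have -> : 5280 * (E * v * lam * X) = 2 * (8 * (33 * 10)) * (v * lam * X) * E by ring.
apply: (@le_trans _ _ (2 * (8 * (33 * 10)) * (v * lam * X) * (q * e2))).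
  apply: le_trans (_ : 2 * (8 * e2 * v * (33 * q * X * (10 * lam))) <= _).
    by rewrite ler_pM2l.
  by rewrite le_eqVlt; apply/orP; left; apply/eqP; ring.
rewrite ler_wpM2l //; apply: mulr_ge0; first by lra.
by apply: mulr_ge0 => //; apply: mulr_ge0 => //; lra.
Qed.

End SeedLength.

(** * Length of the input in terms of the parameters *)

Section Time.
Local Open Scope nat_scope.

Lemma csize_bits (s : seq bool) : csize s <= 4 * size s + 1.
Proof.
rewrite addn1 mulnC; apply: csize_seq_le; apply/allP => b _; exact: csize_bool.
Qed.

Lemma size_sum_count (n : nat) (S : seq 'I_n) :
  size S = \sum_(i < n) count_mem i S.
Proof.
elim: S => [|x S IHS] /=; first by rewrite big1.
rewrite big_split /= -IHS (bigD1 x) //= eqxx big1 // => i /negbTE.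
by rewrite eq_sym => ->.
Qed.

Lemma levels_le_double n : levels n <= 2 * n.
Proof.
have := levels_le n; have := ltn_expl (levels n) (isT : 1 < 2); lia.
Qed.

(** The seed is part of the input, so its length must be polynomial in the parameters as well. 224
    is [2 * 16 * 7]: the half length is at most [16 V^3], and [1 + 3 * levels n <= 7 V]. *)
Lemma seed_length_poly (n k bw be : nat) (S : seq 'I_n) : 1 < k ->
  (forall i : 'I_n, count_mem i S <= k) ->
  seed_length k bw be S <= 224 * (n + k + bw + be + 1) ^ 5.
Proof.
move=> k1 Sk; have [_ _ _ Pn] := var_partsP S k1.
have hL := levels_le_double n; rewrite /seed_length /half_length -muln2.
set P := size _ in Pn *; set L := levels n in hL *; set V := n + k + bw + be + 1.
have V1 : 1 <= V by rewrite /V addn1.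
have nV : n <= V by rewrite /V; lia.
have kV : k <= V by rewrite /V; lia.
have bV : bw + 1 <= V by rewrite /V; lia.
have eV : be <= V by rewrite /V; lia.
have V2 : V <= V * V by rewrite leq_pmulr.
have V3 : V * V <= V * V * V by rewrite leq_pmulr.
have kk : 9 * (k * k) + 2 <= 11 * (V * V).
  by have := leq_mul kV kV; lia.
set m := 2 * L + _ + be.
have hm : m <= 16 * (V * V * V).
  have := leq_mul kk bV; rewrite /m -[11 * _ * V]mulnA; lia.
have -> : 224 * V ^ 5 = V * (2 * (16 * (V * V * V)) * (7 * V)).
  by rewrite !expnS expn0; lia.
apply: leq_mul; first exact: leq_trans Pn nV.
have -> : m * 2 + L * (m * 2 + m * 2 + m * 2) = 2 * m * (1 + 3 * L) by lia.
apply: leq_mul; first by rewrite leq_mul2l hm.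
by lia.
Qed.

Lemma csize_input_le (n k : nat) (wb eb y : seq bool) (S : seq 'I_n) :
  (forall i : 'I_n, count_mem i S <= k) ->
  size y <= 224 * (n + k + size wb + size eb + 1) ^ 5 ->
  (csize (n, (k, (wb, (eb, (values S, (y, tt))))))).+1
    <= 1000 * (n + k + size wb + size eb + 1) ^ 5.
Proof.
move=> Sk hy; rewrite !csize_pair /=.
have hw := csize_bits wb; have he := csize_bits eb; have hyb := csize_bits y.
have hS : csize (values S) <= (size S * (4 * n + 2)).+1.
  have := @csize_seq_le _ _ (4 * n + 1) (values S).
  rewrite size_map -addnS; apply; apply/allP => v /(allP (values_lt S)) /= vn.
  by rewrite csize_natE addn1 ltnS leq_mul2l ltnW ?orbT.
have Snk : size S <= n * k.
  rewrite size_sum_count -[n in n * k]card_ord -sum_nat_const.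
  by apply: leq_sum => i _.
rewrite !csize_natE; rewrite [csize tt]/csize /=.
set V := n + k + size wb + size eb + 1 in hy *.
have V1 : 1 <= V by rewrite /V addn1.
have h1 : n + k + size wb + size eb + 1 = V by [].
have V2 : V <= V * V by rewrite leq_pmulr.
have V3 : V * V <= V * V * V by rewrite leq_pmulr.
have V5 : V * V * V <= V ^ 5.
  by rewrite !expnS expn0 muln1 !mulnA -[leqLHS]muln1 -[V * V * V * V * V]mulnA leq_mul // muln_gt0 V1.
have hS2 : size S * (4 * n + 2) <= 4 * (V * V * V).
  have : size S * (4 * n + 2) <= V * V * (4 * V).
    apply: leq_mul; last by rewrite /V; lia.
    by apply: leq_trans Snk _; apply: leq_mul; rewrite /V; lia.
  by rewrite mulnCA.
move: (V ^ 5) (V * V * V) (V * V) h1 hy V1 V2 V3 V5 hS2 hS hw he hyb.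
move=> v5 v3 v2 h1 hy V1 V2 V3 V5 hS2 hS hw he hyb.
move: (csize wb) (csize eb) (csize (values S)) (csize y) hw he hS hyb => a b c d; lia.
Qed.

End Time.

Section Assembly.
Variable R : realType.

Lemma generator_input_code (n k w : nat) (eps : R) (S : seq 'I_n) (y : seq bool) :
  code (n, (k, (binary w, (binary `|Num.ceil eps^-1|%N, (values S, (y, tt))))))
    = generator_input k w eps S y.
Proof.
rewrite /generator_input /=.
have -> : enc_seq (fun i : 'I_n => enc_unary i) S = code (values S).
  by elim: S => //= i S' ->.
by [].
Qed.

Lemma input_size_le (n k w : nat) (eps : R) : (1 < w)%N -> 0 < eps ->
  (n + k + up_log 2 w.+1 + up_log 2 `|Num.ceil eps^-1|%N.+1 + 1)%:R
    <= 4 * time_parameter n k w eps.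
Proof.
move=> w1 e0; have [c1 c2] := ceil_bounds e0; set c := `|_|%N in c1 c2 *.
have i0 : 0 < eps^-1 by rewrite invr_gt0.
have c0 : (0 < c)%N by rewrite -(ltr_nat R); apply: lt_le_trans c1.
have be := up_log_le_log2 R c0; have bw := up_log_le_log2 R (ltnW w1).
have gw := lg_ge_log2 (w%:R : R); have gw1 := lg_ge1 (w%:R : R).
have ge := lg_ge_log2 eps^-1; have ge1 := lg_ge1 eps^-1.
have one : log2 (2 : R) = 1 by have := log2_nat R 1; rewrite expr1.
have hc : log2 c%:R <= 2 * lg eps^-1.
  (* For [eps >= 1] the ceiling is at most 2, which the truncation of [lg] at 1 covers. *)
  have [l1|l1] := leP eps^-1 1.
    apply: (@le_trans _ _ (log2 2)); first by apply: ler_log2; rewrite ?ltr0n //; lra.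
    by rewrite one; lra.
  apply: (@le_trans _ _ (log2 (2 * eps^-1))).
    by apply: ler_log2; rewrite ?ltr0n //; lra.
  by rewrite log2M // one; lra.
rewrite /time_parameter !natrD.
have n0 : 0 <= n%:R :> R by [].
have k0 : 0 <= k%:R :> R by [].
lra.
Qed.

Lemma pow_up_log_ceil_le (eps : R) : 0 < eps ->
  2 ^- up_log 2 `|Num.ceil eps^-1|%N.+1 <= eps.
Proof.
move=> e0; have [c1 _] := ceil_bounds e0.
rewrite invf_ple ?posrE ?exprn_gt0 //; apply: (le_trans c1).
by rewrite -natrX ler_nat ltnW // up_logP.
Qed.

Lemma prob_unif_itv m (E : pred (m.-tuple bool)) :
  0 <= prob_unif R E <= 1.
Proof.
rewrite /prob_unif divr_ge0 ?exprn_ge0 //= ler_pdivrMr ?exprn_gt0 // mul1r.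
rewrite -natrX ler_nat; apply: leq_trans (max_card _) _.
by rewrite card_tuple card_bool.
Qed.

Lemma seed_length_error (n k w : nat) (eps : R) (S : seq 'I_n)
    (B : branching_program n) (f : n.-tuple bool -> bool) :
  let bw := up_log 2 w.+1 in let be := up_log 2 `|Num.ceil eps^-1|%N.+1 in
  (1 < k)%N -> 0 < eps -> (forall i : 'I_n, (count_mem i S <= k)%N) ->
  reading_order B S -> (bp_width B <= w)%N -> bp_computes B f ->
  `| prob_unif R (fun y : (seed_length k bw be S).-tuple bool => f (output k bw be S y))
     - prob_unif R f | <= eps.
Proof.
move=> bw be k1 e0 Sk ro wB fB; apply: le_trans (pow_up_log_ceil_le e0).
have ww : (w.+2 <= 2 ^ (bw + 1))%N.
  rewrite addn1 expnS; have : (w.+1 <= 2 ^ bw)%N by exact: up_logP.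
  by move: (2 ^ bw)%N => q; lia.
have := generator_error R be k1 Sk ww ro wB fB.
rewrite -(@prob_avg R _ (fun y : (seed_length k bw be S).-tuple bool => f (output k bw be S y))) //.
suff -> : \sum_x (f x)%:R = #|f|%:R :> R by [].
by rewrite -sum1_card natr_sum [RHS]big_mkcond; apply: eq_bigr => x _; rewrite unfold_in; case: (f x).
Qed.

End Assembly.

Theorem theorem1p1 (R : realType) :
  exists (C : R) (A : cmd) (c : nat),
  forall (k n w : nat) (eps : R) (S : seq 'I_n),
    (2 <= k)%N -> (2 <= w)%N -> 0 < eps ->
    (forall i : 'I_n, (count_mem i S <= k)%N) ->
    exists (s : nat) (G : s.-tuple bool -> n.-tuple bool),
      [/\ s%:R <= C * seed_bound n k w eps,
          forall y : s.-tuple bool, exists t : nat,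
            t%:R <= c%:R * time_parameter n k w eps ^+ c /\
            outputs_in_time A (generator_input k w eps S y) t (enc_bits (G y))
        & forall (B : branching_program n) (f : n.-tuple bool -> bool),
            oblivious B -> read_at_most B k -> reading_order B S ->
            (bp_width B <= w)%N -> bp_computes B f ->
            `| prob_unif R (fun y : s.-tuple bool => f (G y))
               - prob_unif R f | <= eps].
Proof.
have [A [e Ae]] := generate_outputs_in_time.
(* 40 is [10 * 4]: the input length is at most [(10 V) ^ 5], and [V] is at most 4 times
   [time_parameter]. The number [c] serves as factor and as exponent, hence the sum. *)
exists 5280, A, (40 ^ (5 * e) + 5 * e)%N => k n w eps S k1 w1 e0 Sk.
pose bw := up_log 2 w.+1; pose be := up_log 2 `|Num.ceil eps^-1|%N.+1.
(* Two probabilities never differ by more than 1, so no seed is needed for [1 <= eps]. *)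
pose s := if eps < 1 then seed_length k bw be S else 0%N.
exists s, (fun y => output k bw be S y); split.
- rewrite /s; case: ifP => [e1|_]; first exact: seed_length_le.
  by rewrite mulr_ge0 ?ler0n // seed_bound_ge0.
- move=> y; have [t [tb At]] := Ae n k (binary w) (binary `|Num.ceil eps^-1|%N) y (values S).
  exists t; split; last by rewrite !size_binary in At; rewrite val_output -generator_input_code.
  have ys : (size y <= 224 * (n + k + bw + be + 1) ^ 5)%N.
    rewrite size_tuple /s; case: ifP => // _; exact: seed_length_poly.
  have := @csize_input_le n k (binary w) (binary `|Num.ceil eps^-1|%N) y S Sk.
  rewrite !size_binary -/bw -/be => /(_ ys) cb.
  have := input_size_le n k w1 e0; rewrite -/bw -/be.
  set V := (n + k + bw + be + 1)%N in cb *; set p := time_parameter _ _ _ _ => Vp.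
  have p1 : 1 <= p.
    rewrite /p /time_parameter; have := lg_ge1 (w%:R : R); have := lg_ge1 eps^-1.
    have n0 : 0 <= n%:R :> R by [].
    have k0 : 0 <= k%:R :> R by [].
    lra.
  have tV : (t <= (10 * V) ^ (5 * e))%N.
    apply: (leq_trans tb); rewrite expnM; case: (e) => // e'; rewrite leq_exp2r //.
    apply: leq_trans cb _; rewrite expnMn leq_mul2r; apply/orP; right.
    by apply: (@leq_trans (10 ^ 3)) => //; rewrite leq_pexp2l.
  apply: (@le_trans _ _ ((10 * V)%:R ^+ (5 * e) : R)); first by rewrite -natrX ler_nat.
  apply: (@le_trans _ _ ((40 * p) ^+ (5 * e))).
    by apply: lerXn2r; rewrite ?nnegrE ?natrM //; lra.
  rewrite exprMn; apply: ler_pM.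
  - by rewrite exprn_ge0.
  - by rewrite exprn_ge0 //; lra.
  - by rewrite -natrX ler_nat leq_addr.
  - by rewrite ler_weXn2l // leq_addl.
- move=> B f _ _ ro wB fB; rewrite /s; case: ifP => [_|/negbT]; first exact: seed_length_error.
  rewrite -leNgt => e1; apply: le_trans e1.
  set g := fun y => _; have /andP[a0 a1] := prob_unif_itv R g; have /andP[b0 b1] := prob_unif_itv R f.
  by rewrite ler_norml; apply/andP; split; lra.
Qed.
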